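(* Let $\mathfrak g$ be a complex simple Lie algebra not of type $\mathsf A_{2p}$ ($p\ge1$). Then $\min(\Delta_{\langle\mathcal K\rangle})=w_{\mathcal K}(\Pi_{\mathcal K}(-1))$. In other words, for $\gamma\in\Delta^+$, one has $\gamma\in\min(\Delta_{\langle\mathcal K\rangle})$ if and only if $w_{\mathcal K}^{-1}(\gamma)\in\Pi_{\mathcal K}(-1)$.
   Context: Let $\mathfrak g$ be a complex simple Lie algebra, $\mathfrak t$ a Cartan subalgebra, $\Delta$ the root system, $\Delta^+$ a fixed set of positive roots, $\Delta^-=-\Delta^+$, $\Pi$ the simple roots, $\theta$ the highest root, $W$ the Weyl group. Let $(\ ,\ )$ be the positive-definite form on the $\mathbb Q$-span of $\Delta$ induced by the Killing form; it is used to identify $\mathfrak t$ and $\mathfrak t^*$. For $\gamma\in\Delta$ put $\gamma^\vee=2\gamma/(\gamma,\gamma)$. The root order on $\Delta^+$: $\gamma\preccurlyeq\gamma'$ if $\gamma'-\gamma$ is a non-negative integral combination of simple roots. Kostant cascade $\mathcal K=\{\beta_1,\dots,\beta_m\}\subset\Delta^+$: it is defined recursively. Its first element is $\beta_1=\theta$. The root system $\Delta_\theta=\{\gamma\in\Delta\mid(\gamma,\theta)=0\}$ is decomposed into irreducible components, each with the set of positive roots inherited from $\Delta^+$; the highest roots of these components are added to $\mathcal K$, and the procedure is repeated for each component until it terminates. The cascade element is $x_{\mathcal K}=\frac12\sum_{i=1}^m\beta_i^\vee\in\mathfrak t$. If $\mathfrak g$ is not of type $\mathsf A_{2p}$, then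 $\gamma(x_{\mathcal K})\in\{-1,0,1,2\}$ for all $\gamma\in\Delta^+$. Put $\Delta^+_{\mathcal K}(i)=\{\gamma\in\Delta^+\mid\gamma(x_{\mathcal K})=i\}$ and $\Pi_{\mathcal K}(i)=\Pi\cap\Delta^+_{\mathcal K}(i)$. The element $w_{\mathcal K}\in W$ is the unique element with inversion set $\{\gamma\in\Delta^+\mid w_{\mathcal K}(\gamma)\in\Delta^-\}=\Delta^+_{\mathcal K}(1)\sqcup\Delta^+_{\mathcal K}(2)$. Put $\Delta_{\langle\mathcal K\rangle}=w_{\mathcal K}(\Delta^+_{\mathcal K}(-1))\sqcup w_{\mathcal K}(-\Delta^+_{\mathcal K}(2))\subset\Delta^+$; by a result of Kostant it is the set of roots of an abelian ideal $\mathfrak a_{\mathcal K}$ of the Borel subalgebra $\mathfrak b$, hence an upper ideal of $(\Delta^+,\preccurlyeq)$. $\min(\Delta_{\langle\mathcal K\rangle})$ is the set of its minimal elements with respect to $\preccurlyeq$. *)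

(* Defs.v *)
From HB Require Import structures.
From mathcomp Require Import all_boot all_order all_algebra.
From mathcomp Require Import complex.
From mathcomp Require Import boolp classical_sets functions fsbigop reals.

Set Implicit Arguments.
Unset Strict Implicit.
Unset Printing Implicit Defensive.

Import GRing.Theory.

Local Open Scope classical_set_scope.
Local Open Scope ring_scope.

(** * Lie algebras *)

Record lieAlgebra (F : fieldType) := LieAlgebra {
  lie_carrier :> vectType F;
  lie_br : lie_carrier -> lie_carrier -> lie_carrier;
  lie_br_linearl : forall y, linear (lie_br^~ y);
  lie_br_linearr : forall x, linear (lie_br x);
  lie_br_alt : forall x, lie_br x x = 0;
  lie_jacobi : forall x y z,
    lie_br x (lie_br y z) + lie_br y (lie_br z x) + lie_br z (lie_br x y) = 0
}.

Section LieAlgebras.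
Variables (F : fieldType) (g : lieAlgebra F).

Definition lie_ideal (I : {vspace g}) : Prop :=
  forall x y : g, y \in I -> lie_br x y \in I.

Definition lie_simple : Prop :=
  (exists x y : g, lie_br x y <> 0) /\
  (forall I : {vspace g}, lie_ideal I -> I = 0%VS \/ I = fullv).

Definition ad (x : g) : 'End(g) := linfun (lie_br x).

Definition killing (x y : g) : F :=
  \tr (passmx.mxof (vbasis fullv) (vbasis fullv) (ad x \o ad y)%VF).

Definition ad_diagonalizable (h : g) : Prop :=
  exists b : seq g, basis_of fullv b /\
    (forall x, x \in b -> exists c : F, lie_br h x = c *: x).

(* The usual definition for semisimple g: t is abelian, equal to its own
   centralizer, and acts diagonalizably on g. *)
Definition cartan_subalgebra (t : {vspace g}) : Prop :=
  [/\ forall x y : g, x \in t -> y \in t -> lie_br x y = 0,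
      forall x : g, (forall h, h \in t -> lie_br h x = 0) -> x \in t
    & forall h : g, h \in t -> ad_diagonalizable h].

Variable t : {vspace g}.

Definition lie_dual := 'Hom(subvs_of t, F^o).

Definition lie_roots : set lie_dual :=
  [set a | a != 0 /\
    exists2 x : g, x != 0 &
      forall h : subvs_of t, lie_br (vsval h) x = (a h : F) *: x].

(* The isomorphism t -> t^* given by the Killing form restricted to t. *)
Definition killing_iso : 'Hom(subvs_of t, lie_dual) :=
  linfun (fun h : subvs_of t =>
    linfun (fun h' : subvs_of t => killing (vsval h) (vsval h') : F^o)
      : lie_dual).

Definition killing_dual (a b : lie_dual) : F :=
  killing (vsval ((killing_iso^-1)%VF a)) (vsval ((killing_iso^-1)%VF b)).

End LieAlgebras.

Arguments lie_roots {F g} t _.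
Arguments killing_dual {F g} t a b.

(** * Root systems

   [B] is the bilinear form on the space [V] spanned by the roots; it
   identifies [V] with its dual, so that the value at [x] of the linear form
   given by [v] is [B v x]. *)

Section Roots.
Variables (F : fieldType) (V : vectType F) (B : V -> V -> F).
Implicit Types (D Dp P Psi C S : set V) (a b c v : V) (w : 'End(V)).

Definition coroot a : V := (2 / B a a) *: a.

Definition refl a : 'End(V) := linfun (fun v => v - B v (coroot a) *: a).

Inductive weyl D : 'End(V) -> Prop :=
| weyl_id : weyl D \1%VF
| weyl_refl a w : D a -> weyl D w -> weyl D (refl a \o w)%VF.

Definition positive_system D Dp : Prop :=
  [/\ forall a, D a <-> Dp a \/ Dp (- a),
      forall a, Dp a -> ~ Dp (- a)
    & forall a b, Dp a -> Dp b -> D (a + b) -> Dp (a + b)].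

Definition simple_roots P : set V :=
  [set a | P a /\ ~ (exists b c, [/\ P b, P c & a = b + c])].

(* [b - a] is a non-negative integral combination of elements of [S]; the list
   [s] may have repetitions. *)
Definition root_le S a b : Prop :=
  exists s : seq V, (forall c, c \in s -> S c) /\ b - a = \sum_(c <- s) c.

Definition highest_root P b : Prop :=
  P b /\ forall a, P a -> root_le (simple_roots P) a b.

Definition orthogonal_sets C C' : Prop :=
  forall a b, C a -> C' b -> B a b = 0.

Definition irreducible C : Prop :=
  C !=set0 /\
  forall C', C' `<=` C -> orthogonal_sets C' (C `\` C') ->
    C' = set0 \/ C' = C.

Definition irr_component Psi C : Prop :=
  [/\ C `<=` Psi, irreducible C & orthogonal_sets C (Psi `\` C)].

(* The irreducible subsystems encountered in the construction of the cascade,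
   starting from an irreducible [D]. *)
Inductive cascade_system D Dp : set V -> Prop :=
| cascade_start : cascade_system D Dp D
| cascade_step Psi b C :
    cascade_system D Dp Psi -> highest_root (Psi `&` Dp) b ->
    irr_component [set a | Psi a /\ B a b = 0] C ->
    cascade_system D Dp C.

Definition kostant_cascade D Dp : set V :=
  [set b | exists Psi, cascade_system D Dp Psi /\ highest_root (Psi `&` Dp) b].

Definition cascade_element D Dp : V :=
  2^-1 *: \sum_(b \in kostant_cascade D Dp) coroot b.

Definition pos_cascade D Dp (i : int) : set V :=
  [set a | Dp a /\ B a (cascade_element D Dp) = i%:~R].

Definition simple_cascade D Dp (i : int) : set V :=
  simple_roots Dp `&` pos_cascade D Dp i.

Definition inversion_set Dp w : set V := [set a | Dp a /\ Dp (- w a)].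

Definition cascade_ideal D Dp w : set V :=
  w @` pos_cascade D Dp (- 1) `|` [set w (- a) | a in pos_cascade D Dp 2].

Definition min_roots Dp S : set V :=
  [set a | S a /\ forall b, S b -> root_le (simple_roots Dp) b a -> b = a].

(* The Dynkin diagram is of type A_n. *)
Definition type_A Dp (n : nat) : Prop :=
  exists a : 'I_n -> V,
    [/\ injective a, range a = simple_roots Dp
      & forall i j, B (a i) (coroot (a j)) =
          if i == j then 2
          else if (i.+1 == j :> nat) || (j.+1 == i :> nat) then - 1 else 0].

End Roots.

(* Main.v *)
Require Import Defs.
From HB Require Import structures.
From mathcomp Require Import all_boot all_order all_algebra.
From mathcomp Require Import complex.
From mathcomp Require Import boolp classical_sets functions fsbigop reals.
From mathcomp Require Import cardinality ring zify.

Set Implicit Arguments.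
Unset Strict Implicit.
Unset Printing Implicit Defensive.

Import Order.TTheory GRing.Theory Num.Theory.
Import passmx.

Local Open Scope classical_set_scope.
Local Open Scope ring_scope.

(** Write [x] for the cascade element and [w] for [wK]. The theorem rests on one
    fact: every positive root takes a value in {-1, 0, 1, 2} at [x]. Granting
    it, [w^-1] sends every positive root to a root of value at most 0, and to a
    positive root if the value is 0. Let [a] be simple of value -1. If [w a] is
    the sum of an element of the ideal and of simple roots, apply [w^-1]: all
    terms have value at most 0, the first at most -1, and the total is -1; so
    all terms are positive roots and, as [a] is simple, there is only one. Thus
    [w a] is minimal. Conversely, if [a] is positive of value -1 but not simple,
    it splits into positive roots of values -1 and 0, and [w a] is not minimal.
    If [a] has value 2, then [a] is not the highest root, whose value is 1, so
    [a + f] is a root for some positive root [f], whose value is then 0 or -1;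
    and [w (- a) = w f + w (- (a + f))] shows that [w (- a)] is not minimal.
    This is [min_cascade_ideal].

    Put [n_b = <a, b^v>] and [m_b = <b, a^v>], for [b] in the cascade. The value
    of [a] at [x] is half of the sum of the [n_b]. Bessel's inequality for the
    orthogonal family of the cascade reads [sum n_b m_b <= 4]. A positive root
    [a] that is not in the cascade has [n_b = 1] for the first [b] that is not
    orthogonal to it, so the other [n_b] add up to at most 3 in absolute value;
    hence the value lies in [-1, 2] ([csum_bound]).

    That the value is an integer outside type A_2p is [cascade_parity]. The
    product [w0] of the reflections in the cascade makes all positive roots
    negative ([crefl_neg]), so [a' = - w0 a] is simple when [a] is, and [a + a']
    is the sum of the [n_b b]. Pairing with [a] gives [sum n_b m_b = 2 + <a',
    a^v>]. Let [th] be the highest root and let [a <> th] be simple and not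
    orthogonal to it. If [a' = a], the sum of the [n_b m_b] is 4, and strong
    orthogonality forces the sum of the [n_b] to be even. Otherwise [sum n_b
    m_b] is 1 or 2; the sum of the [n_b] is again even unless [th = a + a'],
    which is type A_2. A simple root orthogonal to [th] belongs to a component
    of the roots orthogonal to [th]; by induction its sum is even or the
    component is of type A_2p. In the latter case some simple [a] is attached to
    the component, the same count forces [a + a' = th - be], where [be] is the
    highest root of the component, and [a], [a'] extend its chain at the two
    ends: the system is of type A_(2p+2) ([att_extend]).

    It remains to see that the roots of a simple Lie algebra form an irreducible
    root system. Elements of the Cartan subalgebra act diagonalizably, so the
    whole algebra is the sum of its weight spaces. If [e], [f] have opposite
    weights [al] and [- al] and [h] is their bracket, then every weight is a
    rational multiple of [al] at [h] ([root_string]); so the Killing form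
    vanishes on [(h, h)] only if all weights vanish at [h], that is, if [h = 0].
    Were the Killing form zero, all such brackets would vanish and the root
    vectors would span a proper nonzero ideal ([killing_nondeg]). The same
    strings give the integrality, the reflections and the positivity of the
    form. *)

(** * Sums of vectors of a set *)

Definition nspan (V : zmodType) (P : set V) (v : V) : Prop :=
  exists2 s : seq V, {in s, forall c, P c} & v = \sum_(c <- s) c.

Lemma sum_rem (V : zmodType) (s : seq V) a : a \in s ->
  \sum_(c <- s) c = a + \sum_(c <- rem a s) c.
Proof. by move=> h; rewrite (big_rem a h). Qed.

Section NSpan.
Variable V : zmodType.
Implicit Types (P Q : set V) (u v : V).

Lemma nspan0 P : nspan P 0.
Proof. by exists [::]; rewrite ?big_nil. Qed.

Lemma nspan_in P v : P v -> nspan P v.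
Proof.
by move=> Pv; exists [:: v]; rewrite ?big_seq1// => c; rewrite inE => /eqP->.
Qed.

Lemma nspanD P u v : nspan P u -> nspan P v -> nspan P (u + v).
Proof.
move=> [s1 s1P ->] [s2 s2P ->]; exists (s1 ++ s2); last by rewrite big_cat.
by move=> c; rewrite mem_cat => /orP[/s1P|/s2P].
Qed.

Lemma nspanMn P v n : nspan P v -> nspan P (v *+ n).
Proof.
move=> Pv; elim: n => [|n IH]; first by rewrite mulr0n; exact: nspan0.
by rewrite mulrS; exact: nspanD.
Qed.

Lemma nspanS P Q v : P `<=` Q -> nspan P v -> nspan Q v.
Proof. by move=> PQ [s sP ->]; exists s => // c /sP/PQ. Qed.

End NSpan.

(** Identities between vectors reduce to identities between scalars, which the
    ring normalizer decides. *)
Lemma vect_ext (F : fieldType) (V : vectType F) (u v : V) :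
  (forall f : {linear V -> F^o}, f u = f v) -> u = v.
Proof.
move=> h; rewrite (coord_vbasis (memvf u)) (coord_vbasis (memvf v)).
by apply: eq_bigr => i _; rewrite (h (coord (vbasis fullv) i)).
Qed.

Ltac vring := let f := fresh in apply: vect_ext => f;
  rewrite ?(raddfD f, raddfN f, raddfMz f, raddfMn f, raddf0 f)/=; ring.

Lemma linfunE (F : fieldType) (aT rT : vectType F) (f : aT -> rT) : linear f -> linfun f =1 f.
Proof.
move=> lf; pose g : {linear aT -> rT} := HB.pack f (GRing.isLinear.Build _ _ _ _ f lf).
exact: (lfunE g).
Qed.

(** * Root systems *)
Section RootSystem.
Variables (F : numFieldType) (V : vectType F) (B : V -> V -> F).
Implicit Types (a b c u v : V) (s : seq V).

(** The integer [pr a b] is the pairing of [a] with the coroot of [b]. It is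
    required on the whole root lattice, so that it is additive in [a].
    Positivity is also stated on the lattice only, because the values of [B] on
    the whole space are arbitrary scalars. The field [rs_sub] is the part of the
    theory of root strings used below; it passes to subsystems. *)
Record root_system (D : set V) (pr : V -> V -> int) : Prop := RootSystem {
  rs_sym : forall a b, B a b = B b a;
  rs_lin : forall k a b c, B (k *: a + b) c = k * B a c + B b c;
  rs_fin : finite_set D;
  rs_opp : forall a, D a -> D (- a);
  rs_pos : forall a, D a -> 0 < B a a;
  rs_pr : forall a b, nspan D a -> D b -> 2 * B a b = (pr a b)%:~R * B b b;
  rs_refl : forall a b, D a -> D b -> D (a - b *~ pr a b);
  rs_sub : forall a b, D a -> D b -> a <> b -> 0 < pr a b -> D (a - b);
  rs_red : forall a, D a -> ~ D (a *+ 2);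
  rs_ge0 : forall a, nspan D a -> 0 <= B a a;
  rs_def : forall a, nspan D a -> B a a = 0 -> a = 0
}.

Variables (D : set V) (pr : V -> V -> int).
Hypothesis RS : root_system D pr.
Let Bsym := rs_sym RS.
Let Dopp := rs_opp RS.

Lemma BDl a b c : B (a + b) c = B a c + B b c.
Proof. by rewrite -[a]scale1r (rs_lin RS) mul1r scale1r. Qed.
Lemma B0l c : B 0 c = 0.
Proof. by apply: (addrI (B 0 c)); rewrite -BDl !addr0. Qed.
Lemma BNl a c : B (- a) c = - B a c.
Proof. by apply: (addrI (B a c)); rewrite -BDl !subrr B0l. Qed.
Lemma BZl k a c : B (k *: a) c = k * B a c.
Proof. by rewrite -[k *: a]addr0 (rs_lin RS) B0l addr0. Qed.
Lemma Bsuml I (r : seq I) (f : I -> V) c :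
  B (\sum_(i <- r) f i) c = \sum_(i <- r) B (f i) c.
Proof. by apply: (big_morph (B^~ c)); [move=> a b; exact: BDl|exact: B0l]. Qed.
Lemma Bsumr I (r : seq I) (f : I -> V) c :
  B c (\sum_(i <- r) f i) = \sum_(i <- r) B c (f i).
Proof. by rewrite Bsym Bsuml; apply: eq_bigr => i _; rewrite Bsym. Qed.
Lemma BMzl a n c : B (a *~ n) c = B a c *~ n.
Proof. by rewrite -scaler_int BZl mulrzl. Qed.
Lemma BDr a b c : B c (a + b) = B c a + B c b.
Proof. by rewrite !(Bsym c) BDl. Qed.
Lemma BNr a c : B c (- a) = - B c a.
Proof. by rewrite !(Bsym c) BNl. Qed.
Lemma BMzr a n c : B c (a *~ n) = B c a *~ n.
Proof. by rewrite !(Bsym c) BMzl. Qed.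

Lemma root_neq0 a : D a -> a != 0.
Proof. by move=> /(rs_pos RS); case: eqP => // ->; rewrite B0l ltxx. Qed.

Lemma lattice_root a : D a -> nspan D a. Proof. exact: nspan_in. Qed.

Lemma latticeN a : nspan D a -> nspan D (- a).
Proof.
move=> [s sD ->]; exists [seq - c | c <- s]; last by rewrite big_map sumrN.
by move=> c /mapP[b /sD Db ->]; apply: Dopp.
Qed.

Lemma latticeMz a n : nspan D a -> nspan D (a *~ n).
Proof.
by case: n => n La; rewrite ?NegzE ?mulrNz; [|apply: latticeN]; apply: nspanMn.
Qed.

Lemma pr_def a b n : nspan D a -> D b -> 2 * B a b = n%:~R * B b b -> pr a b = n.
Proof.
move=> La Db; rewrite (rs_pr RS)// => /mulIf h; apply/eqP.
by rewrite -(eqr_int F); apply/eqP/h; rewrite gt_eqF// (rs_pos RS).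
Qed.

Lemma prD a b c : nspan D a -> nspan D b -> D c -> pr (a + b) c = pr a c + pr b c.
Proof.
move=> La Lb Dc; apply: pr_def => //; first exact: nspanD.
by rewrite BDl mulrDr !(rs_pr RS)// -mulrDl -intrD.
Qed.

Lemma pr0 c : D c -> pr 0 c = 0.
Proof. by move=> Dc; apply: pr_def; rewrite ?B0l ?mul0r ?mulr0//; exact: nspan0. Qed.

Lemma prN a c : nspan D a -> D c -> pr (- a) c = - pr a c.
Proof.
move=> La Dc; apply: pr_def => //; first exact: latticeN.
by rewrite BNl mulrN !(rs_pr RS)// -mulNr -mulrNz.
Qed.

Lemma prB a b c : nspan D a -> nspan D b -> D c -> pr (a - b) c = pr a c - pr b c.
Proof. by move=> La Lb Dc; rewrite prD ?prN//; exact: latticeN. Qed.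

Lemma prMz a n c : nspan D a -> D c -> pr (a *~ n) c = pr a c * n.
Proof.
move=> La Dc; apply: pr_def => //; first exact: latticeMz.
by rewrite BMzl -mulrzr mulrA (rs_pr RS)// intrM; ring.
Qed.

Lemma prNr a c : nspan D a -> D c -> pr a (- c) = - pr a c.
Proof.
move=> La Dc; apply: pr_def => //; first exact: Dopp.
by rewrite !BNr !BNl mulrN !(rs_pr RS)// mulrNz; ring.
Qed.

Lemma pr_sum (T : eqType) (r : seq T) (f : T -> V) c : {in r, forall i, nspan D (f i)} ->
  D c -> pr (\sum_(i <- r) f i) c = \sum_(i <- r) pr (f i) c.
Proof.
move=> + Dc; elim: r => [|i r IH] h; first by rewrite !big_nil pr0.
have hr : {in r, forall i, nspan D (f i)}.
  by move=> j jr; apply: h; rewrite inE jr orbT.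
rewrite !big_cons prD ?IH//; first by apply: h; rewrite mem_head.
rewrite big_seq; elim/big_rec: _ => [|j x jr]; first exact: nspan0.
by apply: nspanD; apply: hr.
Qed.

Lemma pr_self a : D a -> pr a a = 2.
Proof. by move=> Da; apply: pr_def => //; exact: lattice_root. Qed.

Lemma pr_B_eq0 a b : nspan D a -> D b -> (pr a b == 0) = (B a b == 0).
Proof.
move=> La Db; rewrite -(intr_eq0 F).
have := rs_pr RS La Db => /(congr1 (eq_op^~ 0)).
by rewrite /= !mulf_eq0 pnatr_eq0 /= => ->; rewrite (gt_eqF (rs_pos RS Db)) orbF.
Qed.

Lemma pr_B0 a b : nspan D a -> D b -> pr a b = 0 <-> B a b = 0.
Proof. by move=> La Db; have := pr_B_eq0 La Db; case: eqP; case: eqP. Qed.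

Lemma pr_B_gt0 a b : nspan D a -> D b -> (0 < pr a b) = (0 < B a b).
Proof.
move=> La Db; rewrite -(ltr0z F) -(pmulr_lgt0 _ (rs_pos RS Db)) -(rs_pr RS)//.
by rewrite pmulr_rgt0.
Qed.

Lemma pr_B_lt0 a b : nspan D a -> D b -> (pr a b < 0) = (B a b < 0).
Proof.
move=> La Db; rewrite -oppr_gt0 -prN// pr_B_gt0 ?BNl ?oppr_gt0//.
exact: latticeN.
Qed.

Lemma pr_gt0C a b : D a -> D b -> (0 < pr a b) = (0 < pr b a).
Proof. by move=> Da Db; rewrite !pr_B_gt0; do ?exact: lattice_root; rewrite // Bsym. Qed.

Lemma pr_lt0C a b : D a -> D b -> (pr a b < 0) = (pr b a < 0).
Proof. by move=> Da Db; rewrite !pr_B_lt0; do ?exact: lattice_root; rewrite // Bsym. Qed.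

Lemma pr_eq0C a b : D a -> D b -> (pr a b == 0) = (pr b a == 0).
Proof. by move=> Da Db; rewrite !pr_B_eq0; do ?exact: lattice_root; rewrite // Bsym. Qed.

Lemma pr_le0C a b : D a -> D b -> (pr a b <= 0) = (pr b a <= 0).
Proof. by move=> Da Db; rewrite !leNgt pr_gt0C. Qed.

Lemma pr_ge0C a b : D a -> D b -> (0 <= pr a b) = (0 <= pr b a).
Proof. by move=> Da Db; rewrite !leNgt pr_lt0C. Qed.

Lemma rs_add a b : D a -> D b -> a <> - b -> pr a b < 0 -> D (a + b).
Proof.
move=> Da Db ab prab; rewrite -[b]opprK; apply: (rs_sub RS) => //; first exact: Dopp.
by rewrite prNr ?oppr_gt0//; exact: lattice_root.
Qed.

Lemma int_sum_pos_ex (T : eqType) (r : seq T) (f : T -> int) :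
  0 < \sum_(i <- r) f i -> exists2 i, i \in r & 0 < f i.
Proof.
move=> h; apply/hasP; apply: contraTT h => /hasPn h.
by rewrite -leNgt big_seq sumr_le0// => i /h; rewrite -leNgt.
Qed.

(** * Positive systems *)

Variable Dp : set V.
Hypothesis PS : positive_system D Dp.

Lemma posD a : Dp a -> D a.
Proof. by case: PS => h _ _ ?; apply/h; left. Qed.

Lemma pos_or_neg a : D a -> Dp a \/ Dp (- a).
Proof. by case: PS => h _ _ /h. Qed.

Lemma pos_neg a : Dp a -> ~ Dp (- a).
Proof. by case: PS => _ h _ /h. Qed.

Lemma pos_add a b : Dp a -> Dp b -> D (a + b) -> Dp (a + b).
Proof. by case: PS => _ _ h; exact: h. Qed.

(** If the sum vanishes, its first term pairs negatively with another one; both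
    can be replaced by their sum, which is again a positive root, in a shorter
    list. *)
Lemma pos_sum_neq0 s : {in s, forall c, Dp c} -> s <> [::] ->
  \sum_(c <- s) c <> 0.
Proof.
move: {2}(size s) (leqnn (size s)) => n; elim: n s => [|n IH] [|a s]//= ltn sP _ s0.
have Dpa : Dp a by apply: sP; rewrite mem_head.
have Da := posD Dpa.
have sP' : {in s, forall c, Dp c} by move=> c cs; apply: sP; rewrite inE cs orbT.
have sD : {in s, forall c, nspan D c} by move=> c /sP' /posD /lattice_root.
have : 0 < \sum_(c <- s) pr (- c) a.
  rewrite -(@pr_sum _ s -%R) => [|c /sD|//]; last exact: latticeN.
  move/eqP: s0; rewrite big_cons addr_eq0 => /eqP s0.
  by rewrite sumrN -s0 pr_self.
move=> /int_sum_pos_ex[b bs]; have Dpb := sP' _ bs; have Db := posD Dpb.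
rewrite prN ?oppr_gt0//; last exact: lattice_root.
move=> prab; have Dab : D (a + b).
  rewrite addrC; apply: rs_add => // ba; apply: (pos_neg Dpa); by rewrite -ba.
apply: (IH (a + b :: rem b s)) => //=.
- by rewrite size_rem//; case: (s) bs ltn.
- move=> c; rewrite inE => /orP[/eqP->|/mem_rem/sP'//]; exact: pos_add.
- by have := s0; rewrite !big_cons (big_rem b bs) /= addrA.
Qed.

Lemma count_lt (T : eqType) (p q : pred T) (r : seq T) x :
  subpred p q -> x \in r -> q x -> ~~ p x -> (count p r < count q r)%N.
Proof.
move=> pq + qx px; elim: r => //= y r IH; rewrite inE => /orP[/eqP<-|/IH h].
  by rewrite qx (negbTE px) add0n add1n ltnS; exact: sub_count.
rewrite -addnS leq_add//; case: (boolP (p y)) => // /pq ->//.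
Qed.

(** A height bounded on all roots, for inductions along the root order: it
    counts the positive roots below a given one. *)
Lemma height_exists : exists (h : V -> nat) (N : nat), (forall a, (h a <= N)%N) /\
  forall a b s, Dp a -> {in s, forall c, Dp c} -> s <> [::] ->
    b = a + \sum_(c <- s) c -> (h a < h b)%N.
Proof.
have /finite_seqP[rl Drl] := rs_fin RS.
pose below a c := `[< Dp c /\ exists s, [/\ {in s, forall c, Dp c}, s <> [::]
  & a = c + \sum_(c <- s) c] >].
exists (fun a => count (below a) rl), (size rl); split=> [a|a b s Dpa sP s0 ba].
  exact: count_size.
apply: (@count_lt _ _ _ _ a).
- move=> c /asboolP[Dpc [s' [s'P s'0 ac]]]; apply/asboolP; split=> //.
  exists (s' ++ s); split.
  + by move=> d; rewrite mem_cat => /orP[/s'P|/sP].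
  + by case: s' s'0 {s'P ac}.
  + by rewrite big_cat ba ac addrA.
- by have := posD Dpa; rewrite Drl.
- by apply/asboolP; split=> //; exists s.
- apply/asboolP => -[_ [s' [s'P s'0 /esym/eqP]]].
  by rewrite -subr_eq0 addrC addKr => /eqP; exact: pos_sum_neq0.
Qed.

(** A size for subsets of the finite set [D], for inductions on subsystems. *)
Lemma card_exists : exists m : set V -> nat, forall X Y,
  X `<=` Y -> Y `<=` D -> X <> Y -> (m X < m Y)%N.
Proof.
have /finite_seqP[rl Drl] := rs_fin RS.
exists (fun X => count (fun a => `[< X a >]) rl) => X Y XY YD neXY.
have [a [Ya nXa]] : exists a, Y a /\ ~ X a.
  apply: contrapT => /forallNP h; apply: neXY; apply/seteqP; split=> // a Ya.
  by apply: contrapT => nXa; apply: (h a).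
apply: (@count_lt _ _ _ _ a); first by move=> c /asboolP/XY/asboolP.
- by have := YD _ Ya; rewrite Drl.
- exact/asboolP.
- by apply/asboolP.
Qed.

(** Closed subsystems: those that occur in the cascade are cut out by
    orthogonality. *)
Definition subsystem (Psi : set V) : Prop :=
  [/\ Psi `<=` D, forall a, Psi a -> Psi (- a),
      forall a b, Psi a -> Psi b -> D (a + b) -> Psi (a + b)
    & forall a b, Psi a -> Psi b -> Psi (a - b *~ pr a b)].

Lemma subsystem_full : subsystem D.
Proof. by split=> //; exact: (rs_refl RS). Qed.

Section Subsystem.
Variable Psi : set V.
Hypothesis SP : subsystem Psi.
Let P := Psi `&` Dp.
Let S := simple_roots P.

Lemma subD a : Psi a -> D a. Proof. by case: SP => h _ _ _; exact: h. Qed.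
Lemma subN a : Psi a -> Psi (- a). Proof. by case: SP => _ h _ _; exact: h. Qed.
Lemma sub_add a b : Psi a -> Psi b -> D (a + b) -> Psi (a + b).
Proof. by case: SP => _ _ h _; exact: h. Qed.
Lemma sub_subr a b : Psi a -> Psi b -> D (a - b) -> Psi (a - b).
Proof. by move=> Pa Pb; apply: sub_add => //; apply: subN. Qed.
Lemma sub_refl a b : Psi a -> Psi b -> Psi (a - b *~ pr a b).
Proof. by case: SP => _ _ _; exact. Qed.
Lemma sub_pos_or_neg a : Psi a -> P a \/ P (- a).
Proof.
move=> Pa; have [?|?] := pos_or_neg (subD Pa); [left|right]; split=> //; exact: subN.
Qed.
Lemma subP_D a : P a -> D a. Proof. by move=> [/subD]. Qed.
Lemma subS_D a : S a -> D a. Proof. by move=> [/subP_D]. Qed.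
Lemma subS_P a : S a -> P a. Proof. by case. Qed.

Lemma nspanSL v : nspan S v -> nspan D v.
Proof. by apply: nspanS => a /subS_D. Qed.
Lemma nspanSP v : nspan S v -> nspan P v.
Proof. by apply: nspanS => a []. Qed.

Lemma nspan_root_ind (X : V -> Prop) :
  (forall a, S a -> X a) ->
  (forall a b, P a -> P b -> D (a + b) -> X a -> X b -> X (a + b)) ->
  forall a, P a -> X a.
Proof.
move=> XS XD; have [h [N [_ hh]]] := height_exists.
move=> a; move: {2}(h a) (leqnn (h a)) => n; elim: n a => [|n IH] a han Pa.
  apply: XS; split=> // -[b [c [Pb Pc abc]]].
  have := hh b a [:: c] Pb.2; rewrite big_seq1 => /(_ _ _ abc).
  move: han; rewrite leqn0 => /eqP ->; rewrite ltn0 => /(_ _ _)/notF; apply => //.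
  by move=> d; rewrite inE => /eqP->; exact: Pc.2.
have [Sa|] := pselect (S a); first exact: XS.
move=> nS; have [b [c [Pb Pc abc]]] : exists b c, [/\ P b, P c & a = b + c].
  by apply: contrapT => h'; apply: nS.
have step x y : P x -> P y -> a = x + y -> X x.
  move=> Px Py axy; apply: IH => //; rewrite -ltnS; apply: leq_trans han.
  apply: (hh x a [:: y]) => //; rewrite ?big_seq1//; first exact: Px.2.
  by move=> d; rewrite inE => /eqP->; exact: Py.2.
rewrite abc; apply: XD => //; first by rewrite -abc; exact: subP_D.
  exact: (step b c).
by apply: (step c b) => //; rewrite addrC.
Qed.

Lemma nspan_simple a : P a -> nspan S a.
Proof.
by apply: nspan_root_ind => [b|b c _ _ _]; [exact: nspan_in|exact: nspanD].
Qed.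

Lemma nspan_simpleP v : nspan P v -> nspan S v.
Proof.
move=> [s sP ->]; elim: s sP => [|a s IH] h.
  by rewrite big_nil; exact: nspan0.
rewrite big_cons; apply: nspanD.
  by apply: nspan_simple; apply: h; rewrite mem_head.
by apply: IH => c cs; apply: h; rewrite inE cs orbT.
Qed.

Lemma nspan_sum_eq0 u v : nspan P u -> nspan P v -> u + v = 0 -> u = 0.
Proof.
move=> [s sP ->] [t tP ->]; rewrite -big_cat/= => /pos_sum_neq0.
case: s sP => [|a s] sP; first by rewrite big_nil.
move=> h; exfalso; apply: h => // c; rewrite mem_cat.
by move=> /orP[/sP[]|/tP[]].
Qed.

Lemma nspan_antisym u : nspan P u -> nspan P (- u) -> u = 0.
Proof. by move=> h1 h2; apply: (nspan_sum_eq0 h1 h2); rewrite subrr. Qed.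

Lemma simple_not_sum a b c : S a -> P b -> P c -> a <> b + c.
Proof. by move=> [_ h] Pb Pc abc; apply: h; exists b, c. Qed.

Lemma simple_sub a b : S b -> P a -> D (a - b) -> P (a - b).
Proof.
move=> Sb Pa Dab; have Pab : Psi (a - b) by apply: sub_subr => //; [case: Pa|case: Sb.1].
have [//|h] := sub_pos_or_neg Pab.
by case: (simple_not_sum Sb Pa h); rewrite opprB addrC subrK.
Qed.

Lemma simple_pr_le0 a b : S a -> S b -> a <> b -> pr a b <= 0.
Proof.
move=> Sa Sb ab; rewrite leNgt; apply/negP => h.
have Dab : D (a - b) by apply: (rs_sub RS) => //; exact: subS_D.
by apply: (simple_not_sum Sa (simple_sub Sb (subS_P Sa) Dab) (subS_P Sb)); rewrite subrK.
Qed.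

(** Removing common terms makes the two lists disjoint. Then their common sum
    has norm at most 0, because distinct simple roots pair to at most 0; so it
    is zero and both lists are empty. *)
Lemma simple_indep s1 s2 : {in s1, forall c, S c} -> {in s2, forall c, S c} ->
  \sum_(c <- s1) c = \sum_(c <- s2) c -> perm_eq s1 s2.
Proof.
move: {2}(size s1) (leqnn (size s1)) => n; elim: n s1 s2 => [|n IH] s1 s2 sz h1 h2 e.
  case: s1 sz h1 e => // _ _; rewrite big_nil.
  case: s2 h2 => // a s2 h2 /esym /pos_sum_neq0; case=> // c /h2/subS_P[]//.
have [/hasP[a a1 a2]|/hasPn dis] := boolP (has (mem s2) s1).
  rewrite (permPl (perm_to_rem a1)) (permPr (perm_to_rem a2)) perm_cons.
  apply: IH; first by rewrite size_rem//; case: (s1) a1 sz.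
  - by move=> c /mem_rem/h1.
  - by move=> c /mem_rem/h2.
  - by apply: (addrI a); rewrite -!sum_rem.
have s10 : \sum_(c <- s1) c = 0.
  apply: (rs_def RS).
    by apply: nspanSL; exists s1.
  apply/eqP; rewrite eq_le (rs_ge0 RS); last by apply: nspanSL; exists s1.
  rewrite andbT {1}e Bsuml big_seq sumr_le0// => b bs2.
  rewrite Bsumr big_seq sumr_le0// => a as1.
  have Sa := h1 _ as1; have Sb := h2 _ bs2.
  have /real_leNgt -> : B b a \is Num.real.
    have := rs_pr RS (lattice_root (subS_D Sb)) (subS_D Sa).
    move/(congr1 (fun x => 2^-1 * x)); rewrite mulKf ?pnatr_eq0// => ->.
    rewrite !realM ?realV ?realn ?rpred_int//.
    by rewrite gtr0_real// (rs_pos RS)//; exact: subS_D.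
  + rewrite -pr_B_gt0; [|exact/lattice_root/subS_D|exact: subS_D].
    rewrite -leNgt simple_pr_le0// => ba; have := dis _ as1.
    by rewrite /= -ba bs2.
  + by rewrite real0.
have s1n : s1 = [::].
  apply: contrapT => s1n; apply: pos_sum_neq0 s10 => // c /h1/subS_P[]//.
have s2n : s2 = [::].
  apply: contrapT => s2n; rewrite e in s10; apply: pos_sum_neq0 s10 => // c /h2/subS_P[]//.
by rewrite s1n s2n.
Qed.

Lemma simple_root_in a s : S a -> {in s, forall c, S c} ->
  nspan S (\sum_(c <- s) c - a) -> a \in s.
Proof.
move=> Sa sS [t tS e]; have := @simple_indep (a :: t) s.
rewrite big_cons -e addrC subrK => /(_ _ sS erefl) h.
rewrite -(perm_mem (h _)) ?mem_head// => c; rewrite inE => /orP[/eqP->//|]; exact: tS.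
Qed.

Definition top_root m := P m /\ forall c, P c -> ~ D (m + c).

Lemma top_root_pr m c : top_root m -> P c -> 0 <= pr m c.
Proof.
move=> [Pm mtop] Pc; rewrite leNgt; apply/negP => h; apply: (mtop c Pc).
apply: rs_add => //; [exact: subP_D|exact: subP_D|move=> mc].
by apply: (pos_neg Pc.2); rewrite -mc; exact: Pm.2.
Qed.

Lemma simple_pos_pr a s : P a -> {in s, forall c, S c} -> a = \sum_(c <- s) c ->
  exists2 c, c \in s & 0 < pr c a.
Proof.
move=> Pa sS e; apply: int_sum_pos_ex; rewrite -pr_sum; last exact: subP_D.
  by rewrite -e pr_self//; exact: subP_D.
by move=> c /sS/subS_D/lattice_root.
Qed.

(** As [a] has positive norm, it pairs positively with one of its simple terms,
    which can be subtracted. *)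
Lemma simple_peel a : P a -> S a \/ exists2 c, S c & P (a - c).
Proof.
move=> Pa; have [s sS e] := nspan_simple Pa.
have [c cs h] := simple_pos_pr Pa sS e; have Sc := sS _ cs.
have [->|ac] := eqVneq a c; [by left|right; exists c => //].
apply: simple_sub => //; apply: (rs_sub RS); first exact: subP_D.
- exact: subS_D.
- exact/eqP.
- by rewrite pr_gt0C//; [exact: subP_D|exact: subS_D].
Qed.

Lemma root_add_ind (X : V -> Prop) : (forall a, S a -> X a) ->
  (forall a c, P a -> S c -> P (a + c) -> X a -> X (a + c)) ->
  forall a, P a -> X a.
Proof.
move=> XS XD; have [h [N [_ hh]]] := height_exists.
move=> a; move: {2}(h a) (leqnn (h a)) => n; elim: n a => [|n IH] a han Pa;
  have [Sa|[c Sc Pac]] := simple_peel Pa; try exact: XS;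
  have := hh (a - c) a [:: c] Pac.2; rewrite big_seq1 subrK => /(_ _ _ erefl) {}hh;
  have {}hh : (h (a - c)%R < h a)%N by apply: hh => // d; rewrite inE => /eqP->; exact: Sc.1.2.
  by rewrite (eqP (_ : h a == 0%N)) ?ltn0 // in hh; rewrite -leqn0.
rewrite -[a](subrK c); apply: XD; rewrite ?subrK//; apply: IH => //.
by rewrite -ltnS; apply: leq_trans han.
Qed.

Lemma nspan_pr0 (T : set V) v a : T `<=` D -> D a ->
  (forall c, T c -> pr c a = 0) -> nspan T v -> pr v a = 0.
Proof.
move=> TD Da T0 [s sT ->]; rewrite pr_sum//; last by move=> c /sT/TD/lattice_root.
by rewrite big_seq big1// => c /sT/T0.
Qed.

(** If [d + c] were a root, so would be its reflection in [c], which is [d - c];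
    but that is neither a positive nor a negative combination of simple roots. *)
Lemma orth_add (T : set V) d c : T `<=` S -> P d -> nspan T d -> S c -> ~ T c ->
  (forall b, T b -> pr b c = 0) -> ~ D (d + c).
Proof.
move=> TS Pd [s sT ds] Sc nTc T0 Ddc.
have sS : {in s, forall b, S b} by move=> b /sT/TS.
have cs : c \notin s by apply/negP => /sT.
have Dd := subP_D Pd; have Dc := subS_D Sc; have Pc := subS_P Sc.
have dc0 : pr d c = 0.
  by apply: (@nspan_pr0 T) => //; [move=> b /TS/subS_D|exists s].
have Pdc : Psi (d + c) by apply: sub_add => //; [case: Pd|case: Pc].
have := sub_refl Pdc Pc.1; rewrite prD; do ?exact: lattice_root; rewrite //.
rewrite dc0 pr_self// add0r mulrz_nat mulr2n opprD addrA addrK => Psidc.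
have [h|h] := sub_pos_or_neg Psidc.
  by move: cs; rewrite (simple_root_in (s := s))// -ds; exact: nspan_simple.
have [t tS e] := nspan_simple h.
have : perm_eq [:: c] (s ++ t).
  apply: simple_indep.
  - by move=> b; rewrite inE => /eqP->.
  - by move=> b; rewrite mem_cat => /orP[/sS|/tS].
  - by rewrite big_seq1 big_cat /= -ds -e; vring.
case: (s) cs sT ds => [|b s'] cs sT ds.
  by have := root_neq0 Dd; rewrite ds big_nil eqxx.
move=> /perm_mem /(_ b); rewrite mem_head inE => /eqP bc.
by move: cs; rewrite bc mem_head.
Qed.

(** A root is reached by adding simple roots one at a time, and [orth_add] forbids
    a first step that mixes two orthogonal sets. *)
Lemma split_simple (q : pred V) :
  (forall a b, S a -> S b -> q a -> ~~ q b -> pr a b = 0) ->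
  forall a, P a -> nspan (S `&` [set c | q c]) a \/ nspan (S `&` [set c | ~~ q c]) a.
Proof.
move=> q0; apply: root_add_ind => [a Sa|a c Pa Sc Pac IH].
  by case: (boolP (q a)) => qa; [left|right]; exact: nspan_in.
have Dac := subP_D Pac.
have q0' a' b' : S a' -> S b' -> ~~ q a' -> q b' -> pr a' b' = 0.
  move=> Sa Sb qa qb; apply/eqP; rewrite pr_eq0C; do ?exact: subS_D.
  by rewrite q0.
case: (boolP (q c)) => qc; case: IH => IH.
- by left; apply: nspanD => //; exact: nspan_in.
- exfalso; apply: (orth_add _ Pa IH Sc _ _ Dac); first by move=> b [].
    by move=> [_ /=]; rewrite qc.
  by move=> b [Sb /= qb]; exact: q0'.
- exfalso; apply: (orth_add _ Pa IH Sc _ _ Dac); first by move=> b [].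
    by move=> [_ /=]; rewrite (negbTE qc).
  by move=> b [Sb /= qb]; exact: q0.
- by right; apply: nspanD => //; exact: nspan_in.
Qed.

Lemma top_root_exists a : P a -> exists2 m, top_root m & nspan P (m - a).
Proof.
have [h [N [hN hh]]] := height_exists.
move: {2}(N - h a)%N (leqnn (N - h a)) => n; elim: n a => [|n IH] a han Pa;
  (have [atop|] := pselect (top_root a);
    [by exists a; rewrite ?subrr//; exact: nspan0|]).
all: move=> ntop; have [c Pc Dac] : exists2 c, P c & D (a + c).
1,3: by apply: contrapT => h'; apply: ntop; split=> // c Pc Dac; apply: h'; exists c.
all: have Pac : P (a + c) by split; [apply: sub_add => //; [case: Pa|case: Pc]
       |apply: pos_add => //; [case: Pa|case: Pc]].
all: have := hh a (a + c) [:: c] Pa.2; rewrite big_seq1 => /(_ _ _ erefl) {}hh.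
all: have {}hh : (h a < h (a + c)%R)%N
       by apply: hh => // d; rewrite inE => /eqP->; exact: Pc.2.
all: have := hN (a + c).
  by move=> h1; move: han; rewrite leqn0 subn_eq0 => h2; move: (leq_trans hh h1); lia.
move=> h1; have [||m mtop h2] := IH (a + c) => //; first lia.
exists m => //; rewrite (_ : m - a = (m - (a + c)) + c); last by vring.
by apply: nspanD => //; exact: nspan_in.
Qed.

(** A simple root outside the support of [m] pairs to at most 0 with each term
    of [m] and to at least 0 with [m], so it is orthogonal to the support;
    irreducibility forbids such a splitting of the simple roots. *)
Lemma top_full_support m s : irreducible B Psi -> top_root m ->
  {in s, forall c, S c} -> m = \sum_(c <- s) c -> forall a, S a -> a \in s.
Proof.
move=> [_ irr] mtop sS ms a Sa; have Pm := mtop.1; have Dm := subP_D Pm.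
have orth c b : S c -> S b -> c \in s -> b \notin s -> pr c b = 0.
  move=> Sc Sb cs bs; have le0 d : d \in s -> 0 <= - pr d b.
    move=> ds; rewrite oppr_ge0 simple_pr_le0//; first exact: sS.
    by move=> db; rewrite -db ds in bs.
  have : \sum_(d <- s) - pr d b <= 0.
    rewrite sumrN -(@pr_sum _ s id) => [|d /sS/subS_D/lattice_root//|]; last exact: subS_D.
    by rewrite -ms oppr_le0 top_root_pr//; exact: subS_P.
  rewrite (big_rem c cs)/= => h; apply/eqP; rewrite -oppr_eq0 eq_le le0// andbT.
  apply: le_trans h; rewrite lerDl big_seq sumr_ge0// => d /mem_rem; exact: le0.
have spl := split_simple orth.
pose C := [set c | Psi c /\ (nspan (S `&` [set d | d \in s]) c \/
  nspan (S `&` [set d | d \in s]) (- c))].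
have := irr C; case=> [c []//||C0|CP].
- move=> c d [Pc Cc] [Pd Cd].
  have {Cc} [k [kc Ck]] : exists k, (k = c \/ k = - c) /\ nspan (S `&` [set d | d \in s]) k.
    by case: Cc => Cc; [exists c|exists (- c)]; tauto.
  have : B k d = 0; last first.
    by case: kc => -> //; rewrite BNl => /eqP; rewrite oppr_eq0 => /eqP.
  have {Cd} [l [ld Cl]] : exists l, (l = d \/ l = - d) /\ nspan (S `&` [set d | ~~ (d \in s)]) l.
    have [Pd'|Pd'] := sub_pos_or_neg Pd.
      have [h|h] := spl _ Pd'; last by exists d; tauto.
      by case: Cd; split=> //; left.
    have [h|h] := spl _ Pd'; last by exists (- d); tauto.
    by case: Cd; split=> //; right.
  have : B k l = 0; last first.
    by case: ld => -> //; rewrite BNr => /eqP; rewrite oppr_eq0 => /eqP.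
  case: Ck => t1 t1P ->; case: Cl => t2 t2P ->.
  rewrite Bsuml big_seq big1// => x /t1P[Sx xs]; rewrite Bsumr big_seq big1// => y /t2P[Sy ys].
  by apply/pr_B0; [exact/lattice_root/subS_D|exact: subS_D|exact: orth].
- have : C m by split; [case: Pm|left; exists s => // c cs; split=> //; exact: sS].
  by rewrite C0.
have : C a by rewrite CP; case: Sa.1.
move=> [_ [|] [t tP]] e.
  have := @simple_indep [:: a] t; rewrite big_seq1 => /(_ _ _ e) h.
  have : a \in t.
    rewrite -(perm_mem (h _ _)) ?mem_head// => c; first by rewrite inE => /eqP->.
    by move=> /tP[].
  by move=> /tP[].
have := root_neq0 (subS_D Sa); rewrite (nspan_antisym (u := a)) ?eqxx//.
  by apply/nspan_in/subS_P.
by rewrite e; exists t => // c /tP[] /subS_P.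
Qed.

Lemma top_pr_pos_ex m s : top_root m -> {in s, forall c, S c} -> m = \sum_(c <- s) c ->
  exists2 c, c \in s & 0 < pr m c.
Proof.
move=> [Pm _] sS ms; have [c cs h] := simple_pos_pr Pm sS ms.
by exists c; rewrite // pr_gt0C//; [exact: subP_D|exact/subS_D/sS].
Qed.

(** By full support the two maximal roots pair positively, so their difference
    would be a root. *)
Lemma top_root_unique m m' : irreducible B Psi -> top_root m -> top_root m' -> m = m'.
Proof.
move=> irr mtop mtop'; have [s sS ms] := nspan_simple mtop.1.
have [s' sS' ms'] := nspan_simple mtop'.1.
have [c cs cm] := top_pr_pos_ex mtop sS ms.
have Dm := subP_D mtop.1; have Dm' := subP_D mtop'.1.
have : 0 < pr m' m.
  rewrite ms' (@pr_sum _ s' id)//; last by move=> d /sS'/subS_D/lattice_root.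
  have cs' : c \in s' by apply: (top_full_support irr mtop' sS' ms'); exact: sS.
  rewrite (big_rem c cs') /= ltr_pwDl//; first by rewrite pr_gt0C//; exact/subS_D/sS.
  rewrite big_seq sumr_ge0// => d /mem_rem/sS' Sd; rewrite pr_ge0C//; last exact: subS_D.
  by apply: top_root_pr => //; exact: subS_P.
move=> h; apply: contrapT => mm'.
have Dmm : D (m' - m) by apply: (rs_sub RS) => // /esym.
have [h1|h1] := @sub_pos_or_neg (m' - m) (sub_subr mtop'.1.1 mtop.1.1 Dmm).
  by apply: (mtop.2 _ h1); rewrite addrC subrK.
by apply: (mtop'.2 _ h1); rewrite opprB addrC subrK.
Qed.

Lemma highest_root_exists : irreducible B Psi -> exists th, highest_root P th.
Proof.
move=> irr; have [[a Pa] _] := irr.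
have [b Pb] : exists b, P b by have [?|?] := sub_pos_or_neg Pa; eexists; eauto.
have [m mtop _] := top_root_exists Pb; exists m; split; first by case: mtop.
move=> c Pc; have [m' mtop' h] := top_root_exists Pc.
have [s sS e] := nspan_simpleP h.
by exists s; split=> //; rewrite (top_root_unique irr mtop mtop').
Qed.

Section Highest.
Variable th : V.
Hypothesis Hth : highest_root P th.

Lemma highP : P th. Proof. by case: Hth. Qed.
Lemma highD : D th. Proof. exact: subP_D highP. Qed.

Lemma high_le c : P c -> nspan S (th - c).
Proof. by move=> Pc; have [s [sS e]] := Hth.2 c Pc; exists s. Qed.

Lemma high_top : top_root th.
Proof.
split; first exact: highP.
move=> c Pc Dc; have Pthc : P (th + c).
  by split; [apply: sub_add => //; [case: highP|case: Pc]
            |apply: pos_add => //; [case: highP|case: Pc]].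
have := root_neq0 (subP_D Pc); rewrite (nspan_antisym (u := c)) ?eqxx//.
  exact: nspan_in.
have := nspanSP (high_le Pthc); rewrite opprD addrA subrr sub0r; exact.
Qed.

Lemma high_unique th' : highest_root P th' -> th = th'.
Proof.
move=> H'; apply/eqP; rewrite -subr_eq0; apply/eqP.
apply: nspan_antisym; first by apply/nspanSP/high_le; case: H'.
by rewrite opprB; have [s [sS e]] := H'.2 _ highP; apply: nspanSP; exists s.
Qed.

Lemma high_pr_ge0 c : P c -> 0 <= pr th c.
Proof. by move=> Pc; apply: top_root_pr => //; exact: high_top. Qed.

Lemma high_pr_ge0C c : P c -> 0 <= pr c th.
Proof. by move=> Pc; rewrite pr_ge0C ?high_pr_ge0//; [exact: subP_D|exact: highD]. Qed.

Lemma high_support s a : {in s, forall c, S c} -> th = \sum_(c <- s) c -> S a -> a \in s.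
Proof.
move=> sS e Sa; apply: simple_root_in => //; rewrite -e; exact/high_le/subS_P.
Qed.

(** If [n >= 2] is the pairing of [c] with [th], the reflection of [c] in [th]
    is [c - n th]. Comparing it, up to sign, and [c] with [th] gives [c = th]. *)
Lemma high_pr_le1 c : P c -> c <> th -> pr c th <= 1.
Proof.
move=> Pc cth; have Pth := highP; rewrite leNgt; apply/negP => h; apply: cth.
have := sub_refl Pc.1 Pth.1; set n := pr c th in h * => Pd.
have [k nk] : exists k : nat, n = Posz k.+2.
  by case: (n) h => [[|[|k]]|k]// _; exists k.
have U := nspanSP (high_le Pc).
have W : nspan P (th *+ k) by apply/nspanMn/nspan_in.
have {Pd} [Pd|Pd] := sub_pos_or_neg Pd.
  (* Here [c] would be [n *: th] plus a positive root, yet below [th]. *)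
  have : th = 0; last by move/eqP; rewrite (negbTE (root_neq0 highD)).
  apply: (@nspan_sum_eq0 th (th *+ k + (c - th *~ n) + (th - c))).
  - exact: nspan_in.
  - by do 2?[apply: nspanD => //]; exact: nspan_in.
  - rewrite nk -pmulrn !mulrSr; vring.
have L := nspanSP (high_le Pd).
have e : (th - c) + (th *+ k + (th - - (c - th *~ n))) = 0.
  by rewrite nk -pmulrn !mulrSr; vring.
apply/esym/eqP; rewrite -subr_eq0; apply/eqP.
by apply: (nspan_sum_eq0 U _ e); apply: nspanD.
Qed.

Lemma high_pr_eq1 c : P c -> c <> th -> pr c th != 0 -> pr c th = 1.
Proof.
move=> Pc neth; have := high_pr_le1 Pc neth; have := high_pr_ge0C Pc; clear; lia.
Qed.

End Highest.
End Subsystem.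

(** * Orthogonal components *)

Definition perp (Psi : set V) th : set V := [set a | Psi a /\ B a th = 0].

Lemma perp_subsystem Psi th : subsystem Psi -> subsystem (perp Psi th).
Proof.
move=> SP; split=> [a [/(subD SP)]//|a [Pa a0]|a b [Pa a0] [Pb b0] Dab|a b [Pa a0] [Pb b0]].
- by split; [exact: (subN SP)|rewrite BNl a0 oppr0].
- by split; [exact: (sub_add SP)|rewrite BDl a0 b0 addr0].
- by split; [exact: (sub_refl SP)|rewrite BDl BNl BMzl a0 b0 mul0rz subr0].
Qed.

Section Components.
Variables Psi C : set V.
Hypotheses (SP : subsystem Psi) (CC : irr_component B Psi C).

Lemma compS : C `<=` Psi. Proof. by case: CC. Qed.
Lemma comp_irr : irreducible B C. Proof. by case: CC. Qed.
Lemma compD a : C a -> D a. Proof. by move=> /compS/(subD SP). Qed.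

Lemma comp_orth a b : C a -> Psi b -> ~ C b -> pr a b = 0.
Proof.
case: CC => CP _ h Ca Pb nCb; apply/pr_B0; first exact/lattice_root/compD.
  exact: (subD SP).
by apply: h.
Qed.

Lemma comp_orthC a b : C a -> Psi b -> ~ C b -> pr b a = 0.
Proof.
move=> Ca Pb nCb; apply/eqP; rewrite pr_eq0C ?comp_orth//; [exact: (subD SP)|exact: compD].
Qed.

(** Every component is closed under the operations of the ambient subsystem
    because an element outside of it would be orthogonal to it. *)
Lemma comp_mem x : Psi x -> ((forall c, C c -> B c x = 0) -> B x x = 0) -> C x.
Proof.
move=> Px h; apply: contrapT => nCx.
have := rs_pos RS (subD SP Px); rewrite h ?ltxx// => c Cc.
by case: CC => _ _; apply.
Qed.

Lemma comp_nonorth a b : C a -> Psi b -> pr a b != 0 -> C b.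
Proof. by move=> Ca Pb h; apply: contrapT => nCb; rewrite comp_orth ?eqxx in h. Qed.

Lemma comp_subsystem : subsystem C.
Proof.
have CN a : C a -> C (- a).
  move=> Ca; apply: comp_mem; first exact/(subN SP)/compS.
  by move=> h; rewrite BNl h// oppr0.
split=> // [a|a b Ca Cb Dab|a b Ca Cb]; first exact: compD.
  apply: comp_mem; first by apply: (sub_add SP) => //; exact: compS.
  by move=> h; rewrite BDl !h// addr0.
apply: comp_mem; first by apply: (sub_refl SP); exact: compS.
by move=> h; rewrite BDl BNl BMzl !h// mul0rz subr0.
Qed.

End Components.

Lemma comp_disj Psi C C' a : irr_component B Psi C -> irr_component B Psi C' ->
  C a -> C' a -> C = C'.
Proof.
suff sub X Y : irr_component B Psi X -> irr_component B Psi Y -> X a -> Y a -> X `<=` Y.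
  by move=> h h' Ca C'a; apply/seteqP; split; apply: sub.
move=> [XP [_ irrX] _] [YP _ orthY] Xa Ya.
have := irrX (X `&` Y); case=> [c []//||XY0|<-]; last by move=> c [].
  move=> c d [Xc Yc] [Xd nXYd]; apply: orthY => //; split; first exact: XP.
  by move=> Yd; apply: nXYd.
by have : (X `&` Y) a by []; rewrite XY0.
Qed.

(** A minimal set that contains [a] and is orthogonal to the rest of [Psi] is
    irreducible. *)
Lemma comp_exists Psi a : Psi `<=` D -> Psi a ->
  exists2 C, irr_component B Psi C & C a.
Proof.
have [m hm] := card_exists; move=> PD Pa.
have h X : X `<=` Psi -> X a -> orthogonal_sets B X (Psi `\` X) ->
    exists2 C, irr_component B Psi C & C a.
  have [n] := ubnP (m X); elim: n X => // n IH X; rewrite ltnS => Xn XP Xa Xo.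
  have [irr|nirr] := pselect (irreducible B X); first by exists X; [split|].
  have [C' [C'X C'o C'0 C'XX]] : exists C', [/\ C' `<=` X,
      orthogonal_sets B C' (X `\` C'), C' <> set0 & C' <> X].
    apply: contrapT => h; apply: nirr; split=> [|C' C'X C'o]; first by exists a.
    by apply: contrapT => h'; apply: h; exists C'; split=> // e; apply: h'; tauto.
  have XD := subset_trans XP PD; have mC' := hm _ _ C'X XD C'XX.
  have mXC : (m (X `\` C') < m X)%N.
    apply: (hm _ _ _ XD) => [c []//|e]; apply: C'0; apply/seteqP; split=> // c C'c.
    have : (X `\` C') c by rewrite e; exact: C'X.
    by case.
  have [C'a|nC'a] := pselect (C' a).
    apply: (IH C'); first exact: leq_trans Xn.
    - exact: subset_trans XP.
    - by [].
    - move=> c d C'c [Pd nC'd]; have [Xd|nXd] := pselect (X d); first exact: C'o.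
      by apply: Xo => //; exact: C'X.
  apply: (IH (X `\` C')); first exact: leq_trans Xn.
  - by move=> c [/XP].
  - by [].
  - move=> c d [Xc nC'c] [Pd nd]; have [Xd|nXd] := pselect (X d); last exact: Xo.
    rewrite Bsym; apply: C'o => //; apply: contrapT => nC'd; exact: nd.
by apply: (h Psi) => // c d _ [].
Qed.

(** Passing from [Psi] to the roots orthogonal to [th] affects only the
    component of [th]; this is why the cascade can be listed one root at a time. *)
Lemma comp_perp Psi C th C' : subsystem Psi -> irr_component B Psi C ->
  C th -> irr_component B (perp Psi th) C' <->
    irr_component B (perp C th) C' \/ (irr_component B Psi C' /\ C' <> C).
Proof.
move=> SP CC Cth; have CP := compS CC; have [_ _ Co] := CC; split.
  move=> [C'P irr' C'o]; have [_ irr0] := irr'.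
  have := irr0 (C' `&` C); case=> [c []//|||C'C].
  - move=> c d [C'c Cc] [C'd nd]; apply: Co => //; split; first by case: (C'P _ C'd).
    by move=> Cd; apply: nd.
  - move=> C'C; have nC c : C' c -> ~ C c.
      by move=> C'c Cc; have : (C' `&` C) c by []; rewrite C'C.
    right; split; last by move=> e; rewrite e in nC; exact: (nC th).
    split=> // [c /C'P[]//|c d C'c [Pd nd]].
    have [d0|d0] := eqVneq (B d th) 0; first by apply: C'o.
    rewrite Bsym; apply: (Co); last by split; [case: (C'P _ C'c)|exact: nC].
    by apply: contrapT => nCd; move: d0; rewrite Bsym Co ?eqxx.
  - left; have C'C' c : C' c -> C c by rewrite -C'C => -[].
    split=> // [c C'c|c d C'c [[Cd d0] nd]]; first by split; [exact: C'C'|case: (C'P _ C'c)].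
    by apply: C'o => //; split=> //; split=> //; exact: CP.
move=> [[C'P irr' C'o]|[CC' ne]].
  split=> // [c /C'P[Cc ?]|c d C'c [[Pd d0] nd]]; first by split=> //; exact: CP.
  have [Cd|nCd] := pselect (C d); first exact: C'o.
  by apply: Co => //; case: (C'P _ C'c).
have nC c : C' c -> ~ C c by move=> C'c Cc; apply: ne; exact: (comp_disj CC' CC C'c Cc).
have [C'P irr' C'o] := CC'; split=> // [c C'c|c d C'c [[Pd d0] nd]]; last exact: C'o.
by split; [exact: C'P|rewrite Bsym; apply: Co => //; split; [exact: C'P|exact: nC]].
Qed.

(** * The cascade *)

Local Notation pos X := (X `&` Dp).
Local Notation simple X := (simple_roots (X `&` Dp)).

Definition cascade_union Psi b : Prop :=
  exists2 C, irr_component B Psi C & kostant_cascade B C Dp b.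

Lemma kostant_cascade_step C th b : subsystem C -> highest_root (pos C) th ->
  kostant_cascade B C Dp b <-> b = th \/ cascade_union (perp C th) b.
Proof.
move=> SC Hth; split.
  move=> [X [hX Hb]].
  have [eX|[C1 C1C hX1]] : X = C \/ exists2 C1, irr_component B (perp C th) C1 &
      cascade_system B C1 Dp X.
    elim: hX => [|Y b' C2 _ IH Hb' C2Y]; first by left.
    right; case: IH => [eY|[C1 C1C hY]].
      rewrite eY in Hb' C2Y; rewrite -(high_unique Hth Hb') in C2Y.
      by exists C2 => //; exact: cascade_start.
    by exists C1 => //; apply: cascade_step hY Hb' C2Y.
  by left; rewrite eX in Hb; rewrite (high_unique Hth Hb).
  by right; exists C1 => //; exists X.
move=> [->|[C1 C1C [X [hX Hb]]]]; first by exists C; split=> //; exact: cascade_start.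
exists X; split=> //; elim: hX => [|Y b' C2 _ IH Hb' C2Y].
  exact: cascade_step (cascade_start _ _ _) Hth C1C.
exact: cascade_step IH Hb' C2Y.
Qed.

Lemma cascade_union_step Psi C th b : subsystem Psi -> irr_component B Psi C ->
  highest_root (pos C) th ->
  cascade_union Psi b <-> b = th \/ cascade_union (perp Psi th) b.
Proof.
move=> SP CC Hth; have Cth : C th by case: Hth => -[].
have step := fun b => kostant_cascade_step b (comp_subsystem SP CC) Hth.
split.
  move=> [C' C'P hb]; have [e|ne] := pselect (C' = C).
    rewrite e in hb; have [->|[C1 C1C h]] := (step b).1 hb; first by left.
    by right; exists C1 => //; apply/(comp_perp _ SP CC Cth); left.
  by right; exists C' => //; apply/(comp_perp _ SP CC Cth); right.
move=> [->|[C1 /(comp_perp _ SP CC Cth)[C1C|[C1P _]] h]].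
- by exists C => //; apply/step; left.
- by exists C => //; apply/step; right; exists C1.
- by exists C1.
Qed.

Lemma cascade_union_irr Psi b : irreducible B Psi ->
  cascade_union Psi b <-> kostant_cascade B Psi Dp b.
Proof.
move=> irr; split=> [[C [CP [[a Ca] _] Co]]|h].
  by case: irr => _ /(_ C CP Co)[C0|->//]; rewrite C0 in Ca.
by exists Psi => //; split=> // c d _ [].
Qed.

(** The cascade of a possibly reducible subsystem, in a linear order: each step
    picks one component and passes to the orthogonal of its highest root. This
    replaces the tree recursion over components by an induction on lists. *)
Inductive cascade_list : set V -> seq V -> Prop :=
| cascade_nil : cascade_list set0 [::]
| cascade_cons Psi C th l : irr_component B Psi C -> highest_root (pos C) th ->
    cascade_list (perp Psi th) l -> cascade_list Psi (th :: l).

Lemma cascade_list_exists Psi : subsystem Psi -> exists l, cascade_list Psi l.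
Proof.
have [m hm] := card_exists.
have [n] := ubnP (m Psi); elim: n Psi => // n IH Psi; rewrite ltnS => Xn SP.
have [->|/eqP/set0P[a Pa]] := pselect (Psi = set0).
  by exists [::]; exact: cascade_nil.
have PD : Psi `<=` D by move=> ? /(subD SP).
have [C CC Ca] := comp_exists PD Pa; have SC := comp_subsystem SP CC.
have [th Hth] := highest_root_exists SC (comp_irr CC).
have Cth : C th by case: Hth => -[].
have mlt : (m (perp Psi th) < m Psi)%N.
  apply: hm => // [c []//|e]; have : perp Psi th th by rewrite e; exact: (compS CC).
  by move=> [_ h]; have := rs_pos RS (compD SP CC Cth); rewrite h ltxx.
have [|l hl] := IH (perp Psi th) _ (perp_subsystem th SP).
  exact: leq_trans Xn.
by exists (th :: l); exact: cascade_cons CC Hth hl.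
Qed.

Lemma cascade_list_union Psi l b : subsystem Psi -> cascade_list Psi l ->
  cascade_union Psi b <-> b \in l.
Proof.
move=> + hl; elim: hl => [_|{}Psi C th {}l CC Hth _ IH SP].
  by split=> // -[C [CP [[a /CP]]]].
rewrite (cascade_union_step _ SP CC Hth) inE (IH (perp_subsystem th SP)).
by split=> [[->|->]|/orP[/eqP->|->]]; rewrite ?eqxx ?orbT; auto.
Qed.

Lemma cascade_list_high Psi l C b : subsystem Psi -> cascade_list Psi l ->
  irr_component B Psi C -> highest_root (pos C) b -> b \in l.
Proof.
move=> SP hl CC Hb; apply/(cascade_list_union _ SP hl); exists C => //.
by exists C; split=> //; exact: cascade_start.
Qed.

Lemma cascade_list_pos Psi l b : subsystem Psi -> cascade_list Psi l ->
  b \in l -> pos Psi b.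
Proof.
move=> + hl; elim: hl => [//|{}Psi C th {}l CC Hth _ IH SP].
rewrite inE => /orP[/eqP->|/(IH (perp_subsystem th SP))[[]]//].
by case: Hth => -[/(compS CC)].
Qed.

(** Differences of members are excluded too, by reflecting ([so_sub]). *)
Definition strongly_orthogonal l := [/\ uniq l, {in l, forall b, D b},
  {in l &, forall b c, b != c -> pr b c = 0} &
  {in l &, forall b c, b != c -> ~ D (b + c)}].

Lemma cascade_list_strong Psi l : subsystem Psi -> cascade_list Psi l ->
  strongly_orthogonal l.
Proof.
move=> + hl; elim: hl => [_|{}Psi C th {}l CC Hth hl IH SP]; first by split.
have SP' := perp_subsystem th SP; have [l1 l2 l3 l4] := IH SP'.
have SC := comp_subsystem SP CC.
have Cth : C th by case: Hth => -[].
have Dth := subD SC Cth.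
have lP b : b \in l -> pos (perp Psi th) b by exact: cascade_list_pos.
have lth b : b \in l -> pr b th = 0.
  by move=> bl; have [[Pb b0] _] := lP _ bl; apply/pr_B0 => //; exact/lattice_root/l2.
have thl b : b \in l -> pr th b = 0.
  by move=> bl; apply/eqP; rewrite pr_eq0C ?lth//; exact: l2.
have thD b : b \in l -> ~ D (th + b).
  move=> bl Dthb; have [[Pb b0] Dpb] := lP _ bl.
  have [Cb|nCb] := pselect (C b); first exact: ((high_top SC Hth).2 b).
  have : B (th + b) b = 0.
    have [_ _ Co] := CC; apply: Co => //; apply: (comp_nonorth SP CC Cth).
      by apply: (sub_add SP) => //; exact: (compS CC).
    have Lb := lattice_root (l2 _ bl); have Lth := lattice_root Dth.
    by rewrite pr_eq0C// prD// (lth _ bl) pr_self.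
  rewrite BDl Bsym b0 add0r => h; have := rs_pos RS (l2 _ bl); by rewrite h ltxx.
split.
- rewrite /= l1 andbT; apply/negP => /lth; rewrite pr_self//.
- by move=> b; rewrite inE => /orP[/eqP->//|/l2].
- move=> b c; rewrite !inE => /orP[/eqP->|bl] /orP[/eqP->|cl]; rewrite ?eqxx//.
  + by move=> _; exact: thl.
  + by move=> _; exact: lth.
  + exact: l3.
- move=> b c; rewrite !inE => /orP[/eqP->|bl] /orP[/eqP->|cl]; rewrite ?eqxx//.
  + by move=> _; exact: thD.
  + by move=> _; rewrite addrC; exact: thD.
  + exact: l4.
Qed.

Section StronglyOrthogonal.
Variable l : seq V.
Hypothesis Hl : strongly_orthogonal l.

Lemma so_D b : b \in l -> D b. Proof. by case: Hl => _ h _ _ /h. Qed.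
Lemma so_pr b c : b \in l -> c \in l -> b != c -> pr b c = 0.
Proof. by case: Hl => _ _ h _; exact: h. Qed.

Lemma so_sub b c : b \in l -> c \in l -> b != c -> ~ D (b - c).
Proof.
move=> bl cl bc Dbc; have Lb := lattice_root (so_D bl); have Dc := so_D cl.
have [_ _ _ h] := Hl; apply: (h b c) => //.
have := rs_refl RS Dbc Dc; rewrite prB//; try exact: lattice_root.
by rewrite so_pr// pr_self// (_ : b - c - c *~ _ = b + c)//; vring.
Qed.

Lemma so_lattice (f : V -> int) : nspan D (\sum_(b <- l) b *~ f b).
Proof.
rewrite big_seq; elim/big_rec: _ => [|b x bl]; first exact: nspan0.
by apply: nspanD; apply/latticeMz/lattice_root/so_D.
Qed.

Lemma so_pr_sum (f : V -> int) b : b \in l -> pr (\sum_(c <- l) c *~ f c) b = f b * 2.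
Proof.
move=> bl; have Db := so_D bl; rewrite pr_sum//; last by move=> c /so_D/lattice_root/latticeMz.
rewrite (bigD1_seq b)//=; last by case: Hl.
rewrite prMz//; last exact: lattice_root.
rewrite pr_self// mulrC big_seq_cond big1 ?addr0// => c /andP[cl cb].
by rewrite prMz ?so_pr ?mul0r//; exact/lattice_root/so_D.
Qed.

End StronglyOrthogonal.

(** The product of the reflections in the members of [l]; for the cascade it is
    the longest element of the Weyl group. *)
Definition crefl l a := foldr (fun b x => x - b *~ pr x b) a l.

Lemma crefl_sub Psi C l a : subsystem Psi -> irr_component B Psi C ->
  {in l, forall b, Psi b} -> C a -> C (crefl l a).
Proof.
move=> SP CC + Ca; elim: l => //= b l IH h.
have Cx : C (crefl l a) by apply: IH => c cl; apply: h; rewrite inE cl orbT.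
have Pb : Psi b by apply: h; rewrite mem_head.
have [Cb|nCb] := pselect (C b); first exact: (sub_refl (comp_subsystem SP CC)).
by rewrite (comp_orth SP CC)// mulr0z subr0.
Qed.

Lemma crefl_lattice l a : {in l, forall b, D b} -> nspan D a -> nspan D (crefl l a).
Proof.
move=> + La; elim: l => //= b l IH h.
apply: nspanD; first by apply: IH => c cl; apply: h; rewrite inE cl orbT.
by apply/latticeN/latticeMz/lattice_root/h; rewrite mem_head.
Qed.

Lemma crefl_root l a : {in l, forall b, D b} -> D a -> D (crefl l a).
Proof.
move=> + La; elim: l => //= b l IH h.
apply: (rs_refl RS); first by apply: IH => c cl; apply: h; rewrite inE cl orbT.
by apply: h; rewrite mem_head.
Qed.

Lemma crefl_isom l a b : {in l, forall b, D b} -> nspan D a -> nspan D b ->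
  B (crefl l a) (crefl l b) = B a b.
Proof.
move=> + La Lb; elim: l => //= c l IH h.
have h' : {in l, forall b, D b} by move=> d dl; apply: h; rewrite inE dl orbT.
rewrite -(IH h'); have Dc : D c by apply: h; rewrite mem_head.
have := crefl_lattice h' La; have := crefl_lattice h' Lb; move: (crefl l a) (crefl l b) => x y Ly Lx.
rewrite !(BDl, BDr, BNl, BNr, BMzl, BMzr) (Bsym c y).
have := rs_pr RS Lx Dc; have := rs_pr RS Ly Dc; move: (pr x c) (pr y c) => n m hm hn.
rewrite mulNrz opprK -!(mulrzr (B _ _)) -(mulrzr (_ * _)).
have e1 : B x c * 2 * m%:~R = n%:~R * B c c * m%:~R by rewrite -hn; ring.
have e2 : B y c * 2 * n%:~R = m%:~R * B c c * n%:~R by rewrite -hm; ring.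
apply/eqP; rewrite -subr_eq0; apply/eqP.
have n2 : (2%:R : F) != 0 by rewrite pnatr_eq0.
apply: (mulfI n2); rewrite mulr0.
transitivity ((n%:~R * B c c * m%:~R - B x c * 2 * m%:~R) +
  (m%:~R * B c c * n%:~R - B y c * 2 * n%:~R)).
  by ring.
by rewrite e1 e2 !subrr addr0.
Qed.

Lemma pr_crefl l a b : {in l, forall b, D b} -> nspan D a -> D b ->
  pr (crefl l a) (crefl l b) = pr a b.
Proof.
move=> h La Db; apply: pr_def; [exact: crefl_lattice|exact: crefl_root|].
by rewrite !crefl_isom ?(rs_pr RS)//; exact: lattice_root.
Qed.

Lemma creflE l a : strongly_orthogonal l -> nspan D a ->
  crefl l a = a - \sum_(b <- l) b *~ pr a b.
Proof.
move=> + La; elim: l => [|b l IH] Hl; first by rewrite big_nil subr0.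
have [/= /andP[bl ul] lD lo ls] := Hl.
have lD' : {in l, forall b, D b} by move=> d dl; apply: lD; rewrite inE dl orbT.
have Hl' : strongly_orthogonal l.
  by split=> // [c d cl dl|c d cl dl]; [apply: lo|apply: ls]; rewrite inE ?cl ?dl orbT.
have Db : D b by apply: lD; rewrite mem_head.
have e : pr (crefl l a) b = pr a b.
  rewrite IH// prB//; last exact: so_lattice.
  rewrite pr_sum//; last by move=> c /lD'/lattice_root/latticeMz.
  rewrite big_seq big1 ?subr0// => c cl; rewrite prMz//; last exact/lattice_root/lD'.
  rewrite lo ?mul0r ?inE ?cl ?eqxx ?orbT//; by apply: contraNneq bl => <-.
by rewrite /= -/(crefl l a) e IH// big_cons; vring.
Qed.

Lemma creflD l a b : strongly_orthogonal l -> nspan D a -> nspan D b ->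
  crefl l (a + b) = crefl l a + crefl l b.
Proof.
move=> Hl La Lb; rewrite !creflE//; last exact: nspanD.
rewrite (_ : \sum_(c <- l) c *~ pr (a + b) c =
  \sum_(c <- l) c *~ pr a c + \sum_(c <- l) c *~ pr b c); first by vring.
rewrite -big_split /= big_seq [RHS]big_seq; apply: eq_bigr => c cl.
by rewrite prD ?mulrzDr//; exact: (so_D Hl).
Qed.

Lemma creflN l a : strongly_orthogonal l -> nspan D a -> crefl l (- a) = - crefl l a.
Proof.
move=> Hl La; rewrite !creflE//; last exact: latticeN.
rewrite (_ : \sum_(c <- l) c *~ pr (- a) c = - \sum_(c <- l) c *~ pr a c); first by vring.
rewrite -sumrN big_seq [RHS]big_seq; apply: eq_bigr => c cl.
by rewrite prN ?mulrNz//; exact: (so_D Hl).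
Qed.

Lemma creflK l a : strongly_orthogonal l -> nspan D a -> crefl l (crefl l a) = a.
Proof.
move=> Hl La; have lD := so_D Hl; rewrite (creflE (a := crefl l a))//; last exact: crefl_lattice.
have -> : \sum_(b <- l) b *~ pr (crefl l a) b = - \sum_(b <- l) b *~ pr a b.
  rewrite -sumrN big_seq [RHS]big_seq; apply: eq_bigr => b bl.
  rewrite creflE// prB ?so_pr_sum//; [|exact: so_lattice|exact: lD].
  by rewrite -mulrNz; congr (_ *~ _); ring.
by rewrite creflE// opprK subrK.
Qed.

(** By induction along the cascade. A positive root orthogonal to [th] is
    treated by the remaining reflections. The others pair to 1 with [th], so the
    image is [crefl l a - th], which cannot be positive as [th] is highest; [th]
    itself is mapped to its opposite. *)
Lemma crefl_neg Psi l a : subsystem Psi -> cascade_list Psi l -> pos Psi a ->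
  Dp (- crefl l a).
Proof.
move=> + hl; elim: hl a => [a _ []//|{}Psi C th {}l CC Hth hl IH a SP [Pa Dpa]].
have SC := comp_subsystem SP CC; have SP' := perp_subsystem th SP.
have Cth : C th by case: Hth => -[].
have Dth := subD SC Cth; have Da := subD SP Pa.
have Hl : strongly_orthogonal (th :: l) by apply: cascade_list_strong SP (cascade_cons CC Hth hl).
have Hl' := cascade_list_strong SP' hl.
have lP : {in th :: l, forall b, Psi b}.
  by move=> b /(cascade_list_pos SP (cascade_cons CC Hth hl))[].
have [a0|a0] := eqVneq (pr a th) 0.
  have : Dp (- crefl l a).
    by apply: IH => //; split=> //; split=> //; apply/pr_B0 => //; exact: lattice_root.
  by rewrite !creflE ?big_cons ?a0 ?mulr0z ?add0r//; exact: lattice_root.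
have Ca : C a by apply: (comp_nonorth SP CC Cth) => //; rewrite pr_eq0C.
have Cw : C (crefl (th :: l) a) by exact: (crefl_sub SP CC lP Ca).
have [ath|ath] := eqVneq a th.
  rewrite ath creflE//; last exact: lattice_root.
  rewrite big_cons pr_self// big_seq big1 ?addr0; last first.
    move=> c cl; rewrite (so_pr Hl) ?mulr0z// ?inE ?cl ?eqxx ?orbT//.
    by case: Hl => /= /andP[tl _] _ _ _; apply: contraNneq tl => ->.
  by rewrite (_ : - _ = th); [case: Hth => -[]|vring].
have a1 : pr a th = 1.
  exact: (high_pr_eq1 SC Hth _ (elimN eqP ath)).
have [h|h] := sub_pos_or_neg SC Cw; last by case: h.
exfalso; apply: ((high_top SC Hth).2 _ h).
rewrite (_ : th + _ = crefl l a); first by apply: crefl_root => //; exact: (so_D Hl').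
by rewrite !creflE ?big_cons ?a1//; [vring|exact: lattice_root|exact: lattice_root].
Qed.

Lemma pr_mul_ge0 a b : D a -> D b -> 0 <= pr a b * pr b a.
Proof.
move=> Da Db; case: (ltgtP (pr a b) 0) => [h|h|->]; last by rewrite mul0r.
  by rewrite nmulr_rge0// -pr_le0C// ltW.
by rewrite pmulr_rge0// pr_ge0C// ltW.
Qed.

(** The two pairings are integers of the same sign that vanish together. *)
Lemma pr_mul_abs a b : D a -> D b -> `|pr a b| <= pr a b * pr b a.
Proof.
move=> Da Db; case: (ltgtP (pr a b) 0) => [h|h|->]; last by rewrite mul0r normr0.
  by move: (h); rewrite pr_lt0C// => h'; nia.
by move: (h); rewrite pr_gt0C// => h'; nia.
Qed.

(** Bessel's inequality: the vector [2 a - sum_b pr a b *: b] has norm [(4 - N)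
    * B a a], where [N] is the left-hand side. *)
Lemma bessel l a : strongly_orthogonal l -> D a ->
  \sum_(b <- l) pr a b * pr b a <= 4.
Proof.
move=> Hl Da; have La := lattice_root Da.
set u := \sum_(b <- l) b *~ pr a b; have Lu : nspan D u by exact: so_lattice.
set N := \sum_(b <- l) _.
have uN : pr u a = N.
  rewrite /u pr_sum//; last by move=> c /(so_D Hl)/lattice_root/latticeMz.
  rewrite /N big_seq [RHS]big_seq; apply: eq_bigr => b bl.
  by rewrite prMz 1?mulrC//; exact/lattice_root/(so_D Hl).
have uu : B u u = 2 * B u a.
  rewrite {1}/u Bsuml mulrC /u Bsuml big_distrl /= big_seq [RHS]big_seq.
  apply: eq_bigr => b bl; have Db := so_D Hl bl.
  have e1 := rs_pr RS Lu Db; have e2 := rs_pr RS La Db.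
  rewrite /u so_pr_sum// -/u in e1.
  have n2 : (2%:R : F) != 0 by rewrite pnatr_eq0.
  rewrite !BMzl -!(mulrzr (B b _)); apply: (mulfI n2); rewrite (Bsym b u) (Bsym b a).
  by rewrite mulrA e1 intrM; have -> : 2%:R * (B a b * (pr a b)%:~R * 2) =
    (2 * B a b) * (pr a b)%:~R * 2%:R by [ring]; rewrite e2; ring.
have := rs_ge0 RS (nspanD (nspanMn 2 La) (latticeN Lu)).
have -> : B (a *+ 2 - u) (a *+ 2 - u) = (4 - N)%:~R * B a a.
  rewrite !(BDl, BDr, BNl, BNr) (Bsym a u) uu.
  rewrite intrB mulrBl -uN -(rs_pr RS Lu Da); ring.
by rewrite pmulr_lge0 ?ler0z ?subr_ge0//; exact: (rs_pos RS).
Qed.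

(** * Parity of the cascade sums *)

(** Twice the value of [a] at the cascade element, when [l] lists the cascade. *)
Definition csum l a : int := \sum_(b <- l) pr a b.

(** Besides the Cartan matrix, the induction needs the action of the longest
    element (it reverses the chain), the highest root (the sum of the chain) and
    its pairings, and the fact that all these roots have the same length. *)
Definition typeA_chain C l n (x : nat -> V) : Prop :=
  let th := \sum_(0 <= i < n) x i in
  [/\ forall c, simple C c <-> exists2 i, (i < n)%N & c = x i,
      forall i j, (i < n)%N -> (j < n)%N -> pr (x i) (x j) =
        if i == j then 2 else if (i.+1 == j) || (j.+1 == i) then - 1 else 0,
      forall i, (i < n)%N -> crefl l (x i) = - x (n.-1 - i)%N,
      highest_root (pos C) th
    & forall i, (i < n)%N -> B (x i) (x i) = B th th
        /\ pr th (x i) = (i == 0%N)%:Z + (i == n.-1)%:Z].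

Definition typeA_even C l : Prop :=
  exists p x, (0 < p)%N /\ typeA_chain C l (2 * p) x.

(** ** One step of the cascade

    In this section [C] is a component with highest root [th], and [w] is the longest
    element for the cascade that starts with [th]. *)
Section Core.
Variables (Psi C : set V) (th : V) (l : seq V).
Hypotheses (SP : subsystem Psi) (CC : irr_component B Psi C).
Hypotheses (Hth : highest_root (pos C) th) (hl : cascade_list (perp Psi th) l).

Let SC := comp_subsystem SP CC.
Let hl0 := cascade_cons CC Hth hl.
Let Hl0 : strongly_orthogonal (th :: l) := cascade_list_strong SP hl0.
Let Hl : strongly_orthogonal l := cascade_list_strong (perp_subsystem th SP) hl.
Let lD := so_D Hl0.
Let Dth : D th := highD SC Hth.
Let w := crefl (th :: l).

Lemma crefl_perp a : nspan D a -> pr a th = 0 -> w a = crefl l a.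
Proof. by move=> La a0; rewrite /w !creflE// big_cons a0 mulr0z add0r. Qed.

Lemma w_pos a : pos C a -> pos C (- w a).
Proof.
move=> [Ca Dpa]; split; last first.
  by apply: crefl_neg SP hl0 _; split=> //; exact: (compS CC).
apply: (subN SC); apply: (crefl_sub SP CC) => // b /(cascade_list_pos SP hl0)[]//.
Qed.

Lemma w_opp a : D a -> - w (- w a) = a.
Proof.
move=> Da; rewrite /w creflN ?opprK ?creflK//; do ?exact: lattice_root.
by apply: crefl_lattice => //; exact: lattice_root.
Qed.

(** The opposite of [w] permutes the positive roots of [C] and is additive. *)
Lemma w_simple a : simple C a -> simple C (- w a).
Proof.
move=> Sa; split; first exact/w_pos/subS_P.
move=> [b [c [Pb Pc e]]]; have Da := subS_D SC Sa.
apply: (simple_not_sum Sa (w_pos Pb) (w_pos Pc)).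
rewrite -[LHS]w_opp// e /w creflD ?opprD//; exact/lattice_root/(subP_D SC).
Qed.

(** A chain of even length grows by one node at each end. For [n = 0] this is
    the construction of type A_2 from two adjacent simple roots, whence the two
    cases in the pairing of [a] with [b]. *)
Lemma chain_extend n (x : nat -> V) a b : ~~ odd n ->
  simple C a -> simple C b -> w a = - b -> w b = - a ->
  pr a b = (if n == 0%N then -1 else 0) -> pr b a = (if n == 0%N then -1 else 0) ->
  a + b + \sum_(0 <= i < n) x i = th ->
  B a a = B th th -> B b b = B th th -> pr th a = 1 -> pr th b = 1 ->
  (forall k, (k < n)%N -> [/\ simple C (x k), pr th (x k) = 0,
    w (x k) = - x (n.-1 - k)%N & B (x k) (x k) = B th th]) ->
  (forall i j, (i < n)%N -> (j < n)%N -> pr (x i) (x j) =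
        if i == j then 2 else if (i.+1 == j) || (j.+1 == i) then - 1 else 0) ->
  (forall k, (k < n)%N -> pr a (x k) = - (k == 0%N)%:Z /\ pr b (x k) = - (k == n.-1)%:Z) ->
  typeA_even C (th :: l).
Proof.
move=> oddn Sa Sb wa wb ab ba sum Baa Bbb tha thb Hx xx abx.
have Da := subS_D SC Sa; have Db := subS_D SC Sb.
have Dx k : (k < n)%N -> D (x k) by move=> /Hx[/(subS_D SC)].
pose y (i : nat) : V := if i == 0%N then a else if i == n.+1 then b else x i.-1.
have y0 : y 0%N = a by [].
have yn : y n.+1 = b by rewrite /y eqxx.
have yx k : (k < n)%N -> y k.+1 = x k by move=> kn; rewrite /y eqSS (ltn_eqF kn).
have ysum : \sum_(0 <= i < n.+2) y i = th.
  rewrite big_nat_recl// big_nat_recr//= y0 yn -sum.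
  rewrite (_ : \sum_(0 <= i < n) y i.+1 = \sum_(0 <= i < n) x i); first by vring.
  by apply: eq_big_nat => i /andP[_ /yx].
have case_y i : (i < n.+2)%N -> [\/ i = 0%N, i = n.+1 | exists2 k, (k < n)%N & i = k.+1].
  case: i => [|i]; first by constructor 1.
  rewrite ltnS leq_eqVlt eqSS => /orP[/eqP->|ik]; first by constructor 2.
  by constructor 3; exists i.
have xsym u k : D u -> B u u = B th th -> (k < n)%N -> pr (x k) u = pr u (x k).
  move=> Du Bu kn; have [_ _ _ Bx] := Hx k kn; have Dxk := Dx k kn.
  apply: pr_def => //; first exact: lattice_root.
  by rewrite Bsym (rs_pr RS (lattice_root Du) Dxk) Bx Bu.
exists n./2.+1, y; split=> //; have -> : (2 * n./2.+1)%N = n.+2.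
  by have := odd_double_half n; rewrite (negbTE oddn); lia.
have Sy i : (i < n.+2)%N -> simple C (y i).
  by case/case_y => [->|->|[k kn ->]]; rewrite ?yn// yx//; case: (Hx k kn).
split; rewrite ?ysum//.
- move=> c; split=> [Sc|[i /Sy ? ->//]].
  have : c \in [seq y i | i <- index_iota 0 n.+2].
    apply: (high_support SC Hth) => //; last by rewrite big_map ysum.
    by move=> d /mapP[k]; rewrite mem_index_iota => /andP[_ /Sy ?] ->.
  by move=> /mapP[k]; rewrite mem_index_iota => /andP[_ ?] ->; exists k.
- move=> i j; case/case_y => [->|->|[k kn ->]]; case/case_y => [->|->|[m mn ->]];
    rewrite ?y0 ?yn ?yx ?pr_self ?eqxx//.
  + by rewrite ab; do ?[case: eqP => ?]; rewrite /=; lia.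
  + by rewrite (abx m mn).1; do ?[case: eqP => ?]; rewrite /=; lia.
  + by rewrite ba; do ?[case: eqP => ?]; rewrite /=; lia.
  + by rewrite (abx m mn).2; do ?[case: eqP => ?]; rewrite /=; lia.
  + by rewrite xsym// (abx k kn).1; do ?[case: eqP => ?]; rewrite /=; lia.
  + by rewrite xsym// (abx k kn).2; do ?[case: eqP => ?]; rewrite /=; lia.
  + by rewrite xx// !eqSS.
- move=> i; case/case_y => [->|->|[k kn ->]].
  + by rewrite subn0 /= yn y0.
  + by rewrite subnn y0 yn.
  + have -> : (n.+2.-1 - k.+1)%N = (n.-1 - k).+1 by lia.
    by rewrite !yx//; [case: (Hx k kn)|lia].
- move=> i; case/case_y => [->|->|[k kn ->]].
  + by rewrite y0 Baa tha.
  + by rewrite yn Bbb thb eqxx.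
  + rewrite yx//; case: (Hx k kn) => _ -> _ ->; split=> //=.
    by rewrite eqSS ltn_eqF.
Qed.

Lemma simple_perp_comp C1 c : irr_component B (perp Psi th) C1 -> C1 `<=` C ->
  simple C1 c -> simple C c.
Proof.
move=> CC1 C1C Sc; have SP' := perp_subsystem th SP.
have SC1 := comp_subsystem SP' CC1.
 have [[C1c Dpc] _] := Sc; split; first by split=> //; exact: C1C.
move=> [u [v [[Cu Dpu] [Cv Dpv] cuv]]].
have [_ c0] : perp Psi th c := compS CC1 C1c.
have Du := subD SC Cu; have Dv := subD SC Cv.
have {}c0 : pr u th + pr v th = 0.
  rewrite -prD//; do ?exact: lattice_root.
  rewrite -cuv; apply/pr_B0 => //; exact/lattice_root/(subS_D SC1).
have u0 := high_pr_ge0C SC Hth (conj Cu Dpu); have v0 := high_pr_ge0C SC Hth (conj Cv Dpv).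
have Pu : perp Psi th u.
  by split; [exact: (compS CC)|apply/pr_B0 => //; [exact: lattice_root|lia]].
have Pv : perp Psi th v.
  by split; [exact: (compS CC)|apply/pr_B0 => //; [exact: lattice_root|lia]].
have key y z : perp Psi th y -> perp Psi th z -> Dp y -> Dp z -> c = y + z -> C1 y -> False.
  move=> Py Pz Dpy Dpz cyz C1y; have C1z : C1 z.
    have -> : z = c - y by rewrite cyz addrC addKr.
    by apply: (sub_subr SC1) => //; rewrite cyz addrC addKr; exact: posD.
  by apply: (simple_not_sum Sc _ _ cyz).
have [C1u|nu] := pselect (C1 u); first exact: (key u v).
have [C1v|nv] := pselect (C1 v); first by apply: (key v u) => //; rewrite addrC.
have Dc := subS_D SC1 Sc.
have : pr c c = 0.
  rewrite {1}cuv prD//; do ?exact: lattice_root.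
  by rewrite !(comp_orthC SP' CC1).
by rewrite pr_self.
Qed.

(** Here [a] is a simple root of [C] that is attached to the affine node, that
    is, not orthogonal to [th]. *)
Section Attached.
Variable a : V.
Hypotheses (Sa : simple C a) (ath : pr a th != 0) (neath : a <> th).
Let a' := - w a.
Let Da : D a := subS_D SC Sa.
Let Sa' : simple C a' := w_simple Sa.
Let Da' : D a' := subS_D SC Sa'.
Let e b := pr a b * pr b a.

(** Both sides are the difference of [a] and [w a]. *)
Lemma att_sum : a + a' = \sum_(b <- th :: l) b *~ pr a b.
Proof. by rewrite /a' /w creflE//; [vring|exact: lattice_root]. Qed.

Lemma att_th : pr a th = 1.
Proof. exact: (high_pr_eq1 SC Hth (subS_P Sa) neath ath). Qed.

Lemma att_e_ge0 b : b \in th :: l -> 0 <= e b.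
Proof. by move=> bl; apply: pr_mul_ge0 => //; exact: lD. Qed.

Lemma att_e_abs b : b \in th :: l -> `|pr a b| <= e b.
Proof. by move=> bl; apply: pr_mul_abs => //; exact: lD. Qed.

Lemma att_e_absr b : b \in th :: l -> `|pr b a| <= e b.
Proof. by move=> bl; rewrite /e mulrC; apply: pr_mul_abs => //; exact: lD. Qed.

Lemma att_th_ge1 : 1 <= e th.
Proof. by have := att_e_abs (mem_head _ _); rewrite att_th. Qed.

Lemma att_N : \sum_(b <- th :: l) e b = 2 + pr a' a.
Proof.
rewrite -[X in X + _](pr_self Da) -prD//; do ?exact: lattice_root.
rewrite att_sum pr_sum//; last by move=> b /lD/lattice_root/latticeMz.
rewrite big_seq [RHS]big_seq; apply: eq_bigr => b bl.
by rewrite prMz 1?mulrC//; exact/lattice_root/lD.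
Qed.

Lemma sum_ge0_eq0 (T : eqType) (r : seq T) (f : T -> int) :
  {in r, forall i, 0 <= f i} -> \sum_(i <- r) f i = 0 -> {in r, forall i, f i = 0}.
Proof.
move=> f0 s0 i ir; move: s0; rewrite (big_rem i ir)/=.
move=> s0; apply/eqP; rewrite eq_le f0// andbT -s0 lerDl big_seq sumr_ge0//.
by move=> j /mem_rem/f0.
Qed.

(** As the products of pairings bound the pairings, a vanishing sum of products
    kills each term. *)
Lemma att_vanish (r : seq V) : {subset r <= th :: l} -> \sum_(b <- r) e b = 0 ->
  \sum_(b <- r) b *~ pr a b = 0 /\ \sum_(b <- r) pr a b = 0.
Proof.
move=> rl e0; have z b : b \in r -> pr a b = 0.
  move=> br; have := att_e_abs (rl _ br).
  by rewrite (sum_ge0_eq0 _ e0)// => [|c /rl /att_e_ge0//]; lia.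
by split; rewrite big_seq big1// => b /z->.
Qed.

(** The products of pairings add up to 4. If the pairings [pr a b] had an odd
    sum, some member [k] would have [pr a k] odd and [pr k a] even; then [pr a
    k] is [1] or [-1], and [pr k a] is twice or four times it. *)
Lemma att_N4_even : a' = a -> (2 %| csum (th :: l) a)%Z.
Proof.
move=> ea; have N4 : \sum_(b <- th :: l) e b = 4 by rewrite att_N ea pr_self.
have e2 := att_sum; rewrite ea in e2.
apply/negPn/negP => odd.
have ul : uniq (th :: l) by case: Hl0.
have /hasP[k kl hk] : has (fun b => ~~ (2 %| pr a b - e b)%Z) (th :: l).
  apply: contraNT odd => /hasPn h.
  have : (2 %| \sum_(b <- th :: l) (pr a b - e b))%Z.
    rewrite big_seq; elim/big_rec: _ => [|b x bl hx]; first by rewrite dvdz0.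
    by apply: rpredD => //; have := h _ bl; rewrite negbK.
  by rewrite sumrB N4 /csum; move: (\sum_(b <- _) _) => X; lia.
have ek := N4; rewrite (big_rem k kl) /= in ek.
have := att_e_absr kl; have := att_e_abs kl; have := att_e_ge0 kl.
have e0 : 0 <= \sum_(b <- rem k (th :: l)) e b.
  by rewrite big_seq sumr_ge0// => b /mem_rem/att_e_ge0.
move=> k0 kn km.
have sl : {subset rem k (th :: l) <= th :: l} by move=> b /mem_rem.
have [s [sE nk [mk|mk]]] : exists s : int, [/\ s = 1 \/ s = -1, pr a k = s &
    pr k a = s * 2 \/ pr k a = s * 4].
  exists (pr a k); move: hk ek k0 kn km; rewrite /e; move: e0.
  move: (\sum_(b <- _) _) (pr a k) (pr k a) => X n m X0 hk ek k0 kn km.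
  have nm : n * m <= 4 by lia.
  have [n1|n1] : n = 1 \/ n = -1.
    have : `|n| = 1 \/ 3 <= `|n| by nia.
    by case=> [|h]; [lia|nia].
  - by split; [lia| |nia].
  - by split; [lia| |nia].
(* If [pr k a] is [2] or [-2], reflecting [k] in [a] leaves, up to sign, the sum
   [u] of the other terms, so [u] is a root; but [u] is twice a member of the
   list up to sign, or a sum or difference of two members. *)
- have Eu : \sum_(b <- rem k (th :: l)) e b = 2 
    by move: ek; rewrite /e nk mk; move: (\sum_(b <- _) _) => X; case: sE => ->; lia.
  set u := \sum_(b <- rem k (th :: l)) b *~ pr a b.
  have Du : D u.
    have := rs_refl RS (lD kl) Da; rewrite mk.
    have -> : a *~ (s * 2) = (a + a) *~ s by rewrite mulrC mulrzA.
    rewrite e2 (big_rem k kl) /= -/u nk; case: sE => ->.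
      rewrite (_ : k - _ = - u); last by vring.
      by move/Dopp; rewrite opprK.
    by rewrite (_ : k - _ = u)//; vring.
  set r := rem k (th :: l) in sl Eu u Du *.
  have evr : (2 %| \sum_(b <- r) pr a b)%Z.
    move: odd; rewrite /csum (big_rem k kl)/= nk -/r; move: (\sum_(b <- r) _) => X.
    by case: sE => ->; lia.
  have /int_sum_pos_ex[c cr c0] : 0 < \sum_(b <- r) e b by rewrite Eu.
  have sr : {subset rem c r <= th :: l} by move=> b /mem_rem/sl.
  have R0 : 0 <= \sum_(b <- rem c r) e b.
    by rewrite big_seq sumr_ge0// => b /sr/att_e_ge0.
  have cl := sl _ cr; have Dc := lD cl.
  move: (Eu); rewrite (big_rem c cr)/= => Ec.
  have nc := att_e_abs cl.
  have [ec|ec] : e c = 2 \/ e c = 1 by move: (\sum_(b <- _) _) R0 Ec => X; lia.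
    have R1 : \sum_(b <- rem c r) e b = 0.
      by move: (\sum_(b <- _) _) Ec => X; rewrite ec; lia.
    have [u0 n0] := att_vanish sr R1.
    move: Du evr; rewrite /u !(big_rem c cr)/= u0 n0 !addr0 => Du evc.
    have : pr a c <> 0 by move=> z; move: ec; rewrite /e z mul0r.
    move: Du evc nc; rewrite ec; move: (pr a c) => n Du evc nc n0'.
    have [n2|n2] : n = 2 \/ n = - 2 by lia.
      by move: Du; rewrite n2; exact: (rs_red RS Dc).
    by move: Du; rewrite n2 mulrNz => /Dopp; rewrite opprK; exact: (rs_red RS Dc).
  have R1 : \sum_(b <- rem c r) e b = 1.
    by move: (\sum_(b <- _) _) Ec => X; rewrite ec; lia.
  have /int_sum_pos_ex[d dr d0] : 0 < \sum_(b <- rem c r) e b by rewrite R1.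
  have st : {subset rem d (rem c r) <= th :: l} by move=> b /mem_rem/sr.
  have T0 : 0 <= \sum_(b <- rem d (rem c r)) e b.
    by rewrite big_seq sumr_ge0// => b /st/att_e_ge0.
  move: R1; rewrite (big_rem d dr)/= => R1.
  have [ed T1] : e d = 1 /\ \sum_(b <- rem d (rem c r)) e b = 0.
    by move: (\sum_(b <- _) _) T0 R1 => X; lia.
  have [u0 _] := att_vanish st T1.
  have dl := sr _ dr; have nd := att_e_abs dl.
  have cd : c != d by move: dr; rewrite mem_rem_uniq ?rem_uniq// inE eq_sym => /andP[].
  have unit x : x \in th :: l -> e x = 1 -> pr a x = 1 \/ pr a x = -1.
    move=> xl ex; have nz : pr a x != 0.
      by apply/eqP => z; move: ex; rewrite /e z mul0r.
    by have := att_e_abs xl; rewrite ex; move: nz; move: (pr a x) => n; clear; lia.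
  move: Du; rewrite /u (big_rem c cr)/= (big_rem d dr)/= u0 addr0.
  have [_ _ _ noadd] := Hl0; have nosub := so_sub Hl0.
  have [->|->] := unit c cl ec; have [->|->] := unit d dl ed;
    rewrite ?mulrN1z ?mulr1z.
  - exact: noadd.
  - exact: nosub.
  - by rewrite addrC; apply: nosub; rewrite // eq_sym.
  - by move=> /Dopp; rewrite opprD !opprK; exact: noadd.
(* If it is [4] or [-4], all other terms vanish; the one of [th] does not, so
   [k = th] and [a *+ 2 = th]. *)
- have Eu : \sum_(b <- rem k (th :: l)) e b = 0 
    by move: ek; rewrite /e nk mk; move: (\sum_(b <- _) _) => X; case: sE => ->; lia.
  have [eth|nth] := eqVneq k th.
    have [u0 _] := att_vanish sl Eu.
    move: e2; rewrite (big_rem k kl)/= u0 addr0 eth att_th mulr1z => e2.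
    by apply: (rs_red RS Da); rewrite mulr2n e2.
  have thr : th \in rem k (th :: l) by rewrite mem_rem_uniq// inE eq_sym nth mem_head.
  have := att_th_ge1; rewrite (sum_ge0_eq0 _ Eu)// => b /sl; exact: att_e_ge0.
Qed.

Lemma w_a : w a = - a'. Proof. by rewrite /a' opprK. Qed.
Lemma w_a' : w a' = - a.
Proof. by rewrite -[a in RHS]w_opp ?opprK// -/a'. Qed.

Lemma att_B : B a' a' = B a a.
Proof.
have La := lattice_root Da.
by rewrite /a' BNl BNr opprK /w crefl_isom//.
Qed.

Lemma att_prC : pr a a' = pr a' a.
Proof.
have La := lattice_root Da; have La' := lattice_root Da'.
have DNa := Dopp Da.
by have := pr_crefl lD La Da'; rewrite -/w w_a w_a' (prN La' DNa) (prNr La' Da) opprK => ->.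
Qed.

Lemma att_th_B : e th = 1 -> B a a = B th th /\ pr th a = 1.
Proof.
rewrite /e att_th mul1r => tha; split=> //.
have := rs_pr RS (lattice_root Da) Dth; have := rs_pr RS (lattice_root Dth) Da.
by rewrite att_th tha !mul1r Bsym => ->.
Qed.

(** If [a' = a], the previous parity statement applies. Otherwise the products
    of pairings add up to 1 or 2, and the term of [th] is at least 1. Either it
    is the whole sum, so that [a + a' = th], and [pr a' a = 0] is impossible
    because reflecting [th] in [a] would make [a' - a] a root; or a single other
    member contributes, with pairing 1 or -1. *)
Lemma att_even_or_A2 : (2 %| csum (th :: l) a)%Z \/ typeA_even C (th :: l).
Proof.
have [ea|ea] := eqVneq a' a; first by left; exact: att_N4_even.
have pr0 : pr a' a <= 0 by apply: (simple_pr_le0 SC) => //; exact/eqP.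
have := att_N; rewrite big_cons => N.
have th1 := att_th_ge1.
have ll : {subset l <= th :: l} by move=> b bl; rewrite inE bl orbT.
have S0 : 0 <= \sum_(b <- l) e b by rewrite big_seq sumr_ge0// => b /ll/att_e_ge0.
have [S1|S1] : \sum_(b <- l) e b = 0 \/ \sum_(b <- l) e b = 1 /\ e th = 1.
  by move: (\sum_(b <- l) _) (e th) (pr a' a) N th1 S0 pr0; clear; lia.
- have [u0 _] := att_vanish ll S1.
  have := att_sum; rewrite big_cons u0 att_th mulr1z addr0 => aa'.
  have [p0|p1] : pr a' a = 0 \/ pr a' a = -1 /\ e th = 1.
    by move: N th1; rewrite S1; move: (e th) (pr a' a) pr0; clear; lia.
    exfalso; have := rs_refl RS Dth Da.
    have -> : pr th a = 2 by rewrite -aa' prD ?p0 ?pr_self//; exact: lattice_root.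
    rewrite -aa' (_ : _ - _ = a' - a); last by vring.
    move=> h; apply: (simple_not_sum Sa' (simple_sub SC Sa (subS_P Sa') h) (subS_P Sa)).
    by rewrite subrK.
  have [{}p1 eth] := p1; have [Bath tha] := att_th_B eth; right.
  apply: (@chain_extend 0 (fun=> 0) a a') => //.
  + exact: w_a.
  + exact: w_a'.
  + by rewrite att_prC.
  + by rewrite big_nil addr0.
  + by rewrite att_B.
  + by rewrite -aa' prD ?att_prC ?p1 ?pr_self//; exact: lattice_root.
- left; have [{}S1 eth] := S1.
  have /int_sum_pos_ex[c cl c0] : 0 < \sum_(b <- l) e b by rewrite S1.
  move: S1; rewrite (big_rem c cl)/= => S1.
  have sr : {subset rem c l <= th :: l} by move=> b /mem_rem/ll.
  have R0 : 0 <= \sum_(b <- rem c l) e b.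
    by rewrite big_seq sumr_ge0// => b /sr/att_e_ge0.
  have [ec R1] : e c = 1 /\ \sum_(b <- rem c l) e b = 0.
    by move: (\sum_(b <- rem c l) _) (e c) c0 R0 S1; clear; lia.
  have [_ n0] := att_vanish sr R1.
  rewrite /csum big_cons (big_rem c cl)/= n0 att_th addr0.
  have nz : pr a c != 0 by apply/eqP => z; move: ec; rewrite /e z mul0r.
  have := att_e_abs (ll _ cl); rewrite ec; move: (pr a c) nz; clear; lia.
Qed.

(** Here [a] is moreover attached to a component [C1] of type A_n, with [n] even
    and nonzero, of the roots orthogonal to [th]. *)
Section Extend.
Variables (C1 : set V) (n : nat) (x : nat -> V).
Hypotheses (CC1 : irr_component B (perp Psi th) C1) (C1C : C1 `<=` C).
Hypotheses (n0 : (0 < n)%N) (oddn : ~~ odd n) (Hx : typeA_chain C1 l n x).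
Let be := \sum_(0 <= i < n) x i.
Hypothesis abe : pr a be < 0.

Let SP' := perp_subsystem th SP.
Let SC1 := comp_subsystem SP' CC1.

Let th1 := att_th_ge1.
Let Hbe : highest_root (pos C1) be. Proof. by case: Hx. Qed.
Let C1x k : (k < n)%N -> simple C1 (x k).
Proof. by move=> kn; case: Hx => h _ _ _ _; apply/h; exists k. Qed.
Let Sx k : (k < n)%N -> simple C (x k).
Proof. by move=> /C1x; exact: simple_perp_comp. Qed.
Let Dx k : (k < n)%N -> D (x k). Proof. by move=> /Sx/(subS_D SC). Qed.
Let xth k : (k < n)%N -> pr (x k) th = 0.
Proof.
move=> kn; have [[C1k _] _] := C1x kn; have [_ h] := compS CC1 C1k.
by apply/pr_B0 => //; exact/lattice_root/Dx.
Qed.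
Let thx k : (k < n)%N -> pr th (x k) = 0.
Proof. by move=> kn; apply/eqP; rewrite pr_eq0C ?xth//; exact: Dx. Qed.
Let ax_ne k : (k < n)%N -> a <> x k.
Proof. by move=> kn ak; move: ath; rewrite ak xth. Qed.
Let ax_le0 k : (k < n)%N -> pr a (x k) <= 0.
Proof. by move=> kn; apply: (simple_pr_le0 SC) => //; [exact: Sx|exact: ax_ne]. Qed.
Let wx k : (k < n)%N -> w (x k) = - x (n.-1 - k)%N.
Proof.
move=> kn; rewrite crefl_perp ?xth//; last exact/lattice_root/Dx.
by case: Hx => _ _ h _ _; exact: h.
Qed.
Let ax_rev k : (k < n)%N -> pr a' (x (n.-1 - k)%N) = pr a (x k).
Proof.
move=> kn; have La' := lattice_root Da'; have kn' : (n.-1 - k < n)%N by lia.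
rewrite -(pr_crefl lD (lattice_root Da) (Dx kn)) -/w w_a wx// prN ?prNr ?opprK//; last exact/Dopp/Dx.
exact: Dx.
Qed.
Let bel : be \in th :: l.
Proof. by rewrite inE (cascade_list_high SP' hl CC1 Hbe) orbT. Qed.
Let Dbe : D be := lD bel.
Let beth : be <> th.
Proof.
move=> e1; have [[C1b _] _] := Hbe; have [_] := compS CC1 C1b.
by rewrite e1 => h; have := rs_pos RS Dth; rewrite h ltxx.
Qed.

Lemma att_be_sum : pr a be = \sum_(0 <= i < n) pr a (x i).
Proof.
have La := lattice_root Da.
apply: pr_def => //; rewrite {1}/be Bsumr big_distrr /= raddf_sum /= big_distrl /= !big_nat.
apply: eq_bigr => i /andP[_ ii]; rewrite (rs_pr RS)//; last exact: Dx.
by case: Hx => _ _ _ _ /(_ i ii)[-> _].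
Qed.

Lemma att_be_sumC : pr be a = \sum_(0 <= i < n) pr (x i) a.
Proof.
rewrite /be pr_sum// => i; rewrite mem_index_iota => /andP[_ ii].
exact/lattice_root/Dx.
Qed.

(** If [a' = a], the attachment is symmetric under the reversal of the chain, so
    [pr a be] and [pr be a] are at most -2 and [be] alone contributes at least 4
    to a sum that is 4 in all and has a positive term for [th]. So [a' <> a],
    and the sum is at most 2: [th] and [be] contribute 1 each and nothing else
    does. This gives [a + a' + be = th], and pairing with the nodes of the chain
    shows where [a] and [a'] are attached. *)
Lemma att_extend : typeA_even C (th :: l).
Proof.
have e_th := att_th_ge1; have e_be := att_e_abs bel; have e_be' := att_e_absr bel.
have be_l : be \in l by move: bel; rewrite inE (negbTE (introN eqP beth)).
have ll : {subset l <= th :: l} by move=> b bl; rewrite inE bl orbT.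
have sr : {subset rem be l <= th :: l} by move=> b /mem_rem/ll.
have R0 : 0 <= \sum_(b <- rem be l) e b.
  by rewrite big_seq sumr_ge0// => b /sr/att_e_ge0.
have N := att_N; rewrite big_cons (big_rem be be_l)/= in N.
have [ea|ea] := eqVneq a' a.
  exfalso.
  have [i ii axi] : exists2 i, (i < n)%N & pr a (x i) < 0.
    apply: contrapT => h; move: abe; rewrite att_be_sum big_nat ltNge sumr_ge0//.
    by move=> i /andP[_ ii]; rewrite leNgt; apply/negP => h'; apply: h; exists i.
  pose j := (n.-1 - i)%N.
  have jn : (j < n)%N by rewrite /j; lia.
  have ij : (Ordinal jn != Ordinal ii) by rewrite -val_eqE /= /j; move: oddn; lia.
  have axj : pr a (x j) < 0 by rewrite -ea ax_rev.
  have two (f : nat -> int) : (forall k, (k < n)%N -> f k <= 0) -> f i < 0 -> f j < 0 ->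
      \sum_(0 <= k < n) f k <= -2.
    move=> f0 fi fj; rewrite big_mkord (bigD1 (Ordinal ii))//= (bigD1 (Ordinal jn))//=.
    have : \sum_(k < n | (k != Ordinal ii) && (k != Ordinal jn)) f k <= 0.
      by apply: sumr_le0 => k _; exact: f0.
    by move: (\sum_(k < n | _) _) (f i) (f j) fi fj; clear; lia.
  have h1 : pr a be <= -2 by rewrite att_be_sum; exact: two.
  have h2 : pr be a <= -2.
    rewrite att_be_sumC; apply: two.
    - by move=> k kn; rewrite pr_le0C ?ax_le0//; exact: Dx.
    - by rewrite pr_lt0C//; exact: Dx.
    - by rewrite pr_lt0C//; exact: Dx.
  have h4 : 4 <= e be by rewrite /e; move: (pr a be) (pr be a) h1 h2; clear; nia.
  move: N; rewrite ea pr_self//; move: (\sum_(b <- rem be l) _) (e th) (e be) R0 e_th h4.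
  by clear; lia.
have p0 : pr a' a <= 0 by apply: (simple_pr_le0 SC) => //; exact/eqP.
have e1 : 1 <= e be by apply: le_trans e_be; move: abe; move: (pr a be); clear; lia.
have [eth ebe R1 {}p0] : [/\ e th = 1, e be = 1, \sum_(b <- rem be l) e b = 0 & pr a' a = 0].
  move: N R0 e_th e1 p0; move: (\sum_(b <- rem be l) _) (e th) (e be) (pr a' a).
  by clear; move=> X y z t *; split; lia.
have [u0 _] := att_vanish sr R1.
have abe1 : pr a be = -1 by move: abe e_be; rewrite ebe; move: (pr a be); clear; lia.
have bea1 : pr be a = -1 by move: ebe; rewrite /e abe1; lia.
have aa' : a + a' + be = th.
  by rewrite att_sum big_cons (big_rem be be_l)/= u0 att_th abe1; vring.
have [Bath tha] := att_th_B eth.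
have Bbeth : B be be = B th th.
  rewrite -Bath; have := rs_pr RS (lattice_root Da) Dbe; have := rs_pr RS (lattice_root Dbe) Da.
  by rewrite bea1 abe1 Bsym => ->; rewrite !mulN1r => /oppr_inj.
have tha' : pr th a' = 1.
  have := pr_crefl lD (lattice_root Dth) Da'; rewrite -/w w_a' => <-.
  have -> : w th = - th.
    rewrite /w creflE//; last exact: lattice_root.
    rewrite big_cons pr_self// big_seq big1 => [|b bl]; first by vring.
    rewrite (so_pr Hl0) ?mulr0z ?mem_head ?ll//.
    by case: Hl0 => /= /andP[tl _] _ _ _; apply: contraNneq tl => ->.
  have Lth := lattice_root Dth; have DNa := Dopp Da.
  by rewrite prN ?prNr ?opprK//.
have bex k : (k < n)%N -> pr a (x k) + pr a' (x k) = - ((k == 0%N)%:Z + (k == n.-1)%:Z).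
  move=> kn; have Dk := Dx kn; case: Hx => _ _ _ _ /(_ k kn)[_ <-]; rewrite -/be.
  rewrite -prD//; do ?exact: lattice_root.
  rewrite (_ : a + a' = th - be); last by rewrite -aa'; vring.
  by rewrite prB ?thx ?sub0r//; exact: lattice_root.
have a'x_le0 k : (k < n)%N -> pr a' (x k) <= 0.
  move=> kn; apply: (simple_pr_le0 SC) => //; first exact: Sx.
  move=> a'x; have := thx kn; rewrite -a'x tha'; lia.
have Hxk k : (k < n)%N -> [/\ simple C (x k), pr th (x k) = 0,
    w (x k) = - x (n.-1 - k)%N & B (x k) (x k) = B th th].
  move=> kn; split; [exact: Sx|exact: thx|exact: wx|].
  by case: Hx => _ _ _ _ /(_ k kn)[-> _].
have xx : forall i j, (i < n)%N -> (j < n)%N -> pr (x i) (x j) =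
    if i == j then 2 else if (i.+1 == j) || (j.+1 == i) then - 1 else 0.
  by case: Hx.
have nn0 : (n == 0%N) = false by rewrite eqn0Ngt n0.
have [n1 n2] : (0 < n)%N /\ n.-1 <> 0%N by split=> //; move: n0 oddn; case: (n) => [|[|]].
have rev k : (k < n)%N -> pr a' (x (n.-1 - k)%N) = pr a (x k) by exact: ax_rev.
have kk0 k : (k < n)%N -> (n.-1 - k == 0)%N = (k == n.-1) by move=> ?; apply/eqP/eqP; lia.
have kkn k : (k < n)%N -> (n.-1 - k == n.-1)%N = (k == 0%N) by move=> ?; apply/eqP/eqP; lia.
have fin (u v : nat -> int) : (forall k, (k < n)%N -> u k <= 0) ->
    (forall k, (k < n)%N -> v k <= 0) ->
    (forall k, (k < n)%N -> u k + v k = - ((k == 0%N)%:Z + (k == n.-1)%:Z)) ->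
    u 0%N = -1 -> v n.-1 = -1 ->
    forall k, (k < n)%N -> u k = - (k == 0%N)%:Z /\ v k = - (k == n.-1)%:Z.
  move=> u0' v0' uv u1 v1 k kn; have := uv k kn; have := u0' k kn; have := v0' k kn.
  have [->|k0] := eqVneq k 0%N.
    rewrite u1 (_ : (0%N == n.-1) = false); last by apply/eqP; lia.
    by move: (v 0%N); clear; lia.
  have [->|kn1] := eqVneq k n.-1; last by move: (u k) (v k); clear; lia.
  by rewrite v1; move: (u n.-1); clear; lia.
have last_lt : (n.-1 < n)%N by lia.
have rev0 : pr a' (x n.-1) = pr a (x 0%N) by rewrite -(ax_rev n0) subn0.
have revn : pr a' (x 0%N) = pr a (x n.-1) by rewrite -(ax_rev last_lt) subnn.
have [a0|a0] : pr a (x 0%N) = - 1 \/ pr a' (x 0%N) = - 1.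
- have := bex 0%N n0; rewrite eqxx (_ : (0%N == n.-1) = false); last by apply/eqP; lia.
  by have := ax_le0 n0; have := a'x_le0 0%N n0; move: (pr a _) (pr a' _); clear; lia.
- apply: (@chain_extend n x a a') => //.
  + exact: w_a.
  + exact: w_a'.
  + by rewrite att_prC p0 nn0.
  + by rewrite p0 nn0.
  + by rewrite att_B.
  + apply: (fin (fun k => pr a (x k)) (fun k => pr a' (x k))) => //.
    by rewrite rev0.
- apply: (@chain_extend n x a' a) => //.
  + exact: w_a'.
  + exact: w_a.
  + by rewrite p0 nn0.
  + by rewrite att_prC p0 nn0.
  + by rewrite -aa'; vring.
  + by rewrite att_B.
  + apply: (fin (fun k => pr a' (x k)) (fun k => pr a (x k))) => //.
    * by move=> k kn; rewrite addrC bex.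
    * by rewrite -revn.
Qed.

End Extend.

End Attached.
End Core.

Lemma csumD l a b : {in l, forall c, D c} -> nspan D a -> nspan D b ->
  csum l (a + b) = csum l a + csum l b.
Proof.
move=> lD La Lb; rewrite /csum -big_split /= big_seq [RHS]big_seq.
by apply: eq_bigr => c /lD Dc; rewrite prD.
Qed.

Lemma csumN l a : {in l, forall c, D c} -> nspan D a -> csum l (- a) = - csum l a.
Proof.
move=> lD La; rewrite /csum -sumrN big_seq [RHS]big_seq.
by apply: eq_bigr => c /lD Dc; rewrite prN.
Qed.

(** The highest root [be] of [C1] is orthogonal to [th], which is a sum of
    simple roots among which are those of [C1], and one of these pairs
    positively with [be]. So another term pairs negatively with [be], and only
    terms not orthogonal to [th] can. *)
Lemma attached_exists Psi C th l C1 be : subsystem Psi -> irr_component B Psi C ->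
  highest_root (pos C) th -> cascade_list (perp Psi th) l ->
  irr_component B (perp Psi th) C1 -> C1 `<=` C -> highest_root (pos C1) be ->
  exists a, [/\ simple C a, pr a th != 0, a <> th & pr a be < 0].
Proof.
move=> SP CC Hth hl CC1 C1C Hbe.
have SC := comp_subsystem SP CC; have SP' := perp_subsystem th SP.
have SC1 := comp_subsystem SP' CC1.
have Dth := highD SC Hth; have Dbe := highD SC1 Hbe.
have [s sS e] := nspan_simple SC (highP Hth).
have thbe : pr th be = 0.
  have [_ h] := compS CC1 (highP Hbe).1.
  by apply/eqP; rewrite pr_eq0C//; apply/eqP/pr_B0 => //; exact: lattice_root.
have [c cs cbe] : exists2 c, c \in s & pr c be < 0.
  apply: contrapT => h.
  have ge0 c : c \in s -> 0 <= pr c be.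
    by move=> cs; rewrite leNgt; apply/negP => h'; apply: h; exists c.
  have [t tS e1] := nspan_simple SC1 (highP Hbe).
  have [c ct c0] := simple_pos_pr SC1 (highP Hbe) tS e1.
  have cs : c \in s.
    by apply: (high_support SC Hth sS e); apply: (simple_perp_comp SP CC Hth CC1 C1C); exact: tS.
  have := thbe; rewrite e (@pr_sum _ s id)//; last by move=> d /sS/(subS_D SC)/lattice_root.
  by move=> /(sum_ge0_eq0 ge0)/(_ c cs) z; rewrite z ltxx in c0.
have Sc := sS _ cs; have Dc := subS_D SC Sc.
exists c; split=> //; last by move=> cth; rewrite cth thbe ltxx in cbe.
apply/eqP => cth; move: cbe; rewrite ltNge => /negP; apply.
have [[Cc Dpc] _] := Sc.
have Pc : perp Psi th c by split; [exact: (compS CC)|apply/pr_B0 => //; exact: lattice_root].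
have [C1c|nC1c] := pselect (C1 c); first exact: (high_pr_ge0C SC1 Hbe).
by rewrite (comp_orthC SP' CC1)//; case: (highP Hbe).
Qed.

Lemma typeA_chain_cons C th l n x : strongly_orthogonal (th :: l) -> strongly_orthogonal l ->
  subsystem C -> (forall c, C c -> pr c th = 0) -> typeA_chain C l n x -> typeA_chain C (th :: l) n x.
Proof.
move=> Hl0 Hl SC C0 [h1 h2 h3 h4 h5]; split=> // i ii; rewrite -(h3 _ ii).
have /(subS_P)[Ci _] : simple C (x i) by apply/h1; exists i.
have Li := lattice_root (subD SC Ci).
by rewrite !creflE// big_cons C0// mulr0z add0r.
Qed.

(** By induction along the cascade it suffices to treat the simple roots of the
    component of [th], since the sums are additive. *)
Theorem cascade_parity Psi l : subsystem Psi -> cascade_list Psi l ->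
  forall C, irr_component B Psi C ->
    (forall a, C a -> (2 %| csum l a)%Z) \/ typeA_even C l.
Proof.
move=> + hl; elim: hl => [_ C [C0 [[a /C0]]]//|{}Psi C0 th {}l CC0 Hth hl IH SP C CC].
have SP' := perp_subsystem th SP; have SC0 := comp_subsystem SP CC0.
have hl0 := cascade_cons CC0 Hth hl.
have Hl0 := cascade_list_strong SP hl0; have Hl := cascade_list_strong SP' hl.
have C0th : C0 th by case: Hth => -[].
have Dth := subD SC0 C0th; have SC := comp_subsystem SP CC.
have csum0 a : pr a th = 0 -> csum (th :: l) a = csum l a.
  by move=> a0; rewrite /csum big_cons a0 add0r.
have perpP a : Psi a -> pr a th = 0 -> perp Psi th a.
  move=> Pa a0; split=> //; apply/pr_B0 => //; exact/lattice_root/(subD SP).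
have [CC0e|ne] := pselect (C = C0); last first.
  have C0' c : C c -> pr c th = 0.
    move=> Cc; apply: (comp_orth SP CC) => //; first exact: (compS CC0).
    by move=> Cth; apply: ne; exact: comp_disj CC CC0 Cth C0th.
  have CC' : irr_component B (perp Psi th) C by apply/(comp_perp _ SP CC0 C0th); right.
  have [h|[p [x [p0 h]]]] := IH SP' C CC'.
    by left=> a Ca; rewrite csum0 ?C0'//; exact: h.
  by right; exists p, x; split=> //; exact: typeA_chain_cons.
subst C0; have [hS|hS] := pselect (forall a, simple C a -> (2 %| csum (th :: l) a)%Z).
  left=> a Ca.
  have pos_even b : pos C b -> (2 %| csum (th :: l) b)%Z.
    move: b; apply: (nspan_root_ind SC) => // c d Pc Pd _ hc hd.
    by rewrite csumD ?rpredD//; [exact: (so_D Hl0)|exact/lattice_root/(subP_D SC)..].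
  have [h|h] := sub_pos_or_neg SC Ca; first exact: pos_even.
  rewrite -[a]opprK csumN ?rpredN; [exact: pos_even|exact: (so_D Hl0)|].
  exact/lattice_root/(subP_D SC).
right; move: hS => /existsNP[a /not_implyP[Sa nea]].
have Da := subS_D SC Sa; have Ca : C a by case: Sa => -[].
have neath : a <> th.
  move=> ath; apply: nea; rewrite /csum ath big_cons pr_self// big_seq big1 ?addr0// => b bl.
  rewrite (so_pr Hl0) ?mem_head ?inE ?bl ?orbT//.
  by case: Hl0 => /= /andP[tl _] _ _ _; apply: contraNneq tl => ->.
have [ath|ath] := eqVneq (pr a th) 0; last first.
  by have [|//] := att_even_or_A2 SP CC Hth hl Sa ath neath.
have Pa := perpP a (compS CC Ca) ath.
have [C1 CC1 C1a] := comp_exists (fun b => subD SP' (a := b)) Pa.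
have C1C : C1 `<=` C.
  have [CC1'|[CC1' ne]] := (comp_perp C1 SP CC C0th).1 CC1.
    by move=> c /(compS CC1')[].
  by case: ne; exact: comp_disj CC1' CC C1a Ca.
have [h|[p [x [p0 h]]]] := IH SP' C1 CC1; first by case: nea; rewrite csum0// h.
have Hbe : highest_root (pos C1) (\sum_(0 <= i < 2 * p) x i) by case: h.
have [b [Sb bth neb bbe]] := attached_exists SP CC Hth hl CC1 C1C Hbe.
apply: (att_extend SP CC Hth hl Sb bth neb CC1 C1C _ _ h bbe); first by rewrite muln_gt0 p0.
by rewrite oddM.
Qed.

(** The first member of the cascade not orthogonal to [a] is [a] itself or has
    pairing 1 with [a]; by Bessel's inequality the pairings with the others add
    up to at most 3 in absolute value. *)
Lemma csum_bound Psi l : subsystem Psi -> cascade_list Psi l ->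
  forall a, pos Psi a -> -2 <= csum l a <= 4.
Proof.
move=> + hl; elim: hl => [_ a []//|{}Psi C th {}l CC Hth hl IH SP a [Pa Dpa]].
have SP' := perp_subsystem th SP; have SC := comp_subsystem SP CC.
have Hl0 := cascade_list_strong SP (cascade_cons CC Hth hl).
have Cth : C th by case: Hth => -[].
have Dth := subD SC Cth; have Da := subD SP Pa.
have [a0|a0] := eqVneq (pr a th) 0.
  rewrite /csum big_cons a0 add0r; apply: IH => //; split=> //.
  by split=> //; apply/pr_B0 => //; exact: lattice_root.
have Ca : C a by apply: (comp_nonorth SP CC Cth) => //; rewrite pr_eq0C.
have ll : {subset l <= th :: l} by move=> b bl; rewrite inE bl orbT.
have [ath|/eqP ath] := eqVneq a th.
  rewrite /csum ath big_cons pr_self// big_seq big1 ?addr0// => b bl.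
  rewrite (so_pr Hl0) ?mem_head ?ll//.
  by case: Hl0 => /= /andP[tl _] _ _ _; apply: contraNneq tl => ->.
have a1 : pr a th = 1 by apply: (high_pr_eq1 SC Hth).
have := bessel Hl0 Da; rewrite big_cons a1 mul1r /csum big_cons a1.
have : `|\sum_(b <- l) pr a b| <= \sum_(b <- l) pr a b * pr b a.
  apply: le_trans (ler_norm_sum _ _ _) _; rewrite big_seq [leRHS]big_seq.
  by apply: ler_sum => b bl; apply: pr_mul_abs => //; exact/(so_D Hl0)/ll.
have : 1 <= pr th a by rewrite -gtz0_ge1 pr_gt0C// a1.
move: (\sum_(b <- l) pr a b) (\sum_(b <- l) _ * _) (pr th a); clear; lia.
Qed.

(** * Minimal elements of the cascade ideal *)

Lemma B_coroot a b : nspan D a -> D b -> B a (coroot B b) = (pr a b)%:~R.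
Proof.
move=> La Db; rewrite /coroot Bsym BZl Bsym mulrAC (rs_pr RS)//.
by rewrite mulfK// gt_eqF// (rs_pos RS).
Qed.

Lemma reflE a v : refl B a v = v - B v (coroot B a) *: a.
Proof.
rewrite /refl linfunE// => k x y.
by rewrite (rs_lin RS) scalerDl -scalerA scalerBr opprD addrACA.
Qed.

Lemma reflD a b : D a -> D b -> refl B a b = b - a *~ pr b a.
Proof. by move=> Da Db; rewrite reflE B_coroot ?scaler_int//; exact: lattice_root. Qed.

Lemma reflK a : D a -> cancel (refl B a) (refl B a).
Proof.
move=> Da v; rewrite !reflE BDl BNl BZl (B_coroot (lattice_root Da) Da) pr_self//.
set k := B v _; have -> : k - k * 2%:~R = - k by ring.
by rewrite scaleNr opprK subrK.
Qed.

Lemma weyl_inj w : weyl B D w -> injective w.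
Proof.
elim=> [|a {}w Da _ IH]; first by move=> x y; rewrite !id_lfunE.
by move=> x y; rewrite !comp_lfunE => /(can_inj (reflK Da))/IH.
Qed.

Lemma weyl_root w a : weyl B D w -> D a -> D (w a).
Proof.
move=> hw Da; elim: hw => [|b {}w Db _ IH]; first by rewrite id_lfunE.
by rewrite comp_lfunE reflD//; exact: (rs_refl RS).
Qed.

Lemma weyl_surj w a : weyl B D w -> D a -> exists2 b, D b & w b = a.
Proof.
move=> hw; elim: hw a => [a Da|b {}w Db _ IH a Da]; first by exists a; rewrite ?id_lfunE.
have Dba : D (refl B b a) by rewrite reflD//; exact: (rs_refl RS).
by have [c Dc e] := IH _ Dba; exists c; rewrite // comp_lfunE e reflK.
Qed.

Theorem min_cascade_ideal (wK : 'End(V)) :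
  irreducible B D ->
  (forall p : nat, (1 <= p)%N -> ~ type_A B Dp (2 * p)) ->
  weyl B D wK ->
  inversion_set Dp wK = pos_cascade B D Dp 1 `|` pos_cascade B D Dp 2 ->
  min_roots Dp (cascade_ideal B D Dp wK) = wK @` simple_cascade B D Dp (- 1)
  /\ (forall c, Dp c ->
        (min_roots Dp (cascade_ideal B D Dp wK) c <->
         simple_cascade B D Dp (- 1) ((wK^-1)%VF c))).
Proof.
move=> irrD notA hw inv.
have SD := subsystem_full; have [l hl] := cascade_list_exists SD.
have Hl := cascade_list_strong SD hl; have lD := so_D Hl.
have DDp : D `&` Dp = Dp by apply/seteqP; split=> [a []//|a Da]; split=> //; exact: posD.
have DD : irr_component B D D by split=> // c d _ [].
have KE : kostant_cascade B D Dp = [set` l].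
  apply/seteqP; split=> b.
    by move=> /(cascade_union_irr _ irrD)/(cascade_list_union _ SD hl).
  by move=> /(cascade_list_union _ SD hl)/(cascade_union_irr _ irrD).
have Bx a : nspan D a -> B a (cascade_element B D Dp) = 2^-1 * (csum l a)%:~R.
  move=> La; rewrite /cascade_element KE -fsbig_seq; last by case: Hl.
  rewrite Bsym BZl Bsym Bsumr /csum; congr (_ * _).
  rewrite (raddf_sum (intmul 1)) /= big_seq [RHS]big_seq.
  by apply: eq_bigr => b bl; rewrite B_coroot//; exact: lD.
have even a : D a -> (2 %| csum l a)%Z.
  move=> Da; have [h|[p [x [p0 hx]]]] := cascade_parity SD hl DD; first exact: h.
  exfalso; apply: (notA p p0); case: hx => h1 h2 _ _ _.
  have Dx i : (i < 2 * p)%N -> D (x i).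
    by move=> ii; have : simple D (x i) by [apply/h1; exists i]; rewrite DDp => -[/posD].
  exists (fun i : 'I_(2 * p) => x i); split.
  - move=> i j xij; apply/val_inj/eqP; apply/negPn/negP => ij.
    have := h2 i j (ltn_ord i) (ltn_ord j); rewrite xij pr_self; last exact/Dx/ltn_ord.
    by rewrite (negbTE ij); case: ifP.
  - apply/seteqP; split=> c.
      move=> [i _ <-]; have : simple D (x i) by apply/h1; exists i.
      by rewrite DDp.
    by rewrite -{1}DDp => /h1[i ii ->]; exists (Ordinal ii).
  - move=> i j; rewrite B_coroot; [|exact/lattice_root/Dx/ltn_ord|exact/Dx/ltn_ord].
    rewrite h2// (_ : (i == j :> nat) = (i == j))//.
    by case: (i == j) => //; case: ifP.
have [v vE] : exists v : V -> int, forall a, D a -> csum l a = v a * 2.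
  by exists (fun a => (csum l a %/ 2)%Z) => a /even; lia.
have vD a b : D a -> D b -> D (a + b) -> v (a + b) = v a + v b.
  move=> Da Db Dab; have := vE _ Dab.
  by rewrite csumD ?(vE a) ?(vE b)//; [lia|exact: lattice_root|exact: lattice_root].
have vN a : D a -> v (- a) = - v a.
  move=> Da; have := vE _ (Dopp Da).
  by rewrite csumN ?(vE a)//; [lia|exact: lattice_root].
have half (n : int) : 2^-1 * (n * 2)%:~R = n%:~R :> F.
  by rewrite intrM mulrC mulfK// pnatr_eq0.
have pcE a i : pos_cascade B D Dp i a <-> Dp a /\ v a = i.
  split=> -[Dpa h]; split=> //; have Da := posD Dpa.
    move: h; rewrite Bx ?vE//; last exact: lattice_root.
    by rewrite half => /intr_inj.
  rewrite Bx ?vE//; last exact: lattice_root.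
  by rewrite half h.
have vrange a : Dp a -> -1 <= v a <= 2.
  move=> Dpa; have := csum_bound SD hl (conj (posD Dpa) Dpa).
  by rewrite (vE _ (posD Dpa)); move: (v a); clear; lia.
have wD a : D a -> D (wK a) by exact: weyl_root.
have winj := weyl_inj hw.
have wN a : wK (- a) = - wK a by rewrite linearN.
have wpos a : Dp a -> Dp (wK a) <-> v a <= 0.
  move=> Dpa; have Dw := wD _ (posD Dpa).
  have : inversion_set Dp wK a <-> v a = 1 \/ v a = 2.
    rewrite inv; split=> [[/pcE[]|/pcE[]]|[h|h]]; auto; [left|right]; exact/pcE.
  move=> [h1 h2]; have rg := vrange _ Dpa; split.
    move=> Dpw; rewrite leNgt; apply/negP => v0; apply: (pos_neg Dpw).
    have [_ //] : inversion_set Dp wK a.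
    by apply: h2; move: (v a) v0 rg; clear; lia.
  move=> v0; have [//|nD] := pos_or_neg Dw.
  by have := h1 (conj Dpa nD); move: (v a) v0; clear; lia.
have wposN a : Dp a -> Dp (wK (- a)) <-> 0 < v a.
  move=> Dpa; have Dw := wD _ (posD Dpa); rewrite wN; split.
    by rewrite ltNge => Dpw; apply/negP => /(wpos _ Dpa) h; exact: (pos_neg h).
  by rewrite ltNge => h; have [/(wpos _ Dpa)|//] := pos_or_neg Dw; rewrite (negbTE h).
have pre d : Dp d -> exists u, [/\ D u, wK u = d, v u <= 0 & v u = 0 -> Dp u].
  move=> Dpd; have [u Du wu] := weyl_surj hw (posD Dpd); exists u; split=> //.
    have [Dpu|Dpu] := pos_or_neg Du; first by apply/wpos; rewrite ?wu.
    by have := (wposN _ Dpu).1; rewrite opprK wu vN// => /(_ Dpd); lia.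
  move=> v0; have [//|Dpu] := pos_or_neg Du.
  by have := (wposN _ Dpu).1; rewrite opprK wu vN// => /(_ Dpd); lia.
have preL s : {in s, forall c, Dp c} -> exists2 t : seq V,
    {in t, forall c, [/\ D c, v c <= 0 & v c = 0 -> Dp c]} &
    \sum_(c <- s) c = wK (\sum_(c <- t) c).
  elim: s => [|c s IH] h; first by exists [::]; rewrite ?big_nil ?linear0.
  have [|t tP e] := IH; first by move=> d ds; apply: h; rewrite inE ds orbT.
  have [u [Du wu v1 v2]] := pre c (h c (mem_head _ _)).
  exists (u :: t); first by move=> d; rewrite inE => /orP[/eqP->//|/tP].
  by rewrite !big_cons linearD /= wu e.
have csumL t : {in t, forall c, D c} -> csum l (\sum_(c <- t) c) = \sum_(c <- t) csum l c.
  elim: t => [|c t IH] h.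
    by rewrite !big_nil /csum big_seq big1// => b /lD Db; rewrite pr0.
  have ht : {in t, forall c, D c} by move=> d dt; apply: h; rewrite inE dt orbT.
  rewrite !big_cons csumD ?IH//; first exact/lattice_root/h/mem_head.
  by exists t.
have simpleD : simple_roots Dp = simple D by rewrite DDp.
have ideal_neg a : Dp a -> v a = -1 -> cascade_ideal B D Dp wK (wK a).
  by move=> Dpa va; left; exists a => //; apply/pcE.
have ideal_two a : Dp a -> v a = 2 -> cascade_ideal B D Dp wK (wK (- a)).
  by move=> Dpa va; right; exists a => //; apply/pcE.
have not_min d b e : cascade_ideal B D Dp wK b -> Dp e -> d = b + e ->
    ~ min_roots Dp (cascade_ideal B D Dp wK) d.
  move=> Ib Dpe dbe [_ /(_ b Ib)]; have [|t tS te] := nspan_simple SD (a := e).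
    by rewrite DDp.
  have le : root_le (simple_roots Dp) b d.
    by exists t; split; [rewrite simpleD|rewrite dbe addrC addKr].
  move=> /(_ le); rewrite dbe => /(congr1 (fun x => x - b)).
  rewrite subrr addrC addKr => e0.
  by have := root_neq0 (posD Dpe); rewrite -e0 eqxx.
have main : min_roots Dp (cascade_ideal B D Dp wK) = wK @` simple_cascade B D Dp (- 1).
  apply/seteqP; split=> [d mind|_ [a [Sa /pcE[Dpa va]] <-]].
    have [[[a /pcE[Dpa va] wa]|[a /pcE[Dpa va] wa]] _] := mind.
      exists a => //; split; last by apply/pcE.
      split=> // -[b [c [Dpb Dpc abc]]].
      have := vD b c (posD Dpb) (posD Dpc); rewrite -abc va => /(_ (posD Dpa)) vbc.
      have rb := vrange _ Dpb; have rc := vrange _ Dpc.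
      have [[vb vc]|[vb vc]] : v b = -1 /\ v c = 0 \/ v b = 0 /\ v c = -1 by lia.
        apply: (not_min d (wK b) (wK c)) mind; [exact: ideal_neg|by apply/wpos; rewrite ?vc|].
        by rewrite -wa abc linearD.
      apply: (not_min d (wK c) (wK b)) mind; [exact: ideal_neg|by apply/wpos; rewrite ?vb|].
      by rewrite -wa abc linearD /= addrC.
    (* The highest root has value 1, so [a] can be raised by a positive root [f],
       of value 0 or -1; either way one of the terms of [- a = f - (a + f)] lies in the
       preimage of the ideal and the other in that of the positive roots. *)
    exfalso; have [th Hth] := highest_root_exists SD irrD.
    have [[f [Df Dpf] Daf]|] := pselect (exists2 f, (D `&` Dp) f & D (a + f)); last first.
      move=> nf; have atop : top_root D a.
        split=> [|f Pf Daf]; first by rewrite DDp.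
        by apply: nf; exists f.
      have ath := top_root_unique SD irrD atop (high_top SD Hth).
      have thl := cascade_list_high SD hl DD Hth.
      have Da := posD Dpa; have : csum l a = 2.
        rewrite /csum (big_rem _ thl)/= -ath pr_self//.
        rewrite big_seq big1 ?addr0// => b; rewrite mem_rem_uniq; last by case: Hl.
        rewrite inE => /andP[bth bl]; rewrite ath; apply: (so_pr Hl) => //.
        by rewrite eq_sym -ath.
      by rewrite vE// va.
    have Da := posD Dpa; have Dpaf := pos_add Dpa Dpf Daf.
    have := vD _ _ Da Df Daf; rewrite va => vaf.
    have := vrange _ Dpaf; have := vrange _ Dpf => rf raf.
    have [vf|vf] : v f = 0 \/ v f = -1 by lia.
      apply: (not_min d (wK (- (a + f))) (wK f)) mind.
      - by apply: ideal_two => //; rewrite vaf vf.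
      - by apply/wpos; rewrite ?vf.
      - by rewrite -wa -linearD; congr (wK _); vring.
    apply: (not_min d (wK f) (wK (- (a + f)))) mind.
    - exact: ideal_neg.
    - by apply/wposN; rewrite ?vaf ?vf.
    - by rewrite -wa -linearD; congr (wK _); vring.
  split=> [|b Ib [s [sS e]]]; first exact: ideal_neg.
  have [u [Du wu vu u1]] : exists u, [/\ D u, wK u = b, v u <= -1 & v u = -1 -> Dp u].
    case: Ib => -[u /pcE[Dpu vu] wu].
      by exists u; split; rewrite ?vu//; exact: posD.
    have Du := posD Dpu; exists (- u); split; rewrite ?vN ?vu//; exact: Dopp.
  have [|t tP et] := preL s; first by move=> c /sS[].
  have tD : {in t, forall c, D c} by move=> c /tP[].
  have aut : a = u + \sum_(c <- t) c.
    by apply: winj; rewrite linearD /= wu -et -e addrC subrK.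
  have Lt : nspan D (\sum_(c <- t) c) by exists t.
  have := csumD lD (lattice_root Du) Lt; rewrite -aut csumL// (vE _ (posD Dpa)) (vE _ Du) va => ct.
  have t0 : {in t, forall c, 0 <= - csum l c}.
    by move=> c ct'; have [Dc vc _] := tP _ ct'; rewrite vE//; move: vc; clear; lia.
  have St : \sum_(c <- t) - csum l c = 0.
    apply/eqP; rewrite eq_le; apply/andP; split.
      by rewrite sumrN; move: (\sum_(c <- t) _) ct vu; clear; lia.
    by rewrite big_seq sumr_ge0.
  have Dpu : Dp u by apply: u1; move: ct; rewrite -[\sum_(c <- t) _]opprK -sumrN St; clear; lia.
  have tpos : {in t, forall c, (D `&` Dp) c}.
    move=> c ct'; have [Dc vc] := tP _ ct'; rewrite DDp; apply.
    by have := sum_ge0_eq0 t0 St ct'; rewrite vE//; clear; lia.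
  have [s1 s1S e1] := nspan_simple SD (conj Du Dpu).
  have [s2 s2S e2] : nspan (simple D) (\sum_(c <- t) c).
    by apply: nspan_simpleP => //; exists t.
  have Sa' : simple D a by rewrite -simpleD.
  have : perm_eq [:: a] (s1 ++ s2).
    apply: (simple_indep SD).
    - by move=> c; rewrite inE => /eqP->.
    - by move=> c; rewrite mem_cat => /orP[/s1S|/s2S].
    - by rewrite big_seq1 big_cat /= -e1 -e2.
  move=> /perm_size; rewrite size_cat /=.
  case: s2 s2S e2 => [|c s2] _ e2; first by rewrite aut e2 big_nil addr0 wu.
  case: s1 s1S e1 => [|c' s1] _ e1.
    by have := root_neq0 Du; rewrite e1 big_nil eqxx.
  by rewrite /= addSn addnS.
split=> // c Dpc; rewrite main.
have kw : lker wK == 0%VS by apply/lker0P.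
split=> [[a Ha <-]|h]; first by rewrite lker0_lfunK.
by exists ((wK^-1)%VF c) => //; rewrite lker0_lfunVK.
Qed.

End RootSystem.

(** * Bases of simultaneous eigenvectors *)
Section TraceBasis.
Variables (F : fieldType) (W : vectType F).
Local Notation n := (\dim {:W}).
Variables (e b : n.-tuple W).
Hypotheses (eB : basis_of {:W} e) (bB : basis_of {:W} b).

Lemma trace_mxof (f : 'End(W)) :
  \tr (mxof e e f) = \sum_i coord b i (f b`_i).
Proof.
have -> : mxof e e f = mxof e b f *m mxof b e \1%VF.
  by rewrite -mxof_comp// comp_lfun1l.
rewrite mxtrace_mulC -mxof_comp// comp_lfun1r /mxtrace.
apply: eq_bigr => i _; rewrite !mxE /=.
by rewrite vecof_delta.
Qed.

End TraceBasis.

Section EigenMatrix.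
Variables (F : fieldType) (W : vectType F).
Local Notation n := (\dim {:W}).
Variable e : n.-tuple W.
Hypothesis eB : basis_of {:W} e.

Lemma eigenbasis_diagonalizable (f : 'End(W)) (s : seq W) :
  basis_of fullv s -> (forall x, x \in s -> exists c, f x = c *: x) ->
  diagonalizable (mxof e e f).
Proof.
move=> sB sE; have sz : size s == n by rewrite (size_basis (X := in_tuple s)).
pose X := Tuple sz; have XB : basis_of fullv X by [].
pose P := \matrix_(i < n) rVof e X`_i.
have Pf : row_free P.
  apply: inj_row_free => u; rewrite mulmx_sum_row => u0.
  have : rVof e (\sum_i u 0 i *: X`_i) = 0.
    rewrite -[RHS]u0 linear_sum; apply: eq_bigr => i _.
    by rewrite linearZ /= rowK.
  move/eqP; rewrite rVof_eq0// => /eqP u0'.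
  apply/rowP => i; rewrite mxE.
  by move/freeP: (basis_free XB) => /(_ (fun i => u 0 i) u0').
have cP (i : 'I_n) : {c | f X`_i = c *: X`_i}.
  apply/cid/sE; rewrite -(tnth_nth 0); exact: mem_tnth.
exists P; first by rewrite -row_free_unit.
apply/diagonalizable_forPex; exists (\row_i sval (cP i)).
apply: simmxW => //; apply/row_matrixP => i.
rewrite !row_mul rowK -rVof_app// (svalP (cP i)) linearZ /=.
by rewrite row_diag_mx mxE -scalemxAl -rowE rowK.
Qed.

Lemma simultaneous_eigenbasis (fs : seq 'End(W)) :
  (forall f f', f \in fs -> f' \in fs -> (f \o f')%VF = (f' \o f)%VF) ->
  (forall f : 'End(W), f \in fs -> exists2 s : seq W, basis_of fullv s &
    forall x, x \in s -> exists c, f x = c *: x) ->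
  exists2 X : n.-tuple W, basis_of fullv X &
    forall f : 'End(W), f \in fs -> forall i : 'I_n, exists c, f X`_i = c *: X`_i.
Proof.
move=> fcomm fdiag.
have /codiagonalizableP[P Pu /allP PD] :
    {in [seq mxof e e f | f <- fs] &, forall A A', comm_mx A A'} /\
    {in [seq mxof e e f | f <- fs], forall A, diagonalizable A}.
  split=> [_ _ /mapP[f ff ->] /mapP[f' ff' ->]|_ /mapP[f ff ->]].
    by rewrite /comm_mx -!mxof_comp// fcomm.
  by have [s sB sE] := fdiag _ ff; exact: eigenbasis_diagonalizable sB sE.
pose X := [tuple vecof e (row i P) | i < n].
have XE (i : 'I_n) : X`_i = vecof e (row i P).
  by rewrite -tnth_nth tnth_mktuple.
exists X.
  rewrite basisEdim size_tuple leqnn andbT; apply/subvP => v _.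
  rewrite -(rVofK eB v) -(mulmxKV Pu (rVof e v)) mulmx_sum_row linear_sum.
  apply: rpred_sum => i _; rewrite linearZ /= -XE rpredZ// memv_span//.
  by rewrite -tnth_nth mem_tnth.
move=> f ff i; have /PD/= /diagonalizable_forPex[d /(simmxP Pu) h] :
  mxof e e f \in [seq mxof e e f | f <- fs] by exact: map_f.
exists (d 0 i); rewrite XE (hom_vecof e eB) -row_mul h row_mul row_diag_mx.
by rewrite -scalemxAl -rowE linearZ.
Qed.

End EigenMatrix.

(** * Brackets and the Killing form *)
Section LieBasics.
Variables (F : fieldType) (g : lieAlgebra F).
Local Notation br := (@lie_br F g).
Implicit Types x y z : g.

Lemma brDl x y z : br (x + y) z = br x z + br y z.
Proof. by have := @lie_br_linearl F g z 1 x y; rewrite !scale1r. Qed.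
Lemma brZl c x z : br (c *: x) z = c *: br x z.
Proof.
have br0 : br 0 z = 0 by apply: (addrI (br 0 z)); rewrite -brDl !addr0.
by have := @lie_br_linearl F g z c x 0; rewrite br0 !addr0.
Qed.
Lemma br_anti x y : br x y = - br y x.
Proof.
have := @lie_br_alt F g (x + y); rewrite brDl.
have brDr a b c : br c (a + b) = br c a + br c b.
  by have := @lie_br_linearr F g c 1 a b; rewrite !scale1r.
rewrite !brDr !lie_br_alt add0r addr0 => /eqP; rewrite addr_eq0 => /eqP; exact.
Qed.
Lemma brDr x y z : br z (x + y) = br z x + br z y.
Proof. by rewrite !(br_anti z) brDl opprD. Qed.
Lemma brZr c x z : br z (c *: x) = c *: br z x.
Proof. by rewrite !(br_anti z) brZl scalerN. Qed.
Lemma br0l z : br 0 z = 0. Proof. by have := brZl 0 0 z; rewrite !scale0r. Qed.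
Lemma br0r z : br z 0 = 0. Proof. by rewrite br_anti br0l oppr0. Qed.
Lemma brNr x z : br z (- x) = - br z x. Proof. by rewrite -scaleN1r brZr scaleN1r. Qed.
Lemma br_suml I (r : seq I) (p : pred I) (f : I -> g) z :
  br (\sum_(i <- r | p i) f i) z = \sum_(i <- r | p i) br (f i) z.
Proof. by apply: (big_morph (br^~ z)); [move=> *; exact: brDl|exact: br0l]. Qed.
Lemma br_sumr I (r : seq I) (p : pred I) (f : I -> g) z :
  br z (\sum_(i <- r | p i) f i) = \sum_(i <- r | p i) br z (f i).
Proof. by apply: (big_morph (br z)); [move=> *; exact: brDr|exact: br0r]. Qed.

Lemma br_leibniz x y z : br x (br y z) = br (br x y) z + br y (br x z).
Proof.
have := lie_jacobi x y z; rewrite (br_anti z (br x y)) (br_anti z x) brNr.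
by move/eqP; rewrite -addrA -opprD subr_eq0 addrC => /eqP ->; rewrite addrC.
Qed.

Lemma adE x y : ad x y = br x y.
Proof.
rewrite /ad linfunE// => c u v; exact: lie_br_linearr.
Qed.

Local Notation n := (\dim {:g}).
Local Notation e := (vbasis {:g}).
Let M x := mxof e e (ad x).

Lemma killingE x y : killing x y = \tr (M y *m M x).
Proof. by rewrite /killing (mxof_comp e e (vbasisP _)). Qed.

Lemma killingC x y : killing x y = killing y x.
Proof. by rewrite !killingE mxtrace_mulC. Qed.

Let ML c x y : M (c *: x + y) = c *: M x + M y.
Proof.
rewrite /M -linearP /=; congr (mxof _ _ _); apply/lfunP => z.
by rewrite add_lfunE scale_lfunE !adE brDl brZl.
Qed.

Let Mbr x y : M (br x y) = M y *m M x - M x *m M y.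
Proof.
rewrite /M -!(mxof_comp e e (vbasisP _)).
rewrite -linearB /=; congr (mxof _ _ _); apply/lfunP => z.
by rewrite add_lfunE opp_lfunE !comp_lfunE !adE br_leibniz addrK.
Qed.

Lemma killing_linl c x y z : killing (c *: x + y) z = c * killing x z + killing y z.
Proof. by rewrite !killingE ML mulmxDr mxtraceD -scalemxAr mxtraceZ. Qed.

Lemma killing_assoc x y z : killing (br x y) z = killing x (br y z).
Proof.
rewrite !killingE !Mbr mulmxBl mulmxBr !raddfB /= !mulmxA; congr (_ - _).
by rewrite mxtrace_mulC mulmxA.
Qed.

Lemma killingDl x y z : killing (x + y) z = killing x z + killing y z.
Proof. by rewrite -[x]scale1r killing_linl mul1r scale1r. Qed.
Lemma killing0l z : killing 0 z = 0.
Proof. by apply: (addrI (killing 0 z)); rewrite -killingDl !addr0. Qed.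
Lemma killingZl c x z : killing (c *: x) z = c * killing x z.
Proof. by rewrite -[c *: x]addr0 killing_linl killing0l addr0. Qed.
Lemma killingNl x z : killing (- x) z = - killing x z.
Proof. by rewrite -scaleN1r killingZl mulN1r. Qed.
Lemma killingDr x y z : killing z (x + y) = killing z x + killing z y.
Proof. by rewrite !(killingC z) killingDl. Qed.
Lemma killingZr c x z : killing z (c *: x) = c * killing z x.
Proof. by rewrite !(killingC z) killingZl. Qed.

Lemma killing_basis (b : n.-tuple g) x y : basis_of {:g} b ->
  killing x y = \sum_i coord b i (br x (br y b`_i)).
Proof.
move=> bB; rewrite /killing (trace_mxof (vbasisP _) bB).
by apply: eq_bigr => i _; rewrite comp_lfunE !adE.
Qed.

End LieBasics.

(** * Weights of the Cartan subalgebra *)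
Section Weights.
Variables (F : numFieldType) (g : lieAlgebra F) (t : {vspace g}).
Local Notation br := (@lie_br F g).
Local Notation n := (\dim {:g}).
Local Notation ev a h := (a (vsproj t h) : F).
Implicit Types (x y z h : g) (a : lie_dual t).

(** Weights are linear forms on the vector type of [t], so an element of [t] is
    first projected to that type. *)
Definition weight_vector a x := forall h, h \in t -> br h x = ev a h *: x.

Hypotheses (HS : lie_simple g) (HC : cartan_subalgebra t).

Lemma weight_basis_exists : exists (b : n.-tuple g) (lam : 'I_n -> lie_dual t),
  basis_of {:g} b /\ forall i, weight_vector (lam i) b`_i.
Proof.
have [tab _ tdiag] := HC.
have [||X XB XE] := simultaneous_eigenbasis (vbasisP {:g}) (fs := [seq ad h | h <- vbasis t]).
- move=> _ _ /mapP[h /vbasis_mem ht ->] /mapP[h' /vbasis_mem h't ->].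
  apply/lfunP => x; rewrite !comp_lfunE !adE br_leibniz.
  by rewrite (tab h h')// br0l add0r.
- move=> _ /mapP[h /vbasis_mem ht ->]; have [s [sB sE]] := tdiag _ ht.
  by exists s => // x /sE[c e]; exists c; rewrite adE.
have key h (i : 'I_n) : h \in t -> exists c, br h X`_i = c *: X`_i.
  move=> ht; rewrite (coord_vbasis ht) br_suml.
  have kc (k : 'I_(\dim t)) : exists c, br (vbasis t)`_k X`_i = c *: X`_i.
    have kt : (vbasis t)`_k \in (vbasis t : seq _) by rewrite mem_nth// size_tuple.
    have [c e] := XE _ (map_f _ kt) i; exists c; by rewrite -adE.
  have [f fE] := choice kc; exists (\sum_k coord (vbasis t) k h * f k).
  by rewrite scaler_suml; apply: eq_bigr => k _; rewrite brZl fE scalerA.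
exists X, (fun i : 'I_n => linfun (fun h : subvs_of t => coord X i (br (vsval h) X`_i) : F^o)).
split=> // i h ht; rewrite linfunE; last first.
  by move=> c u v; rewrite linearP brDl brZl linearP.
rewrite vsprojK//; have [c ->] := key h i ht.
by rewrite linearZ /= coord_free ?eqxx ?mulr1//; exact: (basis_free XB).
Qed.

Variables (b : n.-tuple g) (lam : 'I_n -> lie_dual t).
Hypotheses (bB : basis_of {:g} b) (bW : forall i, weight_vector (lam i) b`_i).
Local Notation co i x := (coord b i x).

Let coE x : x = \sum_i co i x *: b`_i.
Proof. exact: coord_basis bB (memvf x). Qed.

Let co_b (i j : 'I_n) : co i b`_j = (i == j)%:R.
Proof. by rewrite coord_free 1?eq_sym//; exact: basis_free bB. Qed.

Let b_neq0 (i : 'I_n) : b`_i != 0.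
Proof.
apply: contraTneq isT => e; have := co_b i i.
by rewrite e linear0 eqxx => /eqP; rewrite eq_sym oner_eq0.
Qed.

Lemma co_ext x y : (forall i, co i x = co i y) -> x = y.
Proof. by move=> h; rewrite (coE x) (coE y); apply: eq_bigr => i _; rewrite h. Qed.

Lemma br_t_co i h x : h \in t -> co i (br h x) = ev (lam i) h * co i x.
Proof.
move=> ht; rewrite {1}(coE x) br_sumr linear_sum (bigD1 i)//=.
rewrite brZr bW// !linearZ /= co_b eqxx mulr1 mulrC big1 ?addr0// => j ji.
by rewrite brZr bW// !linearZ /= co_b eq_sym (negbTE ji) !mulr0.
Qed.

Lemma weight_co a x i : weight_vector a x -> co i x != 0 -> lam i = a.
Proof.
move=> wx xi; apply/lfunP => h; have ht : vsval h \in t by exact: subvsP.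
have := br_t_co i x ht; rewrite (wx _ ht) linearZ /= vsvalK.
by move/(mulIf xi) => ->.
Qed.

Lemma weight_eq a x : (forall i, co i x != 0 -> lam i = a) -> weight_vector a x.
Proof.
move=> xa h ht; apply: co_ext => i; rewrite br_t_co// linearZ /=.
by have [->|/xa ->] := eqVneq (co i x) 0; rewrite ?mulr0.
Qed.

Lemma weight0 x : weight_vector 0 x <-> x \in t.
Proof.
have [tab tself _] := HC; split=> [w0|xt].
  by apply: tself => h ht; rewrite w0// lfunE /= scale0r.
by move=> h ht; rewrite lfunE /= scale0r tab.
Qed.

Lemma weight_br a c x y : weight_vector a x -> weight_vector c y ->
  weight_vector (a + c) (br x y).
Proof.
move=> wx wy h ht; rewrite br_leibniz (wx h)// (wy h)// brZl brZr -scalerDl.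
by rewrite add_lfunE.
Qed.

Lemma weightD a x y : weight_vector a x -> weight_vector a y -> weight_vector a (x + y).
Proof. by move=> wx wy h ht; rewrite brDr wx// wy// scalerDr. Qed.

Lemma weightZ a k x : weight_vector a x -> weight_vector a (k *: x).
Proof. by move=> wx h ht; rewrite brZr wx// !scalerA mulrC. Qed.

Lemma weight_neq0_co a x : weight_vector a x -> x != 0 -> exists i, lam i = a.
Proof.
move=> wx x0; have [i xi] : exists i, co i x != 0.
  apply: contrapT => h; move/eqP: x0; apply; apply: co_ext => i; rewrite linear0.
  by apply/eqP/negPn/negP => h'; apply: h; exists i.
by exists i; exact: weight_co wx xi.
Qed.

(** The zero of the definition of roots is the zero function, here it is the
    zero linear form. *)
Lemma rootP a : lie_roots t a <-> a != 0 /\ exists2 x, x != 0 & weight_vector a x.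
Proof.
split=> -[a0 [x x0 wx]].
  split; last by exists x => // h ht; have e := vsprojK ht; rewrite -{1}e wx.
  by apply: contraNneq a0 => ->; apply/eqP/funext => h; rewrite lfunE.
split; last by exists x => // h; rewrite wx ?subvsP// vsvalK.
by apply: contraNneq a0 => /= e; apply/eqP/lfunP => h; rewrite e lfunE.
Qed.

Lemma root_lam a : lie_roots t a -> exists i, lam i = a.
Proof. by move=> /rootP[_ [x x0 wx]]; exact: weight_neq0_co wx x0. Qed.

Lemma lam_root i : lam i != 0 -> lie_roots t (lam i).
Proof. by move=> l0; apply/rootP; split=> //; exists b`_i. Qed.

Lemma killing_t h h' : h \in t -> h' \in t ->
  killing h h' = \sum_i ev (lam i) h * ev (lam i) h'.
Proof.
move=> ht h't; rewrite (killing_basis _ _ bB); apply: eq_bigr => i _.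
by rewrite !br_t_co// co_b eqxx mulr1.
Qed.

Lemma killing_weight a c x y : weight_vector a x -> weight_vector c y -> a + c != 0 ->
  killing x y = 0.
Proof.
move=> wx wy ac; have [h] : exists h : subvs_of t, (a + c) h != 0.
  apply: contrapT => hh; move/eqP: ac; apply; apply/lfunP => h; rewrite [RHS]lfunE /=.
  by apply/eqP/negPn/negP => h'; apply: hh; exists h.
rewrite add_lfunE => ach; have ht : vsval h \in t by exact: subvsP.
have := killing_assoc x (vsval h) y; rewrite br_anti killingNl wx// wy//.
rewrite killingZl killingZr vsvalK => /eqP; rewrite -subr_eq0 -opprD oppr_eq0 -mulrDl.
by rewrite mulf_eq0 (negbTE ach) => /eqP.
Qed.

Lemma center0 x : (forall y, br y x = 0) -> x = 0.
Proof.
move=> xc; have [[u [v uv]] simple] := HS.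
have [y z|/eqP|full] := simple <[x]>%VS.
- by move=> /vlineP[k ->]; rewrite brZr xc scaler0 mem0v.
- by rewrite -dimv_eq0 dim_vline; have [->|] := eqVneq x 0.
have /vlineP[k vk] : v \in <[x]>%VS by rewrite full memvf.
by case: uv; rewrite vk brZr xc scaler0.
Qed.

Lemma t_eq0 h : h \in t -> (forall i, ev (lam i) h = 0) -> h = 0.
Proof.
move=> ht h0; apply: center0 => y; rewrite br_anti -[RHS]oppr0; congr (- _).
by apply: co_ext => i; rewrite br_t_co// h0 mul0r linear0.
Qed.

(** * Strings for a copy of sl2 *)

Section Strings.
Variables (al : lie_dual t) (e f : g).
Hypotheses (al0 : al != 0) (we : weight_vector al e) (wf : weight_vector (- al) f).
Let h := br e f.

Lemma h_t : h \in t.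
Proof. by apply/weight0; rewrite -(subrr al); exact: weight_br. Qed.

Lemma iter_weight (u : g) c d x k : weight_vector c u -> weight_vector d x ->
  weight_vector (d + c *+ k) (iter k (br u) x).
Proof.
move=> wu wx; elim: k => [|k IH]; first by rewrite mulr0n addr0.
by rewrite mulrSr addrA addrC iterS; exact: weight_br.
Qed.

Lemma iter_top (u : g) c d x : c != 0 -> weight_vector c u -> weight_vector d x ->
  x != 0 -> exists N, iter N (br u) x != 0 /\ iter N.+1 (br u) x = 0.
Proof.
move=> c0 wu wx x0.
have [m m0] : exists m, iter m (br u) x = 0.
  apply: contrapT => nz.
  have nz' k : iter k (br u) x != 0 by apply/eqP => h'; apply: nz; exists k.
  have [fi fiE] := choice (fun k => weight_neq0_co (iter_weight k wu wx) (nz' k)).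
  have inj : injective (fun k : 'I_n.+1 => fi k).
    move=> k1 k2 /(congr1 lam); rewrite !fiE => /addrI.
    have key (m1 m2 : nat) : (m1 < m2)%N -> c *+ m1 = c *+ m2 -> False.
      move=> m12 /eqP; rewrite eq_sym -subr_eq0 -mulrnBr 1?ltnW// -scaler_nat scaler_eq0.
      by rewrite (negbTE c0) orbF pnatr_eq0 subn_eq0 leqNgt m12.
    by move=> ek; apply/val_inj; case: (ltngtP (val k1) (val k2)) => // /key; case.
  by have := leq_card _ inj; rewrite !card_ord ltnn.
elim: m m0 => [/= x00|m IH m0]; first by rewrite x00 eqxx in x0.
have [/IH//|m1] := eqVneq (iter m (br u) x) 0.
by exists m.
Qed.

(** The usual recursion of sl2 for a vector killed by [e], doubled to avoid a
    division. *)
Lemma lower_raise d v k : weight_vector d v -> br e v = 0 ->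
  2 *: br e (iter k.+1 (br f) v) =
  (k.+1%:R * (2 * ev d h - k%:R * ev al h)) *: iter k (br f) v.
Proof.
move=> wv ev0; elim: k => [|k IH].
  rewrite /= br_leibniz ev0 br0r addr0 wv ?h_t// scalerA; congr (_ *: _); ring.
rewrite iterS br_leibniz scalerDr -/h -(brZr 2 (br e (iter k.+1 (br f) v)) f) IH brZr -iterS.
rewrite (iter_weight k.+1 wf wv h_t) scalerA -scalerDl; congr (_ *: _).
rewrite add_lfunE mulNrn opp_lfunE.
have -> : (al *+ k.+1) (vsproj t h) = k.+1%:R * ev al h.
  by rewrite -scaler_nat scale_lfunE.
ring.
Qed.

Lemma top_weight d v : weight_vector d v -> v != 0 -> br e v = 0 ->
  exists N, 2 * ev d h = N%:R * ev al h /\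
    forall j, (j <= N)%N -> iter j (br f) v != 0.
Proof.
move=> wv v0 ev0; have nal0 : - al != 0 by rewrite oppr_eq0.
have [N [N0 N1]] := iter_top nal0 wf wv v0.
exists N; split.
  have := lower_raise N wv ev0; rewrite N1 br0r scaler0 => /esym/eqP.
  rewrite scaler_eq0 (negbTE N0) orbF mulf_eq0 pnatr_eq0 /= subr_eq0 => /eqP//.
move=> j jN; apply: contraNneq N0 => j0; rewrite -(subnK jN) iterD j0.
by elim: (N - j)%N => //= m /eqP->; rewrite br0r.
Qed.

(** Going up with [e] to a highest weight vector and then down with [f]: the
    length [N] of the way down determines the highest weight at [h]. *)
Lemma root_string d x : weight_vector d x -> x != 0 ->
  exists k N : nat, 2 * ev d h = (N%:R - 2 * k%:R) * ev al h /\
    forall j, (j <= N)%N -> exists2 y, y != 0 & weight_vector (d + al *+ k - al *+ j) y.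
Proof.
move=> wx x0; have [k [k0 k1]] := iter_top al0 we wx x0.
have wv := iter_weight k we wx.
have [N [hN nz]] := top_weight wv k0 k1.
exists k, N; split.
  move: hN; rewrite add_lfunE -[(al *+ k) _]/((al *+ k) (vsproj t h)).
  have -> : (al *+ k) (vsproj t h) = k%:R * ev al h by rewrite -scaler_nat scale_lfunE.
  by move=> e1; rewrite mulrBl -e1; ring.
move=> j jN; exists (iter j (br f) (iter k (br e) x)); first exact: nz.
by rewrite -mulNrn; exact: iter_weight.
Qed.

End Strings.

Lemma string_ratio al e f i : al != 0 -> weight_vector al e -> weight_vector (- al) f ->
  exists q : int, 2 * ev (lam i) (br e f) = q%:~R * ev al (br e f).
Proof.
move=> al0 we wf; have [k [N [h _]]] := root_string al0 we wf (@bW i) (b_neq0 i).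
by exists (N%:Z - 2 * k%:Z); rewrite h intrB intrM.
Qed.

(** All weights are multiples of [al] at the bracket, and an element of [t]
    where all weights vanish is central. *)
Lemma coroot_eq0 al e f : al != 0 -> weight_vector al e -> weight_vector (- al) f ->
  ev al (br e f) = 0 -> br e f = 0.
Proof.
move=> al0 we wf h0; apply: t_eq0; first exact: h_t we wf.
move=> i; have [q] := string_ratio i al0 we wf; rewrite h0 mulr0 => /eqP.
by rewrite mulf_eq0 pnatr_eq0 => /eqP.
Qed.

(** Up to the square of the value of [al] at [h], the Killing form at [(h, h)]
    is a sum of rational squares, one of which, that of the weight [al], is not
    zero. *)
Lemma coroot_killing al e f : al != 0 -> weight_vector al e -> weight_vector (- al) f ->
  killing (br e f) (br e f) = 0 -> br e f = 0.
Proof.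
move=> al0 we wf; have ht := h_t we wf; rewrite killing_t// => k0.
apply: (coroot_eq0 al0) => //; apply/eqP/negPn/negP => a0.
have [e0|/(weight_neq0_co we)[j lj]] := eqVneq e 0.
  by rewrite e0 br0l linear0 linear0 eqxx in a0.
have [q qE] := choice (fun i => string_ratio i al0 we wf).
have : (\sum_i (q i) ^+ 2)%:~R * (ev al (br e f)) ^+ 2 = 0.
  rewrite (raddf_sum (intmul 1)) /= big_distrl /= -[RHS](mulr0 4%:R) -[in RHS]k0 big_distrr /=.
  apply: eq_bigr => i _; rewrite -expr2 -[4%:R]/((2 * 2)%:R) natrM.
  rewrite (_ : 2%:R * 2%:R * _ ^+ 2 = (2 * ev (lam i) (br e f)) ^+ 2); last by ring.
  by rewrite qE exprMn rmorphXn.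
move/eqP; rewrite mulf_eq0 expf_eq0 (negbTE a0) /= orbF intr_eq0.
rewrite psumr_eq0; last by move=> i _; exact: sqr_ge0.
move=> /allP/(_ j); rewrite mem_index_enum sqrf_eq0 => /(_ isT) /eqP q0.
have := qE j; rewrite q0 mul0r lj => /eqP.
by rewrite mulf_eq0 pnatr_eq0 (negbTE a0).
Qed.

Lemma weight_span_exists (q : pred 'I_n) : exists I : {vspace g},
  forall x, x \in I <-> forall i, ~~ q i -> co i x = 0.
Proof.
exists <<[seq b`_i | i : 'I_n <- enum q]>>%VS => x; split=> [xI i qi|h].
  rewrite (@coord_span _ _ _ (in_tuple _) _ xI) linear_sum big1// => k _.
  have /mapP[j jq ->] : (in_tuple [seq b`_i | i : 'I_n <- enum q])`_k
    \in [seq b`_i | i : 'I_n <- enum q] by exact: mem_nth.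
  rewrite linearZ /= co_b; have [ij|] := eqVneq i j; last by rewrite mulr0.
  by rewrite mem_enum -ij unfold_in (negbTE qi) in jq.
rewrite (coE x); apply: rpred_sum => i _.
have [qi|/h->] := boolP (q i); last by rewrite scale0r mem0v.
by apply/rpredZ/memv_span/map_f; rewrite mem_enum.
Qed.

(** The radical is an ideal. If it is everything, all brackets of opposite root
    vectors vanish, so the span of the root vectors is an ideal; it is not zero
    because the algebra is not abelian, and not everything because [t] is its
    own centralizer. *)
Lemma killing_nondeg x : (forall y, killing x y = 0) -> x = 0.
Proof.
pose K y := linfun (fun z => killing y z : F^o).
have KE y z : K y z = killing y z.
  by rewrite /K linfunE// => k u v; rewrite killingDr killingZr.
have Klin : linear K.
  by move=> k u v; apply/lfunP => z; rewrite add_lfunE scale_lfunE !KE killing_linl.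
have RE y : y \in lker (linfun K) <-> forall z, killing y z = 0.
  rewrite memv_ker linfunE//; split=> [/eqP e z|h]; first by rewrite -KE e lfunE.
  by apply/eqP/lfunP => z; rewrite KE h lfunE.
have [[u [v uv]] simple] := HS.
have [y z|R0|R1] := simple (lker (linfun K)).
- by move=> /RE h; apply/RE => w; rewrite br_anti killingNl killing_assoc h oppr0.
- by move=> /RE; rewrite R0 memv0 => /eqP.
exfalso; have k0 y : forall z, killing y z = 0 by apply/RE; rewrite R1 memvf.
have opp0 al e f : al != 0 -> weight_vector al e -> weight_vector (- al) f -> br e f = 0.
  by move=> al0 we wf; apply: (coroot_killing al0).
have [I IE] := weight_span_exists (fun i => lam i != 0).
have ideal : lie_ideal I.
  move=> y z /IE zI; apply/IE => k; rewrite negbK => /eqP lk.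
  rewrite (coE z) br_sumr linear_sum big1// => j _.
  have [lj|/zI->] := boolP (lam j != 0); last by rewrite scale0r br0r linear0.
  rewrite (coE y) br_suml linear_sum big1// => i _; rewrite brZl brZr !linearZ /=.
  have [ij|ij] := eqVneq (lam i + lam j) 0.
    have e1 : - lam j = lam i by apply/esym/eqP; rewrite -addr_eq0 ij.
    have wi : weight_vector (- lam j) b`_i by rewrite e1.
    by rewrite br_anti (opp0 _ _ _ lj (@bW j) wi) oppr0 linear0 !mulr0.
  rewrite (_ : co k _ = 0) ?mulr0//; apply/eqP/negPn/negP => ck.
  have := weight_co (weight_br (@bW i) (@bW j)) ck.
  by rewrite lk => /esym/eqP; rewrite (negbTE ij).
have [I0|I1] := simple I ideal.
  have lam0 i : lam i = 0.
    apply/eqP/negPn/negP => li; have : b`_i \in I.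
      by apply/IE => j lj; rewrite co_b; have [ji|//] := eqVneq j i; rewrite ji li in lj.
    by rewrite I0 memv0 (negbTE (b_neq0 i)).
  have allt y : y \in t by apply/weight0; apply: weight_eq => i _; exact: lam0.
  by have [tab _ _] := HC; apply: uv; apply: tab.
have lamn0 i : lam i != 0.
  apply/negP => /eqP li; have : b`_i \in I by rewrite I1 memvf.
  by move=> /IE/(_ i); rewrite li eqxx co_b eqxx => /(_ isT)/eqP; rewrite oner_eq0.
have t0 h : h \in t -> h = 0.
  move=> /weight0 w0; apply: co_ext => i; rewrite linear0; apply/eqP/negPn/negP => ci.
  by have := lamn0 i; rewrite (weight_co w0 ci) eqxx.
have all0 y : y = 0.
  by apply: (t0); have [_ tself _] := HC; apply: tself => h /t0 ->; rewrite br0l.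
by apply: uv; exact: all0.
Qed.

Lemma killing_t_nondeg h : h \in t -> (forall h', h' \in t -> killing h h' = 0) -> h = 0.
Proof.
move=> ht h0; apply: killing_nondeg => y.
suff kb (i : 'I_n) : killing h b`_i = 0.
  rewrite (coE y); elim/big_rec: _ => [|i z _ IH]; first by rewrite killingC killing0l.
  by rewrite killingDr killingZr kb mulr0 IH addr0.
have [li|li] := eqVneq (lam i) 0.
  by apply: h0; apply/weight0; rewrite -li.
by apply: (@killing_weight 0 (lam i)) => //; [exact/weight0|rewrite add0r].
Qed.

(** The Killing form pairs weight spaces of opposite weights only, and is
    nondegenerate. *)
Lemma opposite_exists a x : weight_vector a x -> x != 0 ->
  exists2 y, weight_vector (- a) y & killing x y != 0.
Proof.
move=> wx x0; have [i ki] : exists i : 'I_n, killing x b`_i != 0.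
  apply: contrapT => h; move/eqP: x0; apply; apply: killing_nondeg => y.
  rewrite (coE y); elim/big_rec: _ => [|i z _ IH]; first by rewrite killingC killing0l.
  rewrite killingDr killingZr IH addr0 (_ : killing x b`_i = 0) ?mulr0//.
  by apply/eqP/negPn/negP => h'; apply: h; exists i.
exists b`_i => //; have -> : - a = lam i; last exact: bW.
apply/esym/eqP; rewrite -addr_eq0 addrC; apply/negPn/negP => al.
by rewrite (killing_weight wx (@bW i) al) eqxx in ki.
Qed.

Let iso := killing_iso t.

Lemma isoE (h h' : subvs_of t) : iso h h' = killing (vsval h) (vsval h').
Proof.
have lin u : linear (fun h' : subvs_of t => killing (vsval u) (vsval h') : F^o).
  by move=> k v w; rewrite linearP /= killingDr killingZr.
rewrite /iso /killing_iso linfunE; first by rewrite linfunE.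
move=> k u v; apply/lfunP => w; rewrite add_lfunE scale_lfunE !linfunE//.
by rewrite linearP killing_linl.
Qed.

Lemma iso_inj : lker iso == 0%VS.
Proof.
apply/lker0P => u v uv; apply/eqP; rewrite -subr_eq0; apply/eqP.
have uv0 : vsval (u - v) = 0.
  apply: killing_t_nondeg; first exact: subvsP.
  move=> h' ht'; have e := vsprojK ht'.
  by rewrite -e -isoE linearB /= uv subrr lfunE.
apply: (@subvs_inj _ _ t); exact: uv0.
Qed.

Lemma iso_surj a : a \in limg iso.
Proof.
suff -> : limg iso = fullv by exact: memvf.
apply/eqP; rewrite eqEdim subvf /= limg_dim_eq; last first.
  by rewrite (eqP iso_inj) capv0.
by rewrite !dimvf /dim /= muln1.
Qed.

(** The element of [t] that represents [a] through the Killing form. *)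
Definition dual_elt a : g := vsval ((iso^-1)%VF a).
Local Notation du := dual_elt.

Lemma du_t a : du a \in t. Proof. exact: subvsP. Qed.

Lemma killing_du a h : h \in t -> killing (du a) h = ev a h.
Proof.
by move=> ht; have e := vsprojK ht; rewrite -{1}e /du -isoE limg_lfunVK ?iso_surj.
Qed.

Lemma killing_dualE a c : killing_dual t a c = ev a (du c).
Proof. by rewrite -killing_du ?du_t. Qed.

Lemma du_eq0 a : du a = 0 -> a = 0.
Proof.
move=> a0; apply/lfunP => h; have := killing_du a (subvsP h).
by rewrite a0 killing0l vsvalK => <-; rewrite lfunE.
Qed.

Lemma br_du a x y : weight_vector a x -> weight_vector (- a) y ->
  br x y = killing x y *: du a.
Proof.
move=> wx wy; apply/eqP; rewrite -subr_eq0; apply/eqP; apply: killing_t_nondeg.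
  by rewrite rpredB ?rpredZ ?du_t//; exact: h_t wx wy.
move=> h ht; rewrite killingDl killingNl killingZl killing_du//.
rewrite killingC -killing_assoc wx// killingZl; apply/eqP; rewrite subr_eq0; apply/eqP; ring.
Qed.

(** * The roots form an irreducible root system *)

Local Notation B := (killing_dual t).
Local Notation D := (lie_roots t).

Lemma dual_sym a c : B a c = B c a.
Proof. exact: killingC. Qed.

Lemma dual_lin k a c d : B (k *: a + c) d = k * B a d + B c d.
Proof. by rewrite !killing_dualE add_lfunE scale_lfunE. Qed.

Lemma dual0l c : B 0 c = 0.
Proof. by rewrite killing_dualE lfunE. Qed.

(** This trace formula makes the form positive on the roots and on their span. *)
Lemma dual_sum a c : B a c = \sum_i B (lam i) a * B (lam i) c.
Proof.
rewrite /killing_dual -!/(dual_elt _) killing_t ?du_t//.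
by apply: eq_bigr => i _; rewrite -!killing_dualE.
Qed.

Lemma sl2_exists a : D a -> exists e f, [/\ weight_vector a e, weight_vector (- a) f,
  e != 0, f != 0 & br e f = du a].
Proof.
move=> /rootP[a0 [e e0 we]]; have [f wf ef] := opposite_exists we e0.
exists e, ((killing e f)^-1 *: f); split=> //; first exact: weightZ.
  rewrite scaler_eq0 invr_eq0 (negbTE ef) /=; apply: contraNneq ef => ->.
  by rewrite killingC killing0l.
by rewrite brZr (br_du we wf) scalerA mulVf// scale1r.
Qed.

Lemma root_ne0 a : D a -> a != 0. Proof. by case/rootP. Qed.

Lemma dual_neq0 a : D a -> B a a != 0.
Proof.
move=> Da; have [e [f [we wf _ _ ef]]] := sl2_exists Da; have a0 := root_ne0 Da.
rewrite killing_dualE -ef; apply: contraNneq (a0) => /(coroot_eq0 a0 we wf).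
by rewrite ef => /du_eq0 ->.
Qed.

Lemma dual_ratio a i : D a -> exists q : int, 2 * B (lam i) a = q%:~R * B a a.
Proof.
move=> Da; have [e [f [we wf _ _ ef]]] := sl2_exists Da.
by have := string_ratio i (root_ne0 Da) we wf; rewrite ef -!killing_dualE.
Qed.

(** The trace formula expresses the norm as its own square times a positive
    rational. *)
Lemma dual_pos a : D a -> 0 < B a a.
Proof.
move=> Da; have a0 := dual_neq0 Da; have [q qE] := choice (fun i => dual_ratio i Da).
have : 4%:R = (\sum_i (q i) ^+ 2)%:~R * B a a.
  apply: (mulIf a0); rewrite {1}dual_sum big_distrr /= -mulrA.
  rewrite (raddf_sum (intmul 1)) /= big_distrl /=.
  apply: eq_bigr => i _; transitivity ((2 * B (lam i) a) ^+ 2); first by ring.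
  by rewrite qE rmorphXn /=; ring.
have q0 : 0 <= \sum_i (q i) ^+ 2 by apply: sumr_ge0 => i _; exact: sqr_ge0.
move=> e; have qn0 : \sum_i (q i) ^+ 2 != 0.
  by apply/eqP => z; move/eqP: e; rewrite z mul0r pnatr_eq0.
have qp : 0 < (\sum_i (q i) ^+ 2)%:~R :> F by rewrite ltr0z lt_def qn0.
by rewrite -(pmulr_rgt0 _ qp) -e ltr0n.
Qed.

Lemma dual_int a c : nspan D a -> D c -> exists q : int, 2 * B a c = q%:~R * B c c.
Proof.
move=> [s sD ->] Dc; elim: s sD => [|x s IH] sD.
  by exists 0; rewrite big_nil dual0l mulr0 mul0r.
have [|q1 h1] := IH; first by move=> d ds; apply: sD; rewrite inE ds orbT.
have [j lj] := root_lam (sD x (mem_head _ _)); have [q2 h2] := dual_ratio j Dc.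
exists (q2 + q1); rewrite big_cons -[x]scale1r dual_lin mul1r mulrDr h1 -lj h2.
by rewrite intrD mulrDl.
Qed.

Lemma dual_string a c (q : int) (m : nat) : D a -> D c -> 2 * B c a = q%:~R * B a a ->
  m%:Z <= q -> exists2 y, y != 0 & weight_vector (c - a *+ m) y.
Proof.
move=> Da Dc qE mq; have [e [f [we wf _ _ ef]]] := sl2_exists Da.
have /rootP[_ [x x0 wx]] := Dc.
have [k [N [h str]]] := root_string (root_ne0 Da) we wf wx x0.
have qN : q = N%:Z - 2 * k%:Z.
  apply/eqP; rewrite -(eqr_int F); apply/eqP; apply: (mulIf (dual_neq0 Da)).
  by rewrite -qE killing_dualE -ef h killing_dualE -ef intrB intrM.
have [|y y0 wy] := str (k + m)%N; first by lia.
exists y => //; rewrite (_ : c - a *+ m = c + a *+ k - a *+ (k + m))//.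
by rewrite mulrnDr opprD addrA addrK.
Qed.

Lemma root_opp a : D a -> D (- a).
Proof.
move=> Da; have [e [f [_ wf _ f0 _]]] := sl2_exists Da.
by apply/rootP; split; [rewrite oppr_eq0 root_ne0|exists f].
Qed.

Lemma dual_opp a c : B (- a) c = - B a c.
Proof.
have := dual_lin (-1) a 0 c; rewrite scaleN1r addr0 mulN1r => ->.
by rewrite dual0l addr0.
Qed.

(** For a nonnegative pairing the reflected root lies on the way down of the
    string; the other case follows by replacing [a] with its opposite. *)
Lemma root_reflect a c (q : int) : D a -> D c -> 2 * B c a = q%:~R * B a a ->
  D (c - a *~ q).
Proof.
have ge0 u (p : int) : D u -> D c -> 2 * B c u = p%:~R * B u u -> 0 <= p -> D (c - u *~ p).
  case: p => // m Du Dc pE _; have [y y0 wy] := dual_string Du Dc pE (lexx _).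
  apply/rootP; split; last by exists y.
  rewrite subr_eq0; apply: contraNneq (root_ne0 Dc) => cum.
  have e1 : B c u = m%:R * B u u.
    by rewrite {1}cum -pmulrn -scaler_nat -[_ *: _]addr0 dual_lin dual0l addr0.
  move: pE; rewrite e1 mulrA => /(mulIf (dual_neq0 Du))/eqP.
  rewrite -[m%:~R]mul1r -subr_eq0 -pmulrn -mulrBl mulf_eq0 -(natrB _ (isT : 1 <= 2)%N).
  by rewrite oner_eq0 pnatr_eq0 /= => /eqP m0; rewrite cum m0 mulr0z.
move=> Da Dc qE; have [q0|/ltW q0] := leP 0 q; first exact: ge0.
have -> : c - a *~ q = c - (- a) *~ (- q) by rewrite mulrNz mulNrz opprK.
apply: ge0 => //; [exact: root_opp| |by rewrite oppr_ge0].
rewrite dual_sym !dual_opp (dual_sym a (- a)) dual_opp opprK mulrN (dual_sym a c) qE.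
by rewrite mulrNz mulNr.
Qed.

(** From a vector of weight [a *+ 2], going up and then down reaches weight [a]
    at a vector which must be a multiple of [e], hence is killed by [e]; but the
    recursion of sl2 gives a nonzero result. *)
Lemma root_double a : D a -> ~ D (a *+ 2).
Proof.
move=> Da /rootP[_ [y0 y00 wy0]]; have a0 := root_ne0 Da.
have [e [f [we wf e0 f0 ef]]] := sl2_exists Da.
have c0 : ev a (br e f) != 0 by rewrite ef -killing_dualE dual_neq0.
have kef : killing e f != 0.
  apply: contraNneq c0 => k0; by rewrite (br_du we wf) k0 scale0r linear0 linear0.
have we' : weight_vector (- - a) e by rewrite opprK.
have na0 : - a != 0 by rewrite oppr_eq0.
(* Root spaces are lines: a vector of weight [a] that is Killing-orthogonal to [f]
   commutes with [f], so it is a lowest weight vector of positive weight. *)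
have line x : weight_vector a x -> exists k, x = k *: e.
  move=> wx; exists (killing x f / killing e f).
  apply/eqP; rewrite -subr_eq0; set y := x - _; apply/negPn/negP => yn0.
  have wy : weight_vector a y by rewrite /y -scaleNr; apply: weightD => //; exact: weightZ.
  have fy : br f y = 0.
    rewrite br_anti (br_du wy wf) /y killingDl killingNl killingZl divfK// subrr.
    by rewrite scale0r oppr0.
  have [N [hN _]] := top_weight na0 wf we' wy yn0 fy.
  move: hN; rewrite opp_lfunE br_anti !linearN /= opprK => /eqP.
  rewrite mulrN eqr_oppLR -addr_eq0 -mulrDl mulf_eq0 (negbTE c0) orbF.
  by rewrite -natrD pnatr_eq0.
have [m [ym0 ym1]] := iter_top a0 we wy0 y00.
have wym := iter_weight m we wy0; rewrite -mulrnDr in wym.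
set v := iter m (br e) y0 in ym0 ym1 wym.
have lr j := lower_raise we wf j wym ym1.
have evp : ev (a *+ (2 + m)) (br e f) = (2 + m)%:R * ev a (br e f).
  by rewrite -scaler_nat scale_lfunE.
have cn0 j : (j <= m)%N ->
    (j.+1%:R * (2 * ev (a *+ (2 + m)) (br e f) - j%:R * ev a (br e f))) != 0.
  move=> jm; rewrite evp mulrA -mulrBl !mulf_eq0 pnatr_eq0 (negbTE c0) orbF /=.
  have le : (j <= 2 * (2 + m))%N by move: jm; clear; lia.
  by rewrite -natrM -natrB// pnatr_eq0; move: jm; clear; lia.
have vn0 j : (j <= m)%N -> iter j (br f) v != 0.
  elim: j => // j IH jm; apply/eqP => v0; have := lr j; rewrite v0 br0r scaler0.
  move/esym/eqP; rewrite scaler_eq0 (negbTE (cn0 j _)) /=; last exact: ltnW.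
  by apply/negP/IH/ltnW.
have [k vk] : exists k, iter m.+1 (br f) v = k *: e.
  apply: line; have := iter_weight m.+1 wf wym.
  by rewrite mulNrn -mulrnBr ?addnS ?add1n ?subSnn//; lia.
have := lr m; rewrite vk brZr lie_br_alt !scaler0 => /esym/eqP.
by rewrite scaler_eq0 (negbTE (cn0 m _))// (negbTE (vn0 m _)).
Qed.

Theorem lie_root_system : exists pr, root_system B D pr.
Proof.
pose pr a c := if pselect (exists q : int, 2 * B a c = q%:~R * B c c) is left h
  then projT1 (cid h) else 0.
have prE a c : nspan D a -> D c -> 2 * B a c = (pr a c)%:~R * B c c.
  move=> La Dc; rewrite /pr; case: pselect => [h|]; first by case: cid.
  by case; exact: dual_int.
have sq_ge0 a i : nspan D a -> 0 <= B (lam i) a * B (lam i) a.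
  move=> La; have [l0|l0] := eqVneq (lam i) 0.
    by rewrite l0 killing_dualE lfunE mulr0.
  have Dl := lam_root l0; have := prE a (lam i) La Dl; rewrite dual_sym => h.
  rewrite -expr2 -realEsqr -[B _ _](mulKf (x := 2)) ?pnatr_eq0// h.
  by rewrite !realM ?realV ?realn ?rpred_int ?gtr0_real// dual_pos.
exists pr; split.
- exact: dual_sym.
- exact: dual_lin.
- apply: (@sub_finite_set _ _ [set` [seq lam i | i <- enum 'I_n]]); last exact: finite_seq.
  by move=> a /root_lam[i <-] /=; apply: map_f; rewrite mem_enum.
- exact: root_opp.
- exact: dual_pos.
- exact: prE.
- by move=> a c Da Dc; apply: root_reflect => //; apply: prE => //; exact: nspan_in.
- move=> a c Da Dc ac pr0.
  have pr1 : 1%:Z <= pr a c by rewrite -gtz0_ge1.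
  have [y y0 wy] := dual_string Dc Da (prE a c (nspan_in Da) Dc) pr1.
  apply/rootP; split; last by exists y.
  by rewrite subr_eq0; apply/eqP.
- exact: root_double.
- by move=> a La; rewrite dual_sum sumr_ge0// => i _; exact: sq_ge0.
- move=> a La /eqP; rewrite dual_sum psumr_eq0 => [/allP h|i _]; last exact: sq_ge0.
  apply: du_eq0; apply: t_eq0; first exact: du_t.
  move=> i; have := h i (mem_index_enum _); rewrite mulf_eq0 orbb => /eqP.
  by rewrite killing_dualE.
Qed.

Lemma lie_roots_nonempty : exists i, lam i != 0.
Proof.
apply: contrapT => h; have lam0 i : lam i = 0.
  by apply/eqP/negPn/negP => li; apply: h; exists i.
have allt y : y \in t by apply/weight0; apply: weight_eq => i _; exact: lam0.
have [[u [v uv]] _] := HS; have [tab _ _] := HC; apply: uv; exact: tab.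
Qed.

(** For a subset [C] orthogonal to its complement, the root vectors with weight
    in [C] and the dual elements of [C] span an ideal. *)
Theorem lie_roots_irreducible : irreducible B D.
Proof.
split; first by have [i li] := lie_roots_nonempty; exists (lam i); exact: lam_root.
move=> C CD Co; have [->|/eqP/set0P[al Cal]] := pselect (C = set0); first by left.
right; apply/seteqP; split=> // be Dbe; apply: contrapT => nCbe.
pose gens := [seq b`_i | i : 'I_n <- enum [pred i | `[< C (lam i) >]]]
  ++ [seq du (lam i) | i : 'I_n <- enum [pred i | `[< C (lam i) >]]].
have gensb i : C (lam i) -> b`_i \in <<gens>>%VS.
  move=> Ci; apply/memv_span; rewrite mem_cat; apply/orP; left; apply/map_f.
  by rewrite mem_enum inE.
have genst i : C (lam i) -> du (lam i) \in <<gens>>%VS.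
  move=> Ci; apply/memv_span; rewrite mem_cat; apply/orP; right.
  by apply: (map_f (fun i => du (lam i))); rewrite mem_enum inE.
have gensP (X : g -> Prop) : (forall i, C (lam i) -> X b`_i /\ X (du (lam i))) ->
    X 0 -> (forall k x y, X x -> X y -> X (k *: x + y)) ->
    forall x, x \in <<gens>>%VS -> X x.
  move=> Xi X0 Xl x xI; rewrite (@coord_span _ _ _ (in_tuple _) _ xI).
  elim/big_rec: _ => // k z _ Xz; apply: Xl => //.
  have : (in_tuple gens)`_k \in gens by exact: mem_nth.
  by rewrite mem_cat => /orP[] /mapP[j]; rewrite mem_enum inE => Cj ->; case: (Xi j Cj).
have genw d x : C d -> weight_vector d x -> x \in <<gens>>%VS.
  move=> Cd wx; rewrite (coE x); apply: rpred_sum => i _.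
  have [->|xi] := eqVneq (co i x) 0; first by rewrite scale0r mem0v.
  by apply/rpredZ/gensb; rewrite (weight_co wx xi).
have Bdiag a : B a a = 0 -> D a -> False.
  by move=> h Da; have := dual_neq0 Da; rewrite h eqxx.
have [[u [v uv]] simple] := HS.
have ideal : lie_ideal <<gens>>%VS.
  move=> y; apply: (gensP (fun z => br y z \in <<gens>>%VS)) => [i Ci||k x x' hx hx'] /=; last first.
  - by rewrite brDr brZr rpredD ?rpredZ.
  - by rewrite br0r mem0v.
  have Di := CD _ Ci.
  rewrite (coE y) !br_suml; split; apply: rpred_sum => j _; rewrite brZl; apply: rpredZ.
    have [lj|lj] := eqVneq (lam j) 0.
      apply: (genw (lam i)) => //; have := weight_br (@bW j) (@bW i).
      by rewrite lj add0r.
    have Dj := lam_root lj.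
    have [ij|ij] := eqVneq (lam j + lam i) 0.
      have e1 : - lam i = lam j by apply/esym/eqP; rewrite -addr_eq0 ij.
      have wj : weight_vector (- lam i) b`_j by rewrite e1.
      by rewrite br_anti (br_du (@bW i) wj) rpredN rpredZ// genst.
    have wij := weight_br (@bW j) (@bW i).
    have [->|bij] := eqVneq (br b`_j b`_i) 0; first by rewrite mem0v.
    have Dij : D (lam j + lam i) by apply/rootP; split=> //; exists (br b`_j b`_i).
    apply: (genw (lam j + lam i)) => //; apply: contrapT => nCij.
    (* A sum outside [C] is orthogonal to [lam i]. If [lam j] is in [C], the sum is
       orthogonal to both terms, hence to itself; if not, [lam i] is orthogonal to
       [lam j], hence to itself. *)
    have Bi : B (lam i) (lam j + lam i) = 0 by apply: Co.
    have Bj : B (lam j) (lam j + lam i) = 0.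
      have [Cj|nCj] := pselect (C (lam j)); first by apply: Co.
      exfalso; apply: (Bdiag (lam i)) => //; have := Bi; rewrite dual_sym.
      rewrite -[lam j]scale1r dual_lin mul1r [B (lam j) _]dual_sym.
      by rewrite (Co (lam i) (lam j)) ?add0r.
    apply: (Bdiag _ _ Dij); rewrite -[lam j in X in killing_dual _ X _]scale1r dual_lin Bi Bj.
    by rewrite mulr0 addr0.
  rewrite br_anti rpredN (@bW j _ (du_t _)) -killing_dualE.
  have [lj|lj] := eqVneq (lam j) 0.
    by rewrite lj killing_dualE lfunE scale0r mem0v.
  have [Cj|nCj] := pselect (C (lam j)); first by rewrite rpredZ// gensb.
  by rewrite dual_sym Co ?scale0r ?mem0v//; split=> //; exact: lam_root.
have [I0|I1] := simple <<gens>>%VS ideal.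
  have [i li] := root_lam (CD _ Cal); have : b`_i \in <<gens>>%VS by apply: gensb; rewrite li.
  by rewrite I0 memv0 (negbTE (b_neq0 i)).
have [j lj] := root_lam Dbe.
have : co j b`_j = 0.
  apply: (gensP (fun x => co j x = 0)); last by rewrite I1 memvf.
  - move=> i Ci; rewrite co_b; have [ji|ji] := eqVneq j i.
      by rewrite -ji lj in Ci.
    split=> //; apply/eqP/negPn/negP => cj.
    have w0 : weight_vector 0 (du (lam i)) by apply/weight0; exact: du_t.
    by have := root_ne0 Dbe; rewrite -lj (weight_co w0 cj) eqxx.
  - exact: linear0.
  - by move=> k x y /= hx hy; rewrite linearP /= hx hy mulr0 addr0.
by rewrite co_b eqxx => /eqP; rewrite oner_eq0.
Qed.

End Weights.

Theorem theorem6p6 (R : realType) (g : lieAlgebra R[i]) (t : {vspace g})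
    (Dp : set (lie_dual t)) (wK : 'End(lie_dual t)) :
  let D := lie_roots t in
  let B := killing_dual t in
  lie_simple g ->
  cartan_subalgebra t ->
  positive_system D Dp ->
  (forall p : nat, (1 <= p)%N -> ~ type_A B Dp (2 * p)) ->
  weyl B D wK ->
  inversion_set Dp wK = pos_cascade B D Dp 1 `|` pos_cascade B D Dp 2 ->
  min_roots Dp (cascade_ideal B D Dp wK) = wK @` simple_cascade B D Dp (- 1)
  /\ (forall c, Dp c ->
        (min_roots Dp (cascade_ideal B D Dp wK) c <->
         simple_cascade B D Dp (- 1) ((wK^-1)%VF c))).

Proof.
move=> D B HS HC PS notA hw inv.
have [b [lam [bB bW]]] := weight_basis_exists HC.
have [pr RS] := lie_root_system HS HC bB bW.
have irr := lie_roots_irreducible HS HC bB bW.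
exact: (min_cascade_ideal RS PS irr notA hw inv).
Qed.
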